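(* Let $N\ge2$ and $\mu\in\mathbb{R}$ with $|\mu|>v_N$. Let $Y=(Y_1,\dots,Y_N)$ be a one-dimensional Brownian Bee system with drift $\mu$, started from an arbitrary initial condition, ordered so that $Y_1(t)\le\dots\le Y_N(t)$. Then almost surely $$\lim_{t\to\infty}\frac{Y_1(t)}{t}=\Big(1-\frac{v_N}{|\mu|}\Big)\mu .$$
   Context: Brunet–Derrida system in $\mathbb{R}$ with $N\ge2$ particles, score function $s:\mathbb{R}\to\mathbb{R}$ and drift $\mu\in\mathbb{R}$: let $(J_i)_{i\ge0}$ ($J_0=0$) be the jump times of a Poisson process of rate $N$, $(K_i)_{i\ge1}$ i.i.d. uniform on $\{1,\dots,N\}$, and independent standard Brownian motions, all mutually independent. Between jump times each particle moves as an independent Brownian motion with drift $\mu$ (i.e. $B(t)+\mu t$). At each time $J_i$, the particle with minimal score $s(Y_n(J_i^-))$ (ties broken arbitrarily) is removed and replaced by a copy of the particle $Y_{K_i}(J_i^-)$ (equivalently, the minimal-score particle jumps to the position $Y_{K_i}(J_i^-)$; if it is that same particle nothing happens). At all times particles are relabelled so that $Y_1(t)\le\dots\le Y_N(t)$. An N-BBM (killing from the left) is the case $s(x)=x$, $\mu=0$. A one-dimensional Brownian Bee system with drift $\mu$ is the case $s(x)=-|x|$ (the particle furthest from the origin is removed). It is a known fact (cited in the paper) that for an N-BBM, for any initial condition, $X_1(t)/t\to v_N$ almost surely as $t\to\infty$, where $v_N>0$ is a deterministic constant depending only on $N$, called the asymptotic speed of the N-BBM. *)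

(* Defs.v *)
From mathcomp Require Import all_boot all_order all_algebra.
From mathcomp Require Import all_classical all_reals all_analysis.
Import Order.TTheory GRing.Theory Num.Theory.
Import numFieldNormedType.Exports.

Set Implicit Arguments.
Unset Strict Implicit.
Unset Printing Implicit Defensive.

Local Open Scope classical_set_scope.
Local Open Scope ring_scope.

Section BrunetDerrida.
Context {R : realType} {d : measure_display} {T : measurableType d}.
Variable P : probability T R.

Definition rv_sys (X : T -> R) : set_system T :=
  [set X @^-1` A | A in [set A : set R | measurable A]].

Definition indep_fin (I : finType) (F : I -> set_system T) : Prop :=
  forall E : I -> set T, (forall i, <<s F i >> (E i)) ->
    P (\bigcap_(i in [set: I]) E i) = (\prod_(i : I) P (E i))%E.

(* Mutual independence of a sequence of sigma-algebras <<s F i >>, i : nat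
   (every finite subfamily; it suffices to test initial segments since the
   whole space belongs to every sigma-algebra). *)
Definition indep_nat (F : nat -> set_system T) : Prop :=
  forall (n : nat) (E : nat -> set T), (forall i, (i < n)%N -> <<s F i >> (E i)) ->
    P (\bigcap_(i in `I_n) E i) = (\prod_(i < n) P (E i))%E.

Definition std_BM (W : R -> T -> R) : Prop :=
  [/\ forall t, 0 <= t -> measurable_fun setT (W t),
      forall w, W 0 w = 0,
      forall w, {within [set t : R | 0 <= t], continuous (fun t => W t w)},
      forall s t, 0 <= s -> s < t -> forall A, measurable A ->
        P ((fun w => W t w - W s w) @^-1` A) = normal_prob 0 (Num.sqrt (t - s)) A
    & forall tt : nat -> R, 0 <= tt 0%N -> (forall i, tt i < tt i.+1) ->
        indep_nat (fun i => rv_sys (fun w => W (tt i.+1) w - W (tt i) w))].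

Definition poisson_jumps (r : R) (J : nat -> T -> R) : Prop :=
  [/\ forall i, measurable_fun setT (J i),
      forall w, J 0%N w = 0,
      forall i A, measurable A ->
        P ((fun w => J i.+1 w - J i w) @^-1` A) = exponential_prob r A
    & indep_nat (fun i => rv_sys (fun w => J i.+1 w - J i w))].

Variable N : nat.

Definition Ksys (K : T -> 'I_N) : set_system T :=
  [set K @^-1` A | A in [set: set 'I_N]].

Definition unif_choices (K : nat -> T -> 'I_N) : Prop :=
  [/\ forall i (A : set 'I_N), measurable (K i.+1 @^-1` A),
      forall i k, P (K i.+1 @^-1` [set k]) = ((N%:R)^-1)%:E
    & indep_nat (fun i => Ksys (K i.+1))].

Definition BM_sys (W : R -> T -> R) : set_system T :=
  [set E | exists t, 0 <= t /\ rv_sys (W t) E].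
Definition J_sys (J : nat -> T -> R) : set_system T :=
  [set E | exists i, rv_sys (J i) E].
Definition K_sys (K : nat -> T -> 'I_N) : set_system T :=
  [set E | exists i, Ksys (K i.+1) E].

Definition BD_noise (B : 'I_N -> R -> T -> R) (J : nat -> T -> R)
  (K : nat -> T -> 'I_N) : Prop :=
  [/\ forall n, std_BM (B n),
      poisson_jumps N%:R J,
      unif_choices K
    & indep_fin (fun c : ('I_N + bool)%type =>
        match c with
        | inl n => BM_sys (B n)
        | inr true => J_sys J
        | inr false => K_sys K
        end)].

End BrunetDerrida.

Section Paths.
Context {R : realType}.
Variable N : nat.

Definition sorted_pos (z : 'I_N -> R) : seq R :=
  sort <=%R [seq z n | n <- enum 'I_N].

(* Pathwise definition of the Brunet--Derrida system with score s and drift mu,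
   initial condition y0, for a fixed realisation of the noise: jump times j,
   choices k, Brownian paths b.  Z is an (unordered) labelling of the particles
   (label n driven by b n between jumps), Y is the ordered relabelling.
   At each jump time j (i+1), some particle m of minimal score (ties broken
   arbitrarily) jumps onto the position of the k(i+1)-th smallest particle
   (taken just before the jump). *)
Definition BD_path (s : R -> R) (mu : R) (y0 : 'I_N -> R) (j : nat -> R)
  (k : nat -> 'I_N) (b : 'I_N -> R -> R) (Y : R -> 'I_N -> R) : Prop :=
  exists Z : R -> 'I_N -> R,
  [/\ Z 0 = y0,
      forall i t n, j i <= t -> t < j i.+1 ->
        Z t n = Z (j i) n + (b n t - b n (j i)) + mu * (t - j i),
      forall i,
        let zm := fun n => Z (j i) n + (b n (j i.+1) - b n (j i)) + mu * (j i.+1 - j i) in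
        exists m : 'I_N, (forall n, s (zm m) <= s (zm n)) /\
          forall n, Z (j i.+1) n = if n == m then nth 0 (sorted_pos zm) (k i.+1) else zm n
    & forall t n, 0 <= t -> Y t n = nth 0 (sorted_pos (Z t)) n].

End Paths.

Definition first_ord (N : nat) (hN : (0 < N)%N) : 'I_N := Ordinal hN.

Definition NBBM_speed (R : realType) (N : nat) (hN : (0 < N)%N) (v : R) : Prop :=
  forall (d : measure_display) (T : measurableType d) (P : probability T R)
    (B : 'I_N -> R -> T -> R) (J : nat -> T -> R) (K : nat -> T -> 'I_N),
    BD_noise P B J K ->
    forall (x0 : 'I_N -> R) (X : T -> R -> 'I_N -> R),
    {ae P, forall w, BD_path (fun x => x) 0 x0 (fun i => J i w) (fun i => K i w)
                       (fun n t => B n t w) (X w)} ->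
    {ae P, forall w, X w t (first_ord hN) / t @[t --> +oo] --> v}.

(* Main.v *)
(** Suppose first that [mu < 0]. The bee system is coupled with an N-BBM [X]
    having the same jump times and choices. After every jump the labels of the
    bee system are permuted so that both systems are ordered alike; permuting
    the Brownian motions after a stopping time preserves the law of the noise,
    so [X] is a genuine N-BBM. Removing the leftmost particle is the best
    choice for the number of particles above any level, whence
    [Z_n(t) <= X_n(t) + mu t] for every label.

    All labels of the N-BBM share the speed [v] of its minimum: as soon as the
    rightmost particle has been chosen [N] times, which takes a time o(t), the
    minimum has caught up with every earlier position up to Brownian
    fluctuations. Hence [v + mu < 0] makes all bee particles negative
    eventually; then the bee system also removes its leftmost particle, and it
    stays within a constant of [X_n(t) + mu t]. Since the given system may break
    ties arbitrarily, one also needs that ties almost surely do not occur.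

    The case [mu > 0] follows by reflection, and [mu = 0] is excluded by
    [0 <= v]. *)

Require Import Defs.
From mathcomp Require Import all_boot all_order all_algebra all_fingroup.
From mathcomp Require Import all_classical all_reals all_analysis.
From mathcomp Require Import measurable_realfun ring lra zify.
Import Order.TTheory GRing.Theory Num.Theory.
Import numFieldNormedType.Exports.
Set Implicit Arguments.
Unset Strict Implicit.
Unset Printing Implicit Defensive.
Local Open Scope classical_set_scope.
Local Open Scope ring_scope.

(** * Monotone classes and cylinders *)

(** The speed [v] is only available for N-BBMs driven by a genuine noise, whereas the comparison
    needs the labels of the two systems to be rematched after every jump. The rematched Brownian
    motions must therefore be shown to form, with the same [J] and [K], again a [BD_noise]. As no
    filtration is given, the strong Markov property at a jump time is proved on cylinder events: the
    time is approximated from above by dyadic times, the countably many values of time and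
    permutation are frozen, and on a dyadic grid the increments after a fixed time are exchangeable.
    Pointwise limits of paths then preserve the law.

    Systems are compared through the number of particles above each level, which ignores labels;
    matching the two orders after the jump turns this back into a bound label by label. This works
    because [K] selects ranks and not labels, so both systems copy the particle of the same rank. *)

Section ProbabilityTools.
Context {R : realType} {d : measure_display} {T : measurableType d}.
Variable P : probability T R.

(** Both sides are finite measures in [E] with equal total mass, so the events on which they agree
    form a Dynkin class. The case [c = 1] gives equality of laws; the case [D2 = setT] with [c] the
    probability of [D1] gives independence. *)
Lemma pi_lambda_eq (U : Type) (C : set (set U)) (f g : T -> U) (D1 D2 : set T)
    (c : R) : 0 <= c -> setI_closed C -> measurable D1 -> measurable D2 ->
  (forall E, C E -> measurable (f @^-1` E) /\ measurable (g @^-1` E)) ->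
  P D1 = (c%:E * P D2)%E ->
  (forall E, C E -> P (D1 `&` f @^-1` E) = (c%:E * P (D2 `&` g @^-1` E))%E) ->
  forall E, <<s C >> E -> [/\ measurable (f @^-1` E), measurable (g @^-1` E) &
    P (D1 `&` f @^-1` E) = (c%:E * P (D2 `&` g @^-1` E))%E].
Proof.
move=> c0 CI mD1 mD2 mC hD hC E.
rewrite -(setI_closed_g_dynkin_g_sigma_algebra CI).
pose H := [set E | [/\ measurable (f @^-1` E), measurable (g @^-1` E) &
    P (D1 `&` f @^-1` E) = (c%:E * P (D2 `&` g @^-1` E))%E]].
have dH : dynkin H; last first.
  move=> h; apply: (h H); split=> // A CA; have [m1 m2] := mC _ CA.
  by split=> //; exact: hC.
split.
- by split; rewrite ?preimage_setT ?setIT.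
- move=> A [m1 m2 e].
  split; [by rewrite preimage_setC; exact: measurableC
         |by rewrite preimage_setC; exact: measurableC|].
  have HD (D' F : set T) : measurable D' -> measurable F ->
      P (D' `&` ~` F) = (P D' - P (D' `&` F))%E.
    move=> mD mF; rewrite -setDE measureD// ?(le_lt_trans (probability_le1 _ _)) ?ltry//.
  rewrite (_ : f @^-1` (~` A) = ~` (f @^-1` A))// (_ : g @^-1` (~` A) = ~` (g @^-1` A))//.
  rewrite (HD D1 (f @^-1` A))// (HD D2 (g @^-1` A))// e hD muleBr//.
  by rewrite fin_num_adde_defr// fin_num_measure.
- move=> F tF HF; split.
  + by rewrite preimage_bigcup; apply: bigcupT_measurable => i; case: (HF i).
  + by rewrite preimage_bigcup; apply: bigcupT_measurable => i; case: (HF i).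
  have HU (h : T -> U) (D' : set T) : measurable D' ->
      (forall i, measurable (h @^-1` F i)) ->
      P (D' `&` h @^-1` (\bigcup_k F k)) = (\sum_(k <oo) P (D' `&` h @^-1` F k))%E.
    move=> mD mF; rewrite preimage_bigcup setI_bigcupr measure_bigcup//.
    + by apply: eq_eseriesl => i; rewrite in_setT.
    + by move=> i _; exact: measurableI.
    + apply/trivIsetP => i j _ _ ij; rewrite setIACA setIid -preimage_setI.
      by move/trivIsetP : tF => ->//; rewrite preimage_set0 setI0.
  rewrite !HU//; [|by move=> i; case: (HF i)..].
  rewrite -nneseriesZl//; apply: eq_eseriesr => i _; by case: (HF i).
Qed.

Lemma measure_partition (I : countType) (k : T -> I) (A : set T) :
  (forall i, measurable (k @^-1` [set i])) -> measurable A ->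
  P A = (\sum_(j <oo) P (A `&` [set w | pickle (k w) = j]))%E.
Proof.
move=> mk mA.
have mj j : measurable [set w | pickle (k w) = j].
  case e : (@pickle_inv I j) => [i|].
    rewrite (_ : [set w | _] = k @^-1` [set i])//.
    apply/seteqP; split=> w /=.
      by move=> kw; move: e; rewrite -kw pickleK_inv => -[].
    by move=> ->; apply/esym; have := @pickle_invK I j; rewrite e /=.
  rewrite (_ : [set w | _] = set0)//; apply/seteqP; split=> w //= kw.
  by move: e; rewrite -kw pickleK_inv.
rewrite -[in LHS](setIT A) (_ : setT = \bigcup_j [set w | pickle (k w) = j]); last first.
  by apply/seteqP; split=> // w _; exists (pickle (k w)).
rewrite setI_bigcupr measure_bigcup//.
- by apply: eq_eseriesl => i; rewrite in_setT.
- by move=> i _; exact: measurableI.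
- apply/trivIsetP => i j _ _ /eqP ij; apply/seteqP; split=> w //= [[_ wi] [_ wj]].
  by apply: ij; rewrite -wi wj.
Qed.

Lemma pickle_preimage (I : countType) (k : T -> I) j :
  [set w | pickle (k w) = j] = set0 \/
  exists i, [set w | pickle (k w) = j] = k @^-1` [set i].
Proof.
case e : (@pickle_inv I j) => [i|]; [right; exists i|left]; apply/seteqP; split=> w //=.
- by move=> kw; move: e; rewrite -kw pickleK_inv => -[].
- by move=> ->; apply/esym; have := @pickle_invK I j; rewrite e /=.
- by move=> kw; move: e; rewrite -kw pickleK_inv.
Qed.

Lemma partition_eq (I : countType) (k : T -> I) (A A' : set T) :
  (forall i, measurable (k @^-1` [set i])) -> measurable A -> measurable A' ->
  (forall i, P (A `&` k @^-1` [set i]) = P (A' `&` k @^-1` [set i])) ->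
  P A = P A'.
Proof.
move=> mk mA mA' h; rewrite (measure_partition mk mA) (measure_partition mk mA').
apply: eq_eseriesr => j _; have [->|[i ->]] := pickle_preimage k j.
  by rewrite !setI0.
exact: h.
Qed.

Lemma partition_le (I : countType) (k : T -> I) (A : set T) (c : R) :
  0 <= c ->
  (forall i, measurable (k @^-1` [set i])) -> measurable A ->
  (forall i, (P (A `&` k @^-1` [set i]) <= c%:E * P (k @^-1` [set i]))%E) ->
  (P A <= c%:E)%E.
Proof.
move=> c0 mk mA h; rewrite (measure_partition mk mA).
apply: (@le_trans _ _ (\sum_(j <oo) (c%:E * P (setT `&` [set w | pickle (k w) = j])))%E).
  apply: lee_nneseries => // j _; have [->|[i ->]] := pickle_preimage k j.
    by rewrite !setI0 measure0 mule0.
  by rewrite setTI; exact: h.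
rewrite nneseriesZl// -(measure_partition mk measurableT) probability_setT mule1//.
Qed.

(** Finite-dimensional events are lists of constraints, so that intersection is concatenation. *)
Definition cyl (I : Type) (X : I -> T -> R) (L : seq (I * R)) : set T :=
  [set w | all (fun c => X c.1 w <= c.2) L].

Lemma measurable_leR d' (T' : measurableType d') (X : T' -> R) a :
  measurable_fun setT X -> measurable [set w | X w <= a].
Proof.
move=> mX; rewrite (_ : [set w | _] = X @^-1` `]-oo, a]%classic).
  by rewrite -[X in measurable X]setTI; apply: mX.
by apply/seteqP; split=> w /=; rewrite in_itv.
Qed.

Lemma measurable_fun_leR d' (T' : measurableType d') (X : T' -> R) :
  (forall a, measurable [set w | X w <= a]) -> measurable_fun setT X.
Proof.
move=> h; apply: (measurability _ (RGenOInfty.measurableE R)).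
move=> _ [_ [a ->] <-]; rewrite setTI.
rewrite (_ : _ @^-1` _ = ~` [set w | X w <= a]); first exact: measurableC.
apply/seteqP; split=> w /=; rewrite in_itv /= andbT.
  by rewrite ltNge => /negP.
by move/negP; rewrite -ltNge.
Qed.

Lemma measurable_cyl (I : eqType) (X : I -> T -> R) L :
  (forall c, c \in L -> measurable_fun setT (X c.1)) -> measurable (cyl X L).
Proof.
elim: L => [|c L IH] h.
  by rewrite (_ : cyl _ _ = setT)//; apply/seteqP; split.
rewrite (_ : cyl _ _ = [set w | X c.1 w <= c.2] `&` cyl X L).
  apply: measurableI; first by apply: measurable_leR; apply: h; rewrite inE eqxx.
  by apply: IH => c' c'L; apply: h; rewrite inE c'L orbT.
by apply/seteqP; split=> w /=; rewrite /cyl /=; [move/andP=> []|move=> [? ?]; apply/andP].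
Qed.

(** Limits preserve an inequality only up to a margin; the thresholds are raised by [e] before the
    limit and the margin is removed afterwards. *)
Definition relax (I : Type) (L : seq (I * R)) (e : R) : seq (I * R) :=
  [seq (c.1, c.2 + e) | c <- L].

Lemma cyl_relax (I : Type) (X : I -> T -> R) L e w :
  cyl X (relax L e) w <-> all (fun c => X c.1 w <= c.2 + e) L.
Proof. by rewrite /cyl /= all_map. Qed.

Section CylinderLimit.
Context (I : eqType) (X X' : I -> T -> R) (Xm Xm' : nat -> I -> T -> R).
Context (D : set T) (L : seq (I * R)).
Hypothesis mD : measurable D.
Hypothesis mX : forall c, c \in L -> measurable_fun setT (X' c.1).
Hypothesis mXm : forall m c, c \in L -> measurable_fun setT (Xm m c.1).
Hypothesis mXm' : forall m c, c \in L -> measurable_fun setT (Xm' m c.1).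
Hypothesis cX : forall w c, c \in L -> Xm m c.1 w @[m --> \oo] --> X c.1 w.
Hypothesis cX' : forall w c, c \in L -> Xm' m c.1 w @[m --> \oo] --> X' c.1 w.
Hypothesis eqm : forall m e,
  P (D `&` cyl (Xm m) (relax L e)) = P (D `&` cyl (Xm' m) (relax L e)).

Let mcyl (Y : I -> T -> R) e :
  (forall c, c \in L -> measurable_fun setT (Y c.1)) -> measurable (cyl Y (relax L e)).
Proof.
by move=> h; apply: measurable_cyl => c /mapP[c' c'L ->] /=; exact: h.
Qed.

Let cyl_lim_relax e : 0 < e -> measurable (cyl X L) ->
  (P (D `&` cyl X L) <= P (D `&` cyl X' (relax L e)))%E.
Proof.
move=> e0 mcX.
(* [E M] increases to the lower limit of the relaxed cylinders of [Xm], which contains the cylinder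
   of [X]; [F M] decreases to the upper limit of those of [Xm'], which lies in the relaxed cylinder
   of [X']. The hypothesis [eqm] compares [E M] with [F M]. *)
pose E M := \bigcap_(m in [set m | (M <= m)%N]) (D `&` cyl (Xm m) (relax L e)).
pose F M := \bigcup_(m in [set m | (M <= m)%N]) (D `&` cyl (Xm' m) (relax L e)).
have mE M : measurable (E M).
  by apply: bigcap_measurable; [exists M => /=|move=> m _; apply: measurableI => //;
     apply: mcyl => c cL; exact: mXm].
have mF M : measurable (F M).
  by apply: bigcup_measurable => m _; apply: measurableI => //;
     apply: mcyl => c cL; exact: mXm'.
have cE : P (E M) @[M --> \oo] --> P (\bigcup_M E M).
  apply: nondecreasing_cvg_mu => //; first exact: bigcupT_measurable.
  move=> a b ab; apply/subsetPset => w Ea m /= bm; apply: Ea => /=.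
  exact: leq_trans bm.
have cF : P (F M) @[M --> \oo] --> P (\bigcap_M F M).
  apply: nonincreasing_cvg_mu => //.
  - by rewrite (le_lt_trans (probability_le1 _ _)) ?ltry.
  - exact: bigcapT_measurable.
  - move=> a b ab; apply/subsetPset => w [m /= bm h]; exists m => //=.
    exact: leq_trans bm.
have EF : (P (\bigcup_M E M) <= P (\bigcap_M F M))%E.
  apply: (lee_cvg_to cE cF).
  apply: nearW => M /=; apply: (@le_trans _ _ (P (D `&` cyl (Xm M) (relax L e)))).
    apply: le_measure; rewrite ?inE//.
      by apply: measurableI => //; apply: mcyl => c cL; exact: mXm.
    by move=> w; apply => /=.
  rewrite eqm; apply: le_measure; rewrite ?inE//.
    by apply: measurableI => //; apply: mcyl => c cL; exact: mXm'.
  by move=> w h; exists M => /=.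
apply: (le_trans _ (le_trans EF _)).
  apply: le_measure; rewrite ?inE//.
  - exact: measurableI.
  - exact: bigcupT_measurable.
  move=> w [Dw Xw].
  have : \forall m \near \oo, all (fun c => Xm m c.1 w <= c.2 + e) L.
    have : forall c, c \in L -> \forall m \near \oo, Xm m c.1 w <= c.2 + e.
      move=> c cL; have Xc : X c.1 w <= c.2 by move/allP : Xw; exact.
      have Xe : X c.1 w < c.2 + e by rewrite (le_lt_trans Xc)// ltrDl.
      have [M _ HM] := cvgr_lt _ (@cX w c cL) _ Xe.
      by exists M => // m /HM /ltW.
    elim: (L) => [|c L' IH] h; first by apply: nearW.
    have h1 := h c (mem_head _ _).
    have h2 : forall c, c \in L' -> \forall m \near \oo, Xm m c.1 w <= c.2 + e.
      by move=> c' c'L; apply: h; rewrite inE c'L orbT.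
    by near=> m => /=; apply/andP; split; near: m => //; exact: IH.
  case=> M _ HM; exists M => // m /= Mm; split => //; apply/cyl_relax; exact: HM.
apply: le_measure; rewrite ?inE//.
- exact: bigcapT_measurable.
- by apply: measurableI => //; apply: mcyl.
move=> w Fw; split; first by have [m _ []] := Fw 0%N Logic.I.
apply/cyl_relax/allP => c cL; rewrite leNgt; apply/negP => h.
have [M _ HM] := cvgr_gt _ (@cX' w c cL) _ h.
have [m /= Mm [_ /cyl_relax /allP /(_ c cL)]] := Fw M Logic.I.
by rewrite leNgt (HM m Mm).
Unshelve. all: by end_near. Qed.

Lemma cyl_lim_le : measurable (cyl X L) -> (P (D `&` cyl X L) <= P (D `&` cyl X' L))%E.
Proof.
move=> mcX.
have e0 k : 0 < (k.+1%:R : R)^-1 by rewrite invr_gt0 ltr0n.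
have mX' k : measurable (D `&` cyl X' (relax L k.+1%:R^-1)).
  by apply: measurableI => //; apply: mcyl.
have -> : D `&` cyl X' L = \bigcap_k (D `&` cyl X' (relax L k.+1%:R^-1)).
  apply/seteqP; split=> w.
    move=> [Dw /allP Xw] k _; split => //; apply/cyl_relax/allP => c cL.
    by rewrite (le_trans (Xw c cL))// lerDl ltW.
  move=> h; split; first by have [] := h 0%N Logic.I.
  apply/allP => c cL; apply/ler_addgt0Pr => e e1.
  have [k ke] : exists k : nat, (k.+1%:R : R)^-1 < e.
    have [k _ /(_ k (leqnn k)) H] := near_infty_natSinv_lt (PosNum e1).
    by exists k.
  have [_ /cyl_relax /allP /(_ c cL) /le_trans] := h k Logic.I; apply.
  by rewrite lerD2l ltW.
have cv : P (D `&` cyl X' (relax L k.+1%:R^-1)) @[k --> \oo] -->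
    P (\bigcap_k (D `&` cyl X' (relax L k.+1%:R^-1))).
  apply: nonincreasing_cvg_mu => //.
  - by rewrite (le_lt_trans (probability_le1 _ _)) ?ltry.
  - exact: bigcapT_measurable.
  - move=> a b ab; apply/subsetPset => w [Dw /cyl_relax /allP h]; split=> //.
    apply/cyl_relax/allP => c cL; rewrite (le_trans (h c cL))// lerD2l.
    by rewrite lef_pV2 ?posrE ?ltr0n// ler_nat ltnS.
apply: (cvge_ge _ cv).
by apply: nearW => k; exact: cyl_lim_relax.
Qed.

End CylinderLimit.

(** Equality of laws passes to pointwise limits, by two inequalities with the roles exchanged. It
    serves three limits: dyadic times to real times, discretised switching times to the true one,
    and finitely many relabellings to infinitely many. *)
Lemma cyl_lim_eq (I : eqType) (X X' : I -> T -> R) (Xm Xm' : nat -> I -> T -> R)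
    (D : set T) (L : seq (I * R)) : measurable D ->
  (forall m c, c \in L -> measurable_fun setT (Xm m c.1)) ->
  (forall m c, c \in L -> measurable_fun setT (Xm' m c.1)) ->
  (forall w c, c \in L -> Xm m c.1 w @[m --> \oo] --> X c.1 w) ->
  (forall w c, c \in L -> Xm' m c.1 w @[m --> \oo] --> X' c.1 w) ->
  (forall m e, P (D `&` cyl (Xm m) (relax L e)) = P (D `&` cyl (Xm' m) (relax L e))) ->
  P (D `&` cyl X L) = P (D `&` cyl X' L).
Proof.
move=> mD mXm mXm' cX cX' e.
have mX c : c \in L -> measurable_fun setT (X c.1).
  move=> cL; apply: (@measurable_fun_cvg _ _ _ _ (fun m => Xm m c.1)).
    by move=> m; exact: mXm.
  by move=> w _; exact: cX.
have mX' c : c \in L -> measurable_fun setT (X' c.1).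
  move=> cL; apply: (@measurable_fun_cvg _ _ _ _ (fun m => Xm' m c.1)).
    by move=> m; exact: mXm'.
  by move=> w _; exact: cX'.
apply/eqP; rewrite eq_le; apply/andP; split.
  apply: (@cyl_lim_le _ _ _ Xm Xm') => //; exact: measurable_cyl.
by apply: (@cyl_lim_le _ _ _ Xm' Xm) => //; exact: measurable_cyl.
Qed.

End ProbabilityTools.

Section GeneratedSigmaAlgebras.
Context {R : realType} {d : measure_display} {T : measurableType d}.

Lemma gen_measurable (G : set (set T)) E :
  (forall A, G A -> measurable A) -> <<s G >> E -> measurable E.
Proof.
move=> h; apply: smallest_sub; last by move=> A /h.
exact: sigma_algebra_measurable.
Qed.

Lemma gen_sub (U : Type) (G G' : set (set U)) E :
  (forall A, G A -> <<s G' >> A) -> <<s G >> E -> <<s G' >> E.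
Proof. by move=> h; apply: smallest_sub; [exact: smallest_sigma_algebra|]. Qed.

Lemma gen_preimage (U : Type) (C : set (set U)) (f : T -> U) (G : set (set T)) E :
  (forall A, G A -> exists2 F, <<s C >> F & A = f @^-1` F) ->
  <<s G >> E -> exists2 F, <<s C >> F & E = f @^-1` F.
Proof.
move=> h GE.
have : preimage_set_system setT f <<s C >> E.
  move: E GE; apply: smallest_sub.
    by apply: sigma_algebra_preimage; exact: smallest_sigma_algebra.
  by move=> A /h[F CF ->]; exists F => //; rewrite setTI.
by case=> F CF <-; exists F => //; rewrite setTI.
Qed.

Lemma gen_rv_sys (X : T -> R) E :
  <<s rv_sys X >> E -> exists2 A, measurable A & E = X @^-1` A.
Proof.
move=> /(@gen_preimage _ (@measurable _ R) X) [].
  by move=> _ [A mA <-]; exists A => //; exact: sub_sigma_algebra.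
by move=> F mF ->; exists F => //; move: mF; rewrite sigma_algebra_id//; exact: sigma_algebra_measurable.
Qed.

Lemma gen_setI (G : set (set T)) A A' :
  <<s G >> A -> <<s G >> A' -> <<s G >> (A `&` A').
Proof. by move=> h h'; exact: (@measurableI _ (g_sigma_algebraType G)). Qed.

End GeneratedSigmaAlgebras.

(** * The law of the noise *)

Section NoiseLaw.
Context {R : realType} {d : measure_display} {T : measurableType d}.
Variable P : probability T R.
Context {N : nat}.
Implicit Types (B : 'I_N -> R -> T -> R) (J : nat -> T -> R) (K : nat -> T -> 'I_N).

Definition bcoord B (c : 'I_N * R) : T -> R := B c.1 c.2.

Definition path_of B (w : T) : 'I_N -> R -> R := fun n t => B n t w.

Definition pcyl (L : seq (('I_N * R) * R)) : set ('I_N -> R -> R) :=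
  [set b | all (fun c => b c.1.1 c.1.2 <= c.2) L].

Definition pcyls (Q : 'I_N * R -> Prop) : set (set ('I_N -> R -> R)) :=
  [set E | exists2 L, (forall c, c \in L -> Q c.1) & E = pcyl L].

Lemma pcyls_setI Q : setI_closed (pcyls Q).
Proof.
move=> _ _ [L1 h1 ->] [L2 h2 ->]; exists (L1 ++ L2).
  by move=> c; rewrite mem_cat => /orP[/h1|/h2].
by apply/seteqP; split=> b; rewrite /pcyl /= all_cat; [move=> [-> ->]|move/andP].
Qed.

Lemma measurable_pcoord Q n t : Q (n, t) ->
  measurable_fun setT (fun b : g_sigma_algebraType (pcyls Q) => b n t).
Proof.
move=> Qnt; apply: measurable_fun_leR => a; apply: sub_sigma_algebra.
exists [:: ((n, t), a)]; first by move=> c; rewrite inE => /eqP ->.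
by apply/seteqP; split=> b; rewrite /pcyl /= andbT.
Qed.

(** Equality in law of the triples [(B, J, K)] and [(B', J, K)] on the coordinates in [Q]. The
    events of [J] and [K] appear literally, as these processes are common to both triples. *)
Definition law_eq (Q : 'I_N * R -> Prop) B B' J K :=
  forall DJ DK, <<s J_sys J >> DJ -> <<s K_sys K >> DK ->
  forall L, (forall c, c \in L -> Q c.1) ->
  P (DJ `&` DK `&` cyl (bcoord B) L) = P (DJ `&` DK `&` cyl (bcoord B') L).

Definition nonneg_time (c : 'I_N * R) : Prop := 0 <= c.2.

Lemma law_eq_path Q B B' J K DJ DK E :
  (forall c, Q c -> measurable_fun setT (bcoord B c)) ->
  (forall c, Q c -> measurable_fun setT (bcoord B' c)) ->
  law_eq Q B B' J K -> measurable DJ -> measurable DK ->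
  <<s J_sys J >> DJ -> <<s K_sys K >> DK -> <<s pcyls Q >> E ->
  [/\ measurable (path_of B @^-1` E), measurable (path_of B' @^-1` E) &
  P (DJ `&` DK `&` path_of B @^-1` E) = P (DJ `&` DK `&` path_of B' @^-1` E)].
Proof.
move=> mB mB' BB' mJ mK hJ hK hE.
have [||_ [L hL ->]|||] := @pi_lambda_eq _ _ _ P _ (pcyls Q) (path_of B) (path_of B')
  (DJ `&` DK) (DJ `&` DK) 1 ler01 (@pcyls_setI Q) _ _ _ _ _ E hE.
- exact: measurableI.
- exact: measurableI.
- split; [rewrite (_ : _ @^-1` _ = cyl (bcoord B) L)//|
          rewrite (_ : _ @^-1` _ = cyl (bcoord B') L)//];
  apply: measurable_cyl => c cL; (apply: mB || apply: mB'); exact: hL.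
- by rewrite mul1e.
- by move=> _ [L hL ->]; rewrite mul1e; exact: BB'.
- by move=> m1 m2; rewrite mul1e.
Qed.

Lemma measurable_J_sys J DJ : (forall i, measurable_fun setT (J i)) ->
  <<s J_sys J >> DJ -> measurable DJ.
Proof.
move=> mJ; apply: gen_measurable => _ [i [A mA <-]].
by rewrite -[X in measurable X]setTI; apply: mJ.
Qed.

Lemma measurable_K_sys K DK : (forall i (A : set 'I_N), measurable (K i.+1 @^-1` A)) ->
  <<s K_sys K >> DK -> measurable DK.
Proof. by move=> mK; apply: gen_measurable => _ [i [A _ <-]]. Qed.

Lemma gen_setT (G : set (set T)) : <<s G >> setT.
Proof. exact: (@measurableT _ (g_sigma_algebraType G)). Qed.

(** Normality and independence in [BD_noise] are statements about the joint law, hence follow from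
    cylinders by a monotone class argument. Only measurability, the start at [0] and continuity are
    pathwise and must be assumed for [B']. *)
Lemma noise_transfer B B' J K : BD_noise P B J K ->
  law_eq nonneg_time B B' J K ->
  (forall n t, 0 <= t -> measurable_fun setT (B' n t)) ->
  (forall n w, B' n 0 w = 0) ->
  (forall n w, {within [set t : R | 0 <= t], continuous (fun t => B' n t w)}) ->
  BD_noise P B' J K.
Proof.
move=> [hB hJ hK hI] BB' mB' B'0 cB'.
have mB n t : 0 <= t -> measurable_fun setT (B n t) by case: (hB n) => + _ _ _ _; exact.
have mJ DJ : <<s J_sys J >> DJ -> measurable DJ.
  by apply: measurable_J_sys; case: hJ.
have mK DK : <<s K_sys K >> DK -> measurable DK.
  by apply: measurable_K_sys; case: hK.
have key DJ DK E : <<s J_sys J >> DJ -> <<s K_sys K >> DK ->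
    <<s pcyls nonneg_time >> E ->
    P (DJ `&` DK `&` path_of B @^-1` E) = P (DJ `&` DK `&` path_of B' @^-1` E).
  move=> h1 h2 h3.
  by have [_ _] := @law_eq_path nonneg_time B B' J K DJ DK E
    (fun c => @mB c.1 c.2) (fun c => @mB' c.1 c.2) BB' (mJ _ h1) (mK _ h2) h1 h2 h3.
have key0 E : <<s pcyls nonneg_time >> E ->
    P (path_of B @^-1` E) = P (path_of B' @^-1` E).
  move=> hE; have := key setT setT E (@gen_setT (J_sys J)) (@gen_setT (K_sys K)) hE.
  by rewrite !setTI.
have minc (n : 'I_N) (s t : R) (A : set R) : 0 <= s -> 0 <= t -> measurable A ->
    <<s pcyls nonneg_time >> [set b | A (b n t - b n s)].
  move=> s0 t0 mA.
  have : measurable_fun setT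
      (fun b : g_sigma_algebraType (pcyls nonneg_time) => b n t - b n s).
    by apply: measurable_funB; exact: measurable_pcoord.
  by move=> /(_ measurableT A mA); rewrite setTI.
split => //.
- move=> n; have [_ _ _ h4 h5] := hB n; split => //.
  + by move=> t; exact: mB'.
  + move=> s t s0 st A mA; rewrite -(h4 s t s0 st A mA); apply/esym.
    by apply: (key0 [set b | A (b n t - b n s)]); apply: minc => //; rewrite (le_trans s0)// ltW.
  + move=> tt tt0 ttS m E hE.
    have tt_ge0 i : 0 <= tt i.
      by elim: i => // i IH; rewrite (le_trans IH)// ltW.
    have [A hA] : {A : nat -> set R & forall i, (i < m)%N ->
        measurable (A i) /\ E i = (fun w => B' n (tt i.+1) w - B' n (tt i) w) @^-1` A i}.
      apply: (@choice _ _ (fun i A => (i < m)%N ->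
        measurable A /\ E i = (fun w => B' n (tt i.+1) w - B' n (tt i) w) @^-1` A)) => i.
      have [im|] := boolP (i < m)%N; last by exists set0.
      by have [A mA ->] := gen_rv_sys (hE i im); exists A.
    transitivity (P (\bigcap_(i in `I_m)
        (fun w => B n (tt i.+1) w - B n (tt i) w) @^-1` A i)).
      rewrite (_ : \bigcap_(i in `I_m) E i = path_of B' @^-1`
          (\bigcap_(i in `I_m) [set b | A i (b n (tt i.+1) - b n (tt i))])); last first.
        rewrite preimage_bigcap; apply: eq_bigcapr => i im.
        by have [_ ->] := hA i im.
      rewrite -key0 ?preimage_bigcap//.
      apply: (@fin_bigcap_measurable _ (g_sigma_algebraType (pcyls nonneg_time))) => //.
      by move=> i im; apply: minc => //; case: (hA i im).
    rewrite (h5 tt tt0 ttS); last first.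
      move=> i im; apply: sub_sigma_algebra; exists (A i) => //.
      by case: (hA i im).
    apply: eq_bigr => i _; have [mA ->] := hA i (ltn_ord i).
    exact: (key0 [set b | A i (b n (tt i.+1) - b n (tt i))] (minc _ _ _ _ _ _ _)).
- move=> E hE.
  (* The event attached to label [n] involves the coordinate [n] only. Recording this in [Qn n]
     makes the pullback of the same [F n] along [B] an event of the single motion [B n]. *)
  pose Qn (n : 'I_N) (c : 'I_N * R) := c.1 = n /\ nonneg_time c.
  have [F hF] : {F : 'I_N -> set ('I_N -> R -> R) & forall n,
      <<s pcyls (Qn n) >> (F n) /\ E (inl n) = path_of B' @^-1` F n}.
    apply: (@choice _ _ (fun n F => <<s pcyls (Qn n) >> F /\ E (inl n) = path_of B' @^-1` F)) => n.
    have [|F hF ->] := @gen_preimage _ _ _ (pcyls (Qn n)) (path_of B') _ _ _ (hE (inl n)).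
      move=> _ [t [t0 [A mA <-]]]; exists [set b | A (b n t)] => //.
      have := @measurable_pcoord (Qn n) n t (conj erefl t0) measurableT A mA.
      by rewrite setTI.
    by exists F.
  have subQ n G : <<s pcyls (Qn n) >> G -> <<s pcyls nonneg_time >> G.
    apply: gen_sub => _ [L hL ->]; apply: sub_sigma_algebra; exists L => //.
    by move=> c /hL[].
  have FB n : <<s BM_sys (B n) >> (path_of B @^-1` F n).
    have [+ _] := hF n; move: (F n).
    suff : <<s pcyls (Qn n) >> `<=` [set G | <<s BM_sys (B n) >> (path_of B @^-1` G)] by apply.
    apply: smallest_sub.
      split => /=.
      - by rewrite preimage_set0; exact: (@measurable0 _ (g_sigma_algebraType (BM_sys (B n)))).
      - move=> A hA; rewrite setTD.
        exact: (@measurableC _ (g_sigma_algebraType (BM_sys (B n)))).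
      - move=> A hA; rewrite preimage_bigcup.
        exact: (@bigcupT_measurable _ (g_sigma_algebraType (BM_sys (B n)))).
    move=> _ [L hL ->] /=.
    have -> : path_of B @^-1` pcyl L = @cyl R d (g_sigma_algebraType (BM_sys (B n))) _ (bcoord B) L by [].
    apply: (@measurable_cyl _ _ (g_sigma_algebraType (BM_sys (B n)))) => c /hL[<- c0].
    move=> _ A mA; rewrite setTI; apply: sub_sigma_algebra.
    by exists c.1.2; split => //; exists A.
  have PF n : P (path_of B @^-1` F n) = P (E (inl n)).
    by have [h ->] := hF n; apply: key0; exact: subQ h.
  have splitE (E' : 'I_N + bool -> set T) : \bigcap_(i in [set: 'I_N + bool]) E' i =
      E' (inr true) `&` E' (inr false) `&` \bigcap_(n in [set: 'I_N]) E' (inl n).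
    apply/seteqP; split=> w.
      by move=> h; split; [split; exact: h|move=> n _; exact: h].
    by move=> [[h1 h2] h3] [n|[]] _ //; exact: h3.
  rewrite splitE.
  have -> : \bigcap_(n in [set: 'I_N]) E (inl n) =
      path_of B' @^-1` \bigcap_(n in [set: 'I_N]) F n.
    by rewrite preimage_bigcap; apply: eq_bigcapr => n _; case: (hF n).
  rewrite -key; [|exact: (hE (inr true))|exact: (hE (inr false))|]; last first.
    apply: (@fin_bigcap_measurable _ (g_sigma_algebraType (pcyls nonneg_time))) => //.
    by move=> n _; apply: (subQ n); case: (hF n).
  pose E' (c : 'I_N + bool) := match c with
    | inl n => path_of B @^-1` F n | inr b => E (inr b) end.
  rewrite preimage_bigcap -(splitE E') hI; last by move=> [n|[]]; [exact: FB|exact: (hE (inr true))|exact: (hE (inr false))].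
  by apply: eq_bigr => -[n|b] _ //=; exact: PF.
Qed.

End NoiseLaw.

(** * Continuous paths and dyadic times *)

Section ContinuityTools.
Context {R : realType}.
Implicit Types (f : R -> R) (x t : R).

Lemma within_continuousP f :
  {within [set t : R | 0 <= t], continuous f} <->
  forall x, 0 <= x -> forall e, 0 < e ->
    exists2 dl, 0 < dl & forall y, 0 <= y -> `|y - x| < dl -> `|f y - f x| < e.
Proof.
split.
  move=> /subspace_continuousP h x x0 e e0.
  have /cvgrPdist_lt /(_ e e0) := h x x0.
  move=> /nbhs_ballP[dl /= dl0 hdl]; exists dl => // y y0 xy.
  rewrite distrC; apply: (hdl y) => //.
  by rewrite /ball /= distrC.
move=> h; apply/subspace_continuousP => x x0; apply/cvgrPdist_lt => e e0.
have [dl dl0 hdl] := h x x0 e e0.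
apply/nbhs_ballP; exists dl => //= y xy y0; rewrite distrC; apply: hdl => //.
by rewrite distrC.
Qed.

Lemma within_continuous_seq f (s : nat -> R) x :
  {within [set t : R | 0 <= t], continuous f} -> 0 <= x ->
  (forall m, 0 <= s m) -> s m @[m --> \oo] --> x -> f (s m) @[m --> \oo] --> f x.
Proof.
move=> /within_continuousP h x0 s0 sx; apply/cvgrPdist_lt => e e0.
have [dl dl0 hdl] := h x x0 e e0.
move/cvgrPdist_lt : sx => /(_ dl dl0) [M _ HM]; exists M => // m /HM /= H.
by rewrite distrC; apply: hdl => //; rewrite distrC.
Qed.

Definition grid (M k : nat) : R := k%:R / 2 ^+ M.

Lemma two_exp_gt0 M : 0 < 2 ^+ M :> R. Proof. by rewrite exprn_gt0. Qed.

Lemma grid_ge0 M k : 0 <= grid M k.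
Proof. by rewrite /grid divr_ge0// exprn_ge0. Qed.

Lemma grid0 M : grid M 0 = 0. Proof. by rewrite /grid mul0r. Qed.

Lemma grid_le M k l : (grid M k <= grid M l) = (k <= l)%N.
Proof. by rewrite /grid ler_pM2r ?invr_gt0 ?two_exp_gt0// ler_nat. Qed.

Lemma gridS M k : grid M k.+1 - grid M k = 2 ^- M.
Proof. by rewrite /grid -mulrBl -natrB ?leqnSn// subSnn mul1r. Qed.

Lemma grid_lift M M' k : (M <= M')%N -> grid M k = grid M' (k * 2 ^ (M' - M)).
Proof.
move=> MM'; have e : M' = (M' - M + M)%N by rewrite subnK.
rewrite /grid {2}e exprD natrM natrX invfM mulrA mulfK//.
Qed.

Definition dyadic (t : R) := exists M k, t = grid M k.

Lemma dyadic_common (I : eqType) (L : seq I) (g : I -> R) :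
  (forall c, c \in L -> dyadic (g c)) ->
  exists M, forall c, c \in L -> exists k, g c = grid M k.
Proof.
elim: L => [|c L IH] h; first by exists 0%N.
have [c' c'L|M hM] := IH; first by apply: h; rewrite inE c'L orbT.
have [M' [k ck]] := h c (mem_head _ _).
exists (maxn M M') => c'; rewrite inE => /orP[/eqP->|/hM[k' ->]].
  by exists (k * 2 ^ (maxn M M' - M'))%N; rewrite ck -grid_lift// leq_maxr.
by exists (k' * 2 ^ (maxn M M' - M))%N; rewrite -grid_lift// leq_maxl.
Qed.

Definition dfloor (m : nat) (t : R) : R := grid m (Num.truncn (t * 2 ^+ m)).
(** The successor puts [dceil m t] strictly above [t], even at dyadic points, and makes the cell
    index determine an upper bound of [t]. *)
Definition dceil (m : nat) (t : R) : R := grid m (Num.truncn (t * 2 ^+ m)).+1.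

Lemma dfloor_dceil m t : 0 <= t -> dfloor m t <= t < dceil m t.
Proof.
move=> t0; have /andP[h1 h2] := truncn_itv (mulr_ge0 t0 (ltW (two_exp_gt0 m))).
by rewrite /dfloor /dceil /grid ler_pdivrMr ?ltr_pdivlMr ?two_exp_gt0// h1 h2.
Qed.

Lemma dyadic_cvg (s : nat -> R) t : (forall m, `|s m - t| <= 2 ^- m) ->
  s m @[m --> \oo] --> t.
Proof.
move=> h; apply/cvgrPdist_le => e e0.
have : (2^-1 : R) ^+ m @[m --> \oo] --> 0 by apply: cvg_expr; rewrite ger0_norm//; lra.
move=> /cvgrPdist_le /(_ e e0) [M _ HM]; exists M => // m /HM /=.
rewrite sub0r normrN ger0_norm ?exprn_ge0// => He.
by rewrite distrC (le_trans (h m))// -exprVn.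
Qed.

Lemma dfloor_cvg t : 0 <= t -> dfloor m t @[m --> \oo] --> t.
Proof.
move=> t0; apply: dyadic_cvg => m; have /andP[h1 h2] := dfloor_dceil m t0.
rewrite distrC ger0_norm ?subr_ge0//.
by have := gridS m (Num.truncn (t * 2 ^+ m)); move: h1 h2; rewrite /dfloor /dceil; lra.
Qed.

Lemma dceil_cvg t : 0 <= t -> dceil m t @[m --> \oo] --> t.
Proof.
move=> t0; apply: dyadic_cvg => m; have /andP[h1 h2] := dfloor_dceil m t0.
rewrite ger0_norm; last by rewrite subr_ge0 ltW.
by have := gridS m (Num.truncn (t * 2 ^+ m)); move: h1 h2; rewrite /dfloor /dceil; lra.
Qed.

End ContinuityTools.

(** * Exchanging Brownian motions after a fixed time *)

Section Switch.
Context {R : realType} {N : nat}.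
Implicit Types (b : 'I_N -> R -> R) (s t : R) (p : {perm 'I_N}).

Definition sw b s p : 'I_N -> R -> R := fun n t =>
  if t <= s then b n t else b n s + (b (p n) t - b (p n) s).

Lemma sw1 b s n t : sw b s 1%g n t = b n t.
Proof. by rewrite /sw perm1; case: ifP => // _; rewrite addrC subrK. Qed.

Lemma sw_continuous b s p n : 0 <= s ->
  (forall n, {within [set t : R | 0 <= t], continuous (b n)}) ->
  {within [set t : R | 0 <= t], continuous (sw b s p n)}.
Proof.
move=> s0 cb; apply/within_continuousP => x x0 e e0.
have e2 : 0 < e / 2 by lra.
have [d1 d10 h1] := (within_continuousP _).1 (cb n) x x0 _ e2.
have [d2 d20 h2] := (within_continuousP _).1 (cb (p n)) x x0 _ e2.
have [xs|sx|xs] := ltgtP x s.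
- exists (Num.min d1 (s - x)); first by rewrite lt_min d10 subr_gt0.
  move=> y y0; rewrite lt_min => /andP[yx1 yx2].
  have ys : y <= s by move: yx2; rewrite ltr_norml => /andP[]; lra.
  by rewrite /sw ys (ltW xs); have := h1 y y0 yx1; lra.
- exists (Num.min d2 (x - s)); first by rewrite lt_min d20 subr_gt0.
  move=> y y0; rewrite lt_min => /andP[yx1 yx2].
  have ys : s < y by move: yx2; rewrite ltr_norml => /andP[]; lra.
  rewrite /sw !leNgt ys sx /=; have := h2 y y0 yx1.
  move=> h; rewrite (_ : _ - _ = b (p n) y - b (p n) x); last by ring.
  by lra.
- exists (Num.min d1 d2); first by rewrite lt_min d10 d20.
  move=> y y0; rewrite lt_min => /andP[yx1 yx2].
  have H1 := h1 y y0 yx1; have H2 := h2 y y0 yx2.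
  rewrite /sw xs lexx -xs; case: ifP => _; first by lra.
  by rewrite (_ : _ - _ = b (p n) y - b (p n) x); [lra|ring].
Qed.

(** The effect of [sw] on grid increments: from cell [r] on, the rows are permuted and nothing else
    changes. *)
Definition swinc (p : {perm 'I_N}) (r : nat) (x : 'I_N -> nat -> R) : 'I_N -> nat -> R :=
  fun n l => if (l < r)%N then x n l else x (p n) l.

Definition incs b M : 'I_N -> nat -> R := fun n l => b n (grid M l.+1) - b n (grid M l).

Lemma sum_incs b M n k : b n 0 = 0 ->
  b n (grid M k) = \sum_(l < k) incs b M n l.
Proof.
move=> b0; rewrite -(big_mkord xpredT (incs b M n)) telescope_sumr//.
by rewrite grid0 b0 subr0.
Qed.

Lemma sum_swinc b M p r n k : (forall n, b n 0 = 0) ->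
  sw b (grid M r) p n (grid M k) = \sum_(l < k) swinc p r (incs b M) n l.
Proof.
move=> b0; rewrite /sw grid_le -(big_mkord xpredT (swinc p r (incs b M) n)).
have H j : (j <= r)%N -> \sum_(0 <= l < j) swinc p r (incs b M) n l = b n (grid M j).
  move=> jr; rewrite (sum_incs _ _ (b0 n)) -(big_mkord xpredT (incs b M n)).
  by apply: eq_big_nat => l /andP[_ lj]; rewrite /swinc (leq_trans lj jr).
case: leqP => kr; first by rewrite H.
rewrite (@big_cat_nat _ _ _ r)//=; last exact: ltnW.
rewrite H//; congr (_ + _).
rewrite (eq_big_nat _ _ (F2 := incs b M (p n))); last first.
  by move=> l /andP[rl _]; rewrite /swinc ltnNge rl.
by rewrite telescope_sumr// ltnW.
Qed.

End Switch.

(** * Exchangeability of the increments on a dyadic grid *)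

Section ArrayLaw.
Context {R : realType} {d : measure_display} {T : measurableType d}.
Variable P : probability T R.
Context {N : nat}.
Implicit Types (B : 'I_N -> R -> T -> R) (J : nat -> T -> R) (K : nat -> T -> 'I_N).

Definition box (Lm : nat) (A : 'I_N -> nat -> set R) : set ('I_N -> nat -> R) :=
  [set x | forall n l, (l < Lm)%N -> A n l (x n l)].

Definition boxes : set (set ('I_N -> nat -> R)) :=
  [set E | exists Lm A, (forall n l, measurable (A n l)) /\ E = box Lm A].

Lemma boxes_setI : setI_closed boxes.
Proof.
move=> _ _ [L1 [A1 [m1 ->]]] [L2 [A2 [m2 ->]]].
exists (maxn L1 L2), (fun n l => (if (l < L1)%N then A1 n l else setT) `&`
  (if (l < L2)%N then A2 n l else setT)); split.
  by move=> n l; apply: measurableI; case: ifP.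
apply/seteqP; split=> x.
  by move=> [h1 h2] n l _; split; case: ifP => // hl; [exact: h1|exact: h2].
move=> h; split=> n l hl; have := h n l.
  by rewrite leq_max hl => /(_ isT)[].
by rewrite leq_max hl orbT => /(_ isT)[].
Qed.

Lemma measurable_acoord n l :
  measurable_fun setT (fun x : g_sigma_algebraType boxes => x n l).
Proof.
move=> _ A mA; rewrite setTI; apply: sub_sigma_algebra.
exists l.+1, (fun n' l' => if (n' == n) && (l' == l) then A else setT); split.
  by move=> n' l'; case: ifP.
apply/seteqP; split=> x.
  by move=> xA n' l' _; case: ifP => // /andP[/eqP-> /eqP->].
by move=> /(_ n l (leqnn _)); rewrite !eqxx.
Qed.

Lemma measurable_cyl_incs (L : seq (('I_N * R) * R)) (kk : ('I_N * R) * R -> nat) :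
  <<s boxes >> [set x : 'I_N -> nat -> R | all (fun c => \sum_(l < kk c) x c.1.1 l <= c.2) L].
Proof.
elim: L => [|c L IH] /=.
  rewrite (_ : [set _ | _] = setT); last by apply/seteqP; split.
  exact: (@measurableT _ (g_sigma_algebraType boxes)).
rewrite (_ : [set _ | _] = [set x : 'I_N -> nat -> R | \sum_(l < kk c) x c.1.1 l <= c.2] `&`
   [set x : 'I_N -> nat -> R | all (fun c => \sum_(l < kk c) x c.1.1 l <= c.2) L]); last first.
  by apply/seteqP; split=> x /=; [move/andP=> []|move=> [-> ->]].
apply: (@measurableI _ (g_sigma_algebraType boxes)) => //.
apply: measurable_leR; apply: measurable_sum => i; exact: measurable_acoord.
Qed.

Lemma BM_sys_measurable (W : R -> T -> R) t : 0 <= t ->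
  measurable_fun setT (W t : g_sigma_algebraType (BM_sys W) -> R).
Proof.
by move=> t0 _ A mA; rewrite setTI; apply: sub_sigma_algebra; exists t; split=> //; exists A.
Qed.

Definition cell_prob M : set R -> \bar R := normal_prob 0 (Num.sqrt (2 ^- M)).

(** Independence across labels, across cells and from [(J, K)] gives a product. Each factor depends
    on the set [A n l] but not on its label or cell, which is exactly what permits exchanging
    labels. *)
Lemma box_prob B J K DJ DK M Lm A : BD_noise P B J K ->
  <<s J_sys J >> DJ -> <<s K_sys K >> DK -> (forall n l, measurable (A n l)) ->
  P (DJ `&` DK `&` (fun w => incs (path_of B w) M) @^-1` box Lm A) =
  (\prod_(n < N) \prod_(l < Lm) cell_prob M (A n l) * (P DJ * P DK))%E.
Proof.
move=> [hB hJ hK hI] hDJ hDK mA.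
pose E (c : 'I_N + bool) := match c with
  | inl n => \bigcap_(l in `I_Lm) ((fun w => B n (grid M l.+1) w - B n (grid M l) w) @^-1` A n l)
  | inr true => DJ | inr false => DK end.
have -> : DJ `&` DK `&` (fun w => incs (path_of B w) M) @^-1` box Lm A =
    \bigcap_(c in [set: 'I_N + bool]) E c.
  apply/seteqP; split=> w.
    by move=> [[h1 h2] h3] [n|[]] _ //= l lL; exact: h3.
  move=> h; split; first by split; [exact: (h (inr true))|exact: (h (inr false))].
  by move=> n l lL; exact: (h (inl n) Logic.I l).
rewrite hI; last first.
  move=> [n|[]] //=.
  apply: (@fin_bigcap_measurable _ (g_sigma_algebraType (BM_sys (B n)))) => //.
  move=> l _.
  have : measurable_fun setT (fun w : g_sigma_algebraType (BM_sys (B n)) =>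
      B n (grid M l.+1) w - B n (grid M l) w).
    by apply: measurable_funB; apply: BM_sys_measurable; exact: grid_ge0.
  by move=> /(_ measurableT _ (mA n l)); rewrite setTI.
rewrite big_sumType /= big_bool /=; congr (_ * _)%E; apply: eq_bigr => n _.
have [_ _ _ h4 h5] := hB n.
have gS i : grid M i < grid M i.+1 :> R.
  by rewrite -subr_gt0 gridS invr_gt0 two_exp_gt0.
rewrite (@h5 (grid M) (grid_ge0 M 0) gS Lm
  (fun l => (fun w => B n (grid M l.+1) w - B n (grid M l) w) @^-1` A n l)); last first.
  by move=> l _; apply: sub_sigma_algebra; exists (A n l) => //; exact: mA.
by apply: eq_bigr => l _; rewrite (h4 _ _ (grid_ge0 M l) (gS l) _ (mA n l)) gridS.
Qed.

Lemma box_swinc p r Lm A : swinc p r @^-1` box Lm A =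
  box Lm (fun n l => if (l < r)%N then A n l else A (p^-1%g n) l).
Proof.
apply/seteqP; split=> x h n l lL.
  case: ifP => lr; first by have := h n l lL; rewrite /swinc lr.
  by have := h (p^-1%g n) l lL; rewrite /swinc lr permKV.
rewrite /swinc; case: ifP => lr; first by have := h n l lL; rewrite lr.
by have := h (p n) l lL; rewrite lr permK.
Qed.

Definition dyadic_time (c : 'I_N * R) : Prop := dyadic c.2.

Definition swB B s p : 'I_N -> R -> T -> R := fun n t w => sw (path_of B w) s p n t.

Lemma noise0 B J K : BD_noise P B J K -> forall n w, B n 0 w = 0.
Proof. by move=> [hB _ _ _] n w; case: (hB n). Qed.

Lemma noiseM B J K : BD_noise P B J K ->
  forall n t, 0 <= t -> measurable_fun setT (B n t).
Proof. by move=> [hB _ _ _] n t t0; case: (hB n) => /(_ t t0). Qed.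

Lemma noise_incs_measurable B J K M E : BD_noise P B J K -> boxes E ->
  measurable ((fun w => incs (path_of B w) M) @^-1` E).
Proof.
move=> hN [Lm [A [mA ->]]].
rewrite (_ : _ @^-1` _ = \bigcap_(n in [set: 'I_N]) \bigcap_(l in `I_Lm)
    ((fun w => B n (grid M l.+1) w - B n (grid M l) w) @^-1` A n l)); last first.
  apply/seteqP; split=> w; first by move=> h n _ l lL; exact: h.
  by move=> h n l lL; exact: (h n Logic.I l).
apply: fin_bigcap_measurable => // n _; apply: fin_bigcap_measurable => // l _.
have : measurable_fun setT (fun w => B n (grid M l.+1) w - B n (grid M l) w).
  by apply: measurable_funB; apply: (noiseM hN); exact: grid_ge0.
by move=> /(_ measurableT _ (mA n l)); rewrite setTI.
Qed.

(** On a grid containing [q] and all times of the cylinder, the switch permutes the labels inside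
    each column [l >= r]. The product formula is invariant under this reindexing by [p], and boxes
    generate the cylinders. *)
Lemma exchange_law B J K q p : BD_noise P B J K -> dyadic q ->
  law_eq P dyadic_time B (swB B q p) J K.
Proof.
move=> hN dq DJ DK hDJ hDK L hL.
have mJ : measurable DJ by apply: measurable_J_sys hDJ; case: hN => _ [].
have mK : measurable DK by apply: measurable_K_sys hDK; case: hN => _ _ [].
have [M hM] : exists M, (exists r, q = grid M r) /\
    forall c, c \in L -> exists k, c.1.2 = grid M k.
  (* [None] stands for [q], so that one grid serves the switching time and the times of the
     cylinder. *)
  have [] := @dyadic_common R (option (('I_N * R) * R)) (None :: [seq Some c | c <- L])
    (fun o => if o is Some c then c.1.2 else q).
    move=> c; rewrite inE => /orP[/eqP->//|/mapP[c' c'L ->]]; exact: hL.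
  move=> M hM; exists M; split; first exact: (hM None (mem_head _ _)).
  by move=> c cL; apply: (hM (Some c)); rewrite inE; apply/orP; right; apply/mapP; exists c.
have [[r qr] hk] := hM.
have [kk hkk] : {kk : ('I_N * R) * R -> nat & forall c, c \in L -> c.1.2 = grid M (kk c)}.
  apply: (@choice _ _ (fun c k => c \in L -> c.1.2 = grid M k)) => c.
  have [cL|] := boolP (c \in L); last by exists 0%N.
  by have [k ck] := hk c cL; exists k.
pose W : set ('I_N -> nat -> R) := [set x : 'I_N -> nat -> R | all (fun c => \sum_(l < kk c) x c.1.1 l <= c.2) L].
have B0 w n : path_of B w n 0 = 0 by exact: (noise0 hN).
pose f w := incs (path_of B w) M.
have -> : cyl (bcoord B) L = f @^-1` W.
  apply/seteqP; split=> w /allP h; apply/allP => c cL; have := h c cL;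
    by rewrite /bcoord (hkk c cL) -/(path_of B w c.1.1 _) (sum_incs _ _ (B0 w _)).
have -> : cyl (bcoord (swB B q p)) L = (swinc p r \o f) @^-1` W.
  apply/seteqP; split=> w /allP h; apply/allP => c cL; have := h c cL;
    by rewrite /bcoord (hkk c cL) /swB qr (sum_swinc _ _ _ _ _ (B0 w)).
have [||E hE|||] := @pi_lambda_eq _ _ _ P _ boxes f (swinc p r \o f)
  (DJ `&` DK) (DJ `&` DK) 1 ler01 boxes_setI _ _ _ _ _ W (measurable_cyl_incs L kk).
- exact: measurableI.
- exact: measurableI.
- split; first exact: (noise_incs_measurable _ hN).
  rewrite comp_preimage; apply: (noise_incs_measurable _ hN).
  move: hE => [Lm [A [mA ->]]]; rewrite box_swinc.
  exists Lm, (fun n l => if (l < r)%N then A n l else A (p^-1%g n) l).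
  by split=> // n l; case: (l < r)%N.
- by rewrite mul1e.
- move=> E [Lm [A [mA ->]]]; rewrite mul1e comp_preimage box_swinc !(box_prob _ _ hN)//;
    last by move=> n l; case: ifP.
  congr (_ * _)%E; rewrite exchange_big/= [RHS]exchange_big/=; apply: eq_bigr => l _.
  case: (l < r)%N => //.
  by rewrite [RHS](reindex_inj (@perm_inj _ p))/=; apply: eq_bigr => n _; rewrite permK.
- by move=> _ _; rewrite mul1e.
Qed.

End ArrayLaw.

Lemma measurable_select {R : realType} {d : measure_display} {T : measurableType d}
    (I : countType) (k : T -> I) (h : I -> T -> R) :
  (forall i, measurable (k @^-1` [set i])) ->
  (forall i, measurable (k @^-1` [set i]) -> (exists w, k w = i) ->
     measurable_fun setT (h i)) ->
  measurable_fun setT (fun w => h (k w) w).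
Proof.
move=> mk mh _ A mA; rewrite setTI.
rewrite (_ : _ @^-1` _ = \bigcup_(i in [set: I]) (k @^-1` [set i] `&` h i @^-1` A)).
  apply: countable_bigcupT_measurable; first exact: countableP.
  move=> i; have [[w kw]|nk] := pselect (exists w, k w = i); last first.
    rewrite (_ : k @^-1` _ = set0) ?set0I//.
    by apply/seteqP; split=> w //= kw; apply: nk; exists w.
  apply: measurableI => //; rewrite -[X in measurable X]setTI; apply: mh => //.
  by exists w.
apply/seteqP; split=> w; first by move=> h'; exists (k w).
by move=> [i _ [/= <-]].
Qed.

Lemma measurable_truncn_fiber {R : realType} k :
  measurable [set x : R | Num.truncn x = k].
Proof.
(* [truncn] sends every negative number to [0], so there is no lower bound when [k] is [0]. *)
have -> : [set x : R | Num.truncn x = k] = [set x | x < k.+1%:R] `&`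
    ([set x | k%:R <= x] `|` (if k == 0%N then setT else set0)).
  apply/seteqP; split=> x /=.
    move=> xk; split; first by rewrite -xk truncnS_gt.
    have [x0|x0] := leP 0 x; first by left; rewrite -xk truncn_le.
    right; suff -> : k == 0%N by [].
    by rewrite -xk; apply/eqP; apply/truncn0Pn; rewrite -ltNge (lt_trans x0).
  move=> [xk [kx|]]; first by apply: truncn_def; rewrite kx xk.
  case: ifP => // /eqP k0 _; move: xk; rewrite k0 => x1.
  by apply/truncn0Pn; rewrite -ltNge.
apply: measurableI.
  by rewrite (_ : [set _ | _] = `]-oo, k.+1%:R[%classic)//.
apply: measurableU; last by case: ifP.
rewrite (_ : [set _ | _] = `[k%:R, +oo[%classic); first exact: measurable_itv.
by apply/seteqP; split=> x; rewrite /= in_itv /= andbT.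
Qed.

(** * Exchanging Brownian motions after a random time *)

Section Past.
Context {R : realType} {d : measure_display} {T : measurableType d}.
Variable P : probability T R.
Context {N : nat}.
Implicit Types (B : 'I_N -> R -> T -> R) (J : nat -> T -> R) (K : nat -> T -> 'I_N).

(* A pi-system generating the jump times, the choices and the Brownian
   coordinates [(n, t)] selected by [Q]. *)
Definition Fgen B J K (Q : 'I_N * R -> Prop) : set (set T) :=
  [set E | exists DJ DK L, [/\ <<s J_sys J >> DJ, <<s K_sys K >> DK,
    (forall c, c \in L -> Q c.1) & E = DJ `&` DK `&` cyl (bcoord B) L]].

Lemma Fgen_setI B J K Q : setI_closed (Fgen B J K Q).
Proof.
move=> _ _ [J1 [K1 [L1 [hJ1 hK1 hL1 ->]]]] [J2 [K2 [L2 [hJ2 hK2 hL2 ->]]]].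
exists (J1 `&` J2), (K1 `&` K2), (L1 ++ L2); split.
- exact: gen_setI.
- exact: gen_setI.
- by move=> c; rewrite mem_cat => /orP[/hL1|/hL2].
- apply/seteqP; split=> w; rewrite /cyl /= all_cat.
    by move=> [[[? ?] ->] [[? ?] ->]].
  by move=> [[[? ?] [? ?]] /andP[? ?]].
Qed.

Lemma Fgen_J B J K Q D : <<s J_sys J >> D -> <<s Fgen B J K Q >> D.
Proof.
move=> hD; apply: sub_sigma_algebra; exists D, setT, [::]; split => //.
  exact: gen_setT.
by apply/seteqP; split=> w // [[]].
Qed.

Lemma Fgen_K B J K Q D : <<s K_sys K >> D -> <<s Fgen B J K Q >> D.
Proof.
move=> hD; apply: sub_sigma_algebra; exists setT, D, [::]; split => //.
  exact: gen_setT.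
by apply/seteqP; split=> w // [[]].
Qed.

Lemma Fgen_B B J K (Q : 'I_N * R -> Prop) c : Q c ->
  measurable_fun setT (bcoord B c : g_sigma_algebraType (Fgen B J K Q) -> R).
Proof.
move=> Qc; apply: measurable_fun_leR => a; apply: sub_sigma_algebra.
exists setT, setT, [:: (c, a)]; split => //; try exact: gen_setT.
  by move=> c'; rewrite inE => /eqP ->.
by apply/seteqP; split=> w; rewrite /cyl /= andbT; [move=> ->|move=> [_ ->]].
Qed.

Lemma Fgen_measurable B J K (Q : 'I_N * R -> Prop) D : BD_noise P B J K ->
  (forall c, Q c -> 0 <= c.2) -> <<s Fgen B J K Q >> D -> measurable D.
Proof.
move=> hN hQ; apply: gen_measurable => _ [DJ [DK [L [h1 h2 h3 ->]]]].
apply: measurableI; first apply: measurableI.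
- by apply: measurable_J_sys h1; case: hN => _ [].
- by apply: measurable_K_sys h2; case: hN => _ _ [].
- by apply: measurable_cyl => c /h3 /hQ; exact: (noiseM hN).
Qed.

(** Dyadic coordinates suffice: values at other times, even random ones, are recovered as limits
    along [dfloor]. *)
Definition past (q : R) (c : 'I_N * R) : Prop := dyadic c.2 /\ c.2 <= q.

Lemma dyadic_ge0 (t : R) : dyadic t -> 0 <= t.
Proof. by move=> [M [k ->]]; exact: grid_ge0. Qed.

Lemma past_ge0 q c : past q c -> 0 <= c.2. Proof. by move=> [/dyadic_ge0]. Qed.

Lemma swB_measurable B J K q p n t : BD_noise P B J K -> 0 <= q -> 0 <= t ->
  measurable_fun setT (swB B q p n t).
Proof.
move=> hN q0 t0; rewrite /swB /sw /path_of; case: (t <= q); first exact: (noiseM hN).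
apply: measurable_funD; first exact: (noiseM hN).
by apply: measurable_funB; exact: (noiseM hN).
Qed.

(** A switch at [q] leaves every coordinate up to [q] unchanged. A cylinder of the past can thus be
    appended to [L] on both sides of [exchange_law]; a monotone class argument then reaches all of
    the past. *)
Lemma exchange_past B J K q p H L : BD_noise P B J K -> dyadic q ->
  <<s Fgen B J K (past q) >> H -> (forall c, c \in L -> dyadic c.1.2) ->
  P (H `&` cyl (bcoord B) L) = P (H `&` cyl (bcoord (swB B q p)) L).
Proof.
move=> hN dq hH hL; rewrite ![H `&` _]setIC.
have mc1 : measurable (cyl (bcoord B) L).
  by apply: measurable_cyl => c /hL /dyadic_ge0; exact: (noiseM hN).
have mc2 : measurable (cyl (bcoord (swB B q p)) L).
  apply: measurable_cyl => c /hL /dyadic_ge0 h.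
  by apply: (swB_measurable _ _ hN) => //; exact: dyadic_ge0.
have key DJ DK L' : <<s J_sys J >> DJ -> <<s K_sys K >> DK ->
    (forall c, c \in L' -> past q c.1) ->
    P (cyl (bcoord B) L `&` (DJ `&` DK `&` cyl (bcoord B) L')) =
    P (cyl (bcoord (swB B q p)) L `&` (DJ `&` DK `&` cyl (bcoord B) L')).
  move=> h1 h2 h3; have := @exchange_law _ _ _ P _ B J K q p hN dq DJ DK h1 h2 (L ++ L').
  have -> : DJ `&` DK `&` cyl (bcoord B) (L ++ L') =
      cyl (bcoord B) L `&` (DJ `&` DK `&` cyl (bcoord B) L').
    apply/seteqP; split=> w; rewrite /cyl /= all_cat.
      by move=> [[? ?] /andP[-> ->]].
    by move=> [-> [[? ?] ->]].
  have -> : DJ `&` DK `&` cyl (bcoord (swB B q p)) (L ++ L') =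
      cyl (bcoord (swB B q p)) L `&` (DJ `&` DK `&` cyl (bcoord B) L').
    have e w : all (fun c => bcoord (swB B q p) c.1 w <= c.2) L' =
        all (fun c => bcoord B c.1 w <= c.2) L'.
      by apply: eq_in_all => c /h3[_ cq]; rewrite /bcoord /swB /sw cq.
    apply/seteqP; split=> w; rewrite /cyl /= all_cat e.
      by move=> [[? ?] /andP[-> ->]].
    by move=> [-> [[? ?] ->]].
  apply=> c; rewrite mem_cat => /orP[/hL//|/h3[]//].
have [||E hE|||] := @pi_lambda_eq _ _ _ P _ (Fgen B J K (past q)) id id
  (cyl (bcoord B) L) (cyl (bcoord (swB B q p)) L) 1 ler01 (@Fgen_setI B J K (past q))
  _ _ _ _ _ H hH.
- exact: mc1.
- exact: mc2.
- by split; apply: (Fgen_measurable hN (@past_ge0 q)); exact: sub_sigma_algebra.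
- have gJ : <<s J_sys J >> setT by exact: gen_setT.
  have gK : <<s K_sys K >> setT by exact: gen_setT.
  rewrite mul1e; have := key setT setT [::] gJ gK.
  have -> : cyl (bcoord B) [::] = setT by apply/seteqP; split.
  by rewrite !setIT; apply.
- by move=> _ [DJ [DK [L' [h1 h2 h3 ->]]]]; rewrite mul1e; exact: key.
- by move=> _ _; rewrite mul1e.
Qed.

Lemma law_eq_dyadic B B' J K : BD_noise P B J K ->
  (forall n t, dyadic t -> measurable_fun setT (B' n t)) ->
  (forall n w, {within [set t : R | 0 <= t], continuous (fun t => B' n t w)}) ->
  law_eq P dyadic_time B B' J K -> law_eq P nonneg_time B B' J K.
Proof.
move=> hN mB' cB' h DJ DK hDJ hDK L hL.
have cB n w : {within [set t : R | 0 <= t], continuous (fun t => B n t w)}.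
  by case: hN => hB _ _ _; case: (hB n).
have mJ : measurable DJ by apply: measurable_J_sys hDJ; case: hN => _ [].
have mK : measurable DK by apply: measurable_K_sys hDK; case: hN => _ _ [].
have dy m (t : R) : dyadic (dfloor m t) by exists m; eexists.
apply: (@cyl_lim_eq _ _ _ P _ _ _ (fun m c => bcoord B (c.1, dfloor m c.2))
  (fun m c => bcoord B' (c.1, dfloor m c.2))).
- exact: measurableI.
- by move=> m c cL; apply: (noiseM hN); exact: grid_ge0.
- by move=> m c cL; apply: mB'; exact: dy.
- move=> w c cL; apply: (within_continuous_seq (cB c.1.1 w)).
  + exact: hL.
  + by move=> m; exact: grid_ge0.
  + by apply: dfloor_cvg; exact: hL.
- move=> w c cL; apply: (within_continuous_seq (cB' c.1.1 w)).
  + exact: hL.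
  + by move=> m; exact: grid_ge0.
  + by apply: dfloor_cvg; exact: hL.
- move=> m e.
  have E (X : 'I_N -> R -> T -> R) : cyl (fun c => bcoord X (c.1, dfloor m c.2)) (relax L e) =
      cyl (bcoord X) [seq ((c.1.1, dfloor m c.1.2), c.2 + e) | c <- L].
    by apply/seteqP; split=> w; rewrite /cyl /relax /= !all_map.
  by rewrite !E; apply: h => // c /mapP[c' _ ->]; exact: dy.
Qed.

Section OneSwitch.
Context (B : 'I_N -> R -> T -> R) (J : nat -> T -> R) (K : nat -> T -> 'I_N).
Context (tau : T -> R) (rho : T -> {perm 'I_N}).
Hypothesis hN : BD_noise P B J K.
Hypothesis mtau : forall a, <<s J_sys J >> [set w | tau w <= a].
(** Paths with ill-behaved jump times are left alone: there the permutation is the identity and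
    [tau] may be negative. *)
Hypothesis tau_rho : forall w, 0 <= tau w \/ rho w = 1%g.
(** Adaptedness: before time [q] the permutation may use [J] and [K] in full, as they are
    independent of the Brownian motions, but the motions only up to [q]. *)
Hypothesis mrho : forall q p, dyadic q ->
  <<s Fgen B J K (past q) >> ([set w | rho w = p] `&` [set w | tau w <= q]).

Definition switched : 'I_N -> R -> T -> R :=
  fun n t w => sw (path_of B w) (tau w) (rho w) n t.

(** The time is discretised from above, so that [rho] is already known when the approximate switch
    takes place. *)
Let switchedm m : 'I_N -> R -> T -> R :=
  fun n t w => sw (path_of B w) (dceil m (tau w)) (rho w) n t.

Let kap m w : nat * {perm 'I_N} := (Num.truncn (tau w * 2 ^+ m), rho w).

Let cB n w : {within [set t : R | 0 <= t], continuous (fun t => B n t w)}.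
Proof. by case: hN => hB _ _ _; case: (hB n). Qed.

Let mtauJ : measurable_fun setT (tau : g_sigma_algebraType (J_sys J) -> R).
Proof. by apply: measurable_fun_leR => a; exact: mtau. Qed.

Let kapF m k p : <<s Fgen B J K (past (grid m k.+1)) >> (kap m @^-1` [set (k, p)]).
Proof.
have dq : dyadic (grid m k.+1 : R) by exists m, k.+1.
rewrite (_ : _ @^-1` _ = [set w | Num.truncn (tau w * 2 ^+ m) = k] `&`
   ([set w | rho w = p] `&` [set w | tau w <= grid m k.+1])).
  apply: gen_setI; last exact: mrho.
  apply: Fgen_J.
  have h : measurable_fun setT (fun w : g_sigma_algebraType (J_sys J) => tau w * 2 ^+ m).
    by apply: measurable_funM.
  have -> : [set w | Num.truncn (tau w * 2 ^+ m) = k] =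
     (fun w => tau w * 2 ^+ m) @^-1` [set x | Num.truncn x = k] by [].
  have := h measurableT [set x | Num.truncn x = k]; rewrite setTI; apply.
  exact: measurable_truncn_fiber.
apply/seteqP; split=> w /=; last by move=> [h1 [h2 _]]; rewrite /kap h1 h2.
move=> [h1 h2]; split => //; split => //; rewrite /grid ler_pdivlMr ?two_exp_gt0//.
by rewrite ltW// -h1 truncnS_gt.
Qed.

Let mkap m i : measurable (kap m @^-1` [set i]).
Proof. by case: i => k p; exact: (Fgen_measurable hN (@past_ge0 _) (@kapF m k p)). Qed.

Let switchedmE m : switchedm m =
  fun n t w => swB B (grid m (kap m w).1.+1) (kap m w).2 n t w.
Proof. by []. Qed.

Let mswitchedm m n t : 0 <= t -> measurable_fun setT (switchedm m n t).
Proof.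
move=> t0; rewrite switchedmE.
apply: (@measurable_select _ _ _ _ (kap m) (fun i => swB B (grid m i.1.+1) i.2 n t)).
  exact: mkap.
by move=> i _ _; apply: (swB_measurable _ _ hN) => //; exact: grid_ge0.
Qed.

Let switchedm_cvg w n t : 0 <= t -> switchedm m n t w @[m --> \oo] --> switched n t w.
Proof.
move=> t0; rewrite /switchedm /switched.
case: (tau_rho w) => [tw|->]; last first.
  by rewrite sw1; under eq_fun do rewrite sw1; exact: cvg_cst.
rewrite {2}/sw; have [ttau|ttau] := leP t (tau w).
  have e m : sw (path_of B w) (dceil m (tau w)) (rho w) n t = path_of B w n t.
    rewrite /sw (le_trans ttau)//; have /andP[_ h] := dfloor_dceil m tw; exact: ltW.
  by under eq_fun do rewrite e; exact: cvg_cst.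
have cv (n' : 'I_N) : path_of B w n' (dceil m (tau w)) @[m --> \oo] --> path_of B w n' (tau w).
  apply: (within_continuous_seq (@cB n' w)) => //; first by move=> m; exact: grid_ge0.
  exact: dceil_cvg.
apply: cvg_trans; last exact: (cvgD (cv n) (cvgB (cvg_cst _) (cv (rho w n)))).
apply: near_eq_cvg.
have [M _ HM] := cvgr_lt _ (dceil_cvg tw) _ ttau.
by exists M => // m /HM /= h; rewrite /sw leNgt h.
Qed.

Lemma switched_continuous n w :
  {within [set t : R | 0 <= t], continuous (fun t => switched n t w)}.
Proof.
rewrite /switched; case: (tau_rho w) => [tw|->].
  by apply: sw_continuous => // n'; exact: cB.
rewrite (_ : (fun t => _) = path_of B w n); first exact: cB.
by apply/funext => t; rewrite sw1.
Qed.

(** Strong Markov argument: on the cell where [kap m] is [(k, p)] the approximate switch is the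
    deterministic one at [grid m k.+1], and the cell belongs to the past of that time. Exchange on
    each cell, sum over the cells, then let [m] tend to infinity. *)
Lemma switched_law_eq : law_eq P nonneg_time B switched J K.
Proof.
have msw n t : 0 <= t -> measurable_fun setT (switched n t).
  move=> t0; apply: (@measurable_fun_cvg _ _ _ _ (fun m => switchedm m n t)).
    by move=> m; exact: mswitchedm.
  by move=> w _; exact: switchedm_cvg.
apply: (law_eq_dyadic hN).
- by move=> n t /dyadic_ge0; exact: msw.
- exact: switched_continuous.
move=> DJ DK hDJ hDK L hL.
have mJ : measurable DJ by apply: measurable_J_sys hDJ; case: hN => _ [].
have mK : measurable DK by apply: measurable_K_sys hDK; case: hN => _ _ [].
have hL0 c : c \in L -> 0 <= c.1.2 by move=> /hL /dyadic_ge0.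
apply: (@cyl_lim_eq _ _ _ P _ _ _ (fun m => bcoord B) (fun m => bcoord (switchedm m))).
- exact: measurableI.
- by move=> m c /hL0; exact: (noiseM hN).
- by move=> m c /hL0; exact: mswitchedm.
- by move=> w c _; exact: cvg_cst.
- by move=> w c /hL0; exact: switchedm_cvg.
move=> m e.
have hL' c : c \in relax L e -> dyadic c.1.2 by move=> /mapP[c' /hL h ->].
have mD : measurable (DJ `&` DK) by exact: measurableI.
apply: (@partition_eq _ _ _ P _ (kap m)).
- exact: mkap.
- apply: measurableI => //; apply: measurable_cyl => c /hL' /dyadic_ge0; exact: (noiseM hN).
- by apply: measurableI => //; apply: measurable_cyl => c /hL' /dyadic_ge0; exact: mswitchedm.
move=> [k p]; rewrite !(setIAC (DJ `&` DK) _ (kap m @^-1` _)).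
have -> : DJ `&` DK `&` kap m @^-1` [set (k, p)] `&` cyl (bcoord (switchedm m)) (relax L e) =
    DJ `&` DK `&` kap m @^-1` [set (k, p)] `&` cyl (bcoord (swB B (grid m k.+1) p)) (relax L e).
  have E w : kap m w = (k, p) -> all (fun c => bcoord (switchedm m) c.1 w <= c.2) (relax L e) =
      all (fun c => bcoord (swB B (grid m k.+1) p) c.1 w <= c.2) (relax L e).
    by move=> kw; apply: eq_all => c; rewrite /bcoord switchedmE kw.
  by apply/seteqP; split=> w [[? /= kw]] h; split => //; move: h; rewrite /cyl /= E.
apply: (exchange_past p hN) => //; first by exists m; exists k.+1.
apply: gen_setI; last exact: kapF.
by apply: gen_setI; [exact: Fgen_J|exact: Fgen_K].
Qed.

Lemma switched_noise : BD_noise P switched J K.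
Proof.
apply: (noise_transfer hN switched_law_eq).
- move=> n t t0; apply: (@measurable_fun_cvg _ _ _ _ (fun m => switchedm m n t)).
    by move=> m; exact: mswitchedm.
  by move=> w _; exact: switchedm_cvg.
- move=> n w; rewrite /switched; case: (tau_rho w) => [tw|->]; last first.
    by rewrite sw1; exact: (noise0 hN).
  by rewrite /sw tw; exact: (noise0 hN).
- exact: switched_continuous.
Qed.

End OneSwitch.

End Past.

(** * The pathwise coupling *)

Section Counting.
Context {R : realType} {N : nat}.
Implicit Types (z x : 'I_N -> R) (y c : R) (m k n : 'I_N) (p : {perm 'I_N}).

(** The counts at all levels encode the order statistics and are blind to labels. *)
Definition cnt z y : nat := (\sum_n (y < z n)%R)%N.

Lemma cnt_le z y : (cnt z y <= N)%N.
Proof.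
rewrite -[X in (_ <= X)%N](card_ord N) -sum1_card; apply: leq_sum => n _.
by case: (_ < _).
Qed.

Lemma cnt_perm z p y : cnt (z \o p) y = cnt z y.
Proof. by rewrite /cnt [RHS](reindex_inj (@perm_inj _ p)). Qed.

Lemma size_sorted_pos z : size (sorted_pos z) = N.
Proof. by rewrite /sorted_pos size_sort size_map size_enum_ord. Qed.

Lemma count_sorted_pos z y : count (fun u => y < u) (sorted_pos z) = cnt z y.
Proof.
rewrite /sorted_pos (seq.permP (permEl (perm_sort _ _))) count_map /cnt -sum1_count.
by rewrite big_mkcond /= big_enum /=; apply: eq_bigr => n _; case: (_ < _).
Qed.

Lemma sorted_pos_sorted z : sorted <=%R (sorted_pos z).
Proof. by apply: sort_sorted; exact: le_total. Qed.

Lemma nth_sorted_gt z k y :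
  (y < nth 0 (sorted_pos z) k) = (N - k <= cnt z y)%N.
Proof.
have kN := ltn_ord k; have sz := size_sorted_pos z.
have mono i j : (i <= j)%N -> (j < N)%N ->
    nth 0 (sorted_pos z) i <= nth 0 (sorted_pos z) j.
  move=> ij jN; apply: (sorted_leq_nth le_trans le_refl 0 (sorted_pos_sorted z)) => //.
    by rewrite inE sz (leq_ltn_trans ij).
  by rewrite inE sz.
rewrite -count_sorted_pos; apply/idP/idP => h.
  rewrite -(cat_take_drop k (sorted_pos z)) count_cat.
  apply: (leq_trans _ (leq_addl _ _)).
  rewrite (_ : count _ (drop k _) = (N - k)%N)//.
  rewrite -[RHS](_ : size (drop k (sorted_pos z)) = (N - k)%N); last by rewrite size_drop sz.
  apply/eqP; rewrite -all_count; apply/(all_nthP 0) => i; rewrite size_drop sz => ik.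
  by rewrite nth_drop (lt_le_trans h)// mono ?leq_addr// -ltn_subRL.
rewrite ltNge; apply/negP => h'; move: h.
rewrite -(cat_take_drop k.+1 (sorted_pos z)) count_cat.
have -> : count (fun u => y < u) (take k.+1 (sorted_pos z)) = 0%N.
  apply/eqP; rewrite -leqn0 leqNgt -has_count; apply/negP => /(has_nthP 0)[i].
  rewrite size_take sz => ik.
  have ik1 : (i < k.+1)%N by move: ik; case: ifP; lia.
  by rewrite nth_take// ltNge (le_trans _ h')// mono.
rewrite add0n; apply/negP; rewrite -ltnNge.
apply: (leq_ltn_trans (count_size _ _)); rewrite size_drop sz.
by rewrite ltn_sub2l.
Qed.

Lemma nth_sorted_ex z k : exists n, nth 0 (sorted_pos z) k = z n.
Proof.
have : nth 0 (sorted_pos z) k \in sorted_pos z by rewrite mem_nth// size_sorted_pos.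
by rewrite /sorted_pos mem_sort => /mapP[n _ ->]; exists n.
Qed.

Lemma nth_sorted_first z k n : k = 0%N :> nat -> nth 0 (sorted_pos z) k <= z n.
Proof.
move=> k0; rewrite leNgt nth_sorted_gt k0 subn0 -ltnNge.
rewrite /cnt (bigD1 n)//= ltxx add0n.
apply: (@leq_ltn_trans (\sum_(i | i != n) 1)); first by apply: leq_sum => i _; case: (_ < _).
by rewrite sum1_card cardC1 card_ord; have := ltn_ord n; lia.
Qed.

Lemma nth_sorted_last z k n : k = N.-1 :> nat -> z n <= nth 0 (sorted_pos z) k.
Proof.
move=> kN; rewrite leNgt; apply/negP => h.
have := nth_sorted_gt z k (nth 0 (sorted_pos z) k); rewrite ltxx kN.
have N0 : (0 < N)%N by exact: leq_ltn_trans (ltn_ord n).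
have -> : (N - N.-1 = 1)%N by lia.
by rewrite /cnt (bigD1 n)//= -kN h add1n.
Qed.

Lemma sorted_pos_perm z p : sorted_pos (z \o p) = sorted_pos z.
Proof.
apply/perm_sortP; [exact: le_total|exact: le_trans|exact: le_anti|].
rewrite (map_comp z p); apply: perm_map; apply: uniq_perm.
- by rewrite map_inj_uniq ?enum_uniq//; exact: perm_inj.
- exact: enum_uniq.
- move=> n; rewrite mem_enum; apply/mapP; exists (p^-1%g n); first by rewrite mem_enum.
  by rewrite permKV.
Qed.

Definition jump z m k : 'I_N -> R :=
  fun n => if n == m then nth 0 (sorted_pos z) k else z n.

(** One particle is taken from its side of [y] and one is added on the side of the copied particle.
    The additive form avoids truncated subtraction. *)
Lemma cnt_jump z m k y :
  (cnt (jump z m k) y + (y < z m)%R = cnt z y + (N - k <= cnt z y)%N)%N.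
Proof.
rewrite -nth_sorted_gt.
have -> : cnt (jump z m k) y = ((y < nth 0 (sorted_pos z) k)%R +
    \sum_(n | n != m) (y < z n)%R)%N.
  rewrite /cnt (bigD1 m)//= {1}/jump eqxx; congr (_ + _)%N.
  by apply: eq_bigr => n /negbTE nm; rewrite /jump nm.
have -> : cnt z y = ((y < z m)%R + \sum_(n | n != m) (y < z n)%R)%N.
  by rewrite /cnt (bigD1 m).
lia.
Qed.

Lemma jump_ge z m k n : (forall n, z m <= z n) -> z n <= jump z m k n.
Proof.
move=> hm; rewrite /jump; case: eqP => // ->.
by have [n' ->] := nth_sorted_ex z k.
Qed.

(* With [a] particles above [y] before the jump, the count after removal of the
   leftmost particle is [a - (a == N) + (N - k <= a)], which is monotone in [a];
   removing any other particle can only give a smaller count. *)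
Lemma jump_dom z x c k m m' : (forall n, z n <= x n + c) ->
  (forall n, x m' <= x n) ->
  forall y, (cnt (jump z m k) y <= cnt (jump x m' k) (y - c))%N.
Proof.
move=> zx xm y.
have h1 := cnt_jump z m k y; have h2 := cnt_jump x m' k (y - c).
have ha : (cnt z y <= cnt x (y - c))%N.
  apply: leq_sum => n _; have [yz|] := boolP (y < z n) => //.
  by rewrite ltrBlDr (lt_le_trans yz).
have a'N := cnt_le x (y - c); have jN := cnt_le (jump z m k) y.
have hx : y - c < x m' -> cnt x (y - c) = N.
  move=> h; rewrite /cnt (eq_bigr (fun=> 1%N)) ?sum1_card ?card_ord// => n _.
  by rewrite (lt_le_trans h).
have hz : cnt z y = N -> y < z m.
  move=> h; apply/negPn/negP => hm; suff : (cnt z y < N)%N by rewrite h ltnn.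
  rewrite /cnt (bigD1 m)//= (negbTE hm) add0n.
  apply: (@leq_ltn_trans (\sum_(i | i != m) 1)); first by apply: leq_sum => i _; case: (_ < _).
  by rewrite sum1_card cardC1 card_ord; have := ltn_ord m; lia.
move: (cnt z y) (cnt x (y - c)) (cnt (jump z m k) y) (cnt (jump x m' k) (y - c))
  h1 h2 ha a'N jN hx hz => a a' j1 j2.
case: (y - c < x m') => h1 h2 ha a'N jN hx hz.
  have := hx isT; lia.
lia.
Qed.

(** Label [a] of [x] is matched with label [p a] of [z]. The premise is strict and the conclusion
    weak, so that such a [p] exists whatever the ties. *)
Definition simord x z p : bool :=
  [forall a, forall b, (x a < x b) ==> (z (p a) <= z (p b))].

Lemma sorting_perm z : exists p, forall i j : 'I_N, (i <= j)%N -> z (p i) <= z (p j).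
Proof.
pose t := [tuple z i | i < N].
have /tuple_permP[p hp] : perm_eq (sort_tuple <=%R t) t by rewrite /= perm_sort.
exists p => i j ij.
have e l : z (p l) = nth 0 (sort <=%R t) l.
  have -> : nth 0 (sort <=%R t) l = tnth (sort_tuple <=%R t) l by rewrite (tnth_nth 0).
  have -> : tnth (sort_tuple <=%R t) l = nth 0 (sort_tuple <=%R t) l by rewrite (tnth_nth 0).
  by rewrite hp -tnth_nth !tnth_mktuple.
rewrite !e; apply: (sorted_leq_nth le_trans le_refl 0) => //.
- by apply: sort_sorted; exact: le_total.
- by rewrite inE size_sort size_tuple.
- by rewrite inE size_sort size_tuple.
Qed.

Lemma simord_ex x z : exists p, simord x z p.
Proof.
have [sx hx] := sorting_perm x; have [sz hz] := sorting_perm z.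
exists (sx^-1 * sz)%g; apply/forallP => a; apply/forallP => b; apply/implyP => ab.
rewrite !permM; apply: hz; rewrite leqNgt; apply/negP => /ltnW /hx.
by rewrite !permKV leNgt ab.
Qed.

(** If label [n] violated the bound, then above the level [x n + c] the system [z] would have [p n]
    together with the partners of all labels strictly above [n] in [x]: one particle more than the
    counts allow. *)
Lemma match_le x z p c : simord x z p -> (forall y, cnt z y <= cnt x (y - c))%N ->
  forall n, z (p n) <= x n + c.
Proof.
move=> /forallP so h n; rewrite leNgt; apply/negP => hn.
have := h (x n + c); rewrite addrK; apply/negP; rewrite -ltnNge.
rewrite -(cnt_perm z p) /cnt (bigD1 n)//= ltxx add0n [in X in (_ < X)%N](bigD1 n)//=.
rewrite hn add1n ltnS; apply: leq_sum => a _; have [xa|] := boolP (x n < x a) => //.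
by move: (so n) => /forallP /(_ a); rewrite xa /= => za; rewrite (lt_le_trans hn).
Qed.

(** The same counting at level [z (p n) + c]; now a partner strictly above [p n] in [z] cannot have
    its [x] position below [x n]. *)
Lemma match_ge x z p c : simord x z p -> (forall y, cnt x y <= cnt z (y - c))%N ->
  forall n, x n <= z (p n) + c.
Proof.
move=> /forallP so h n; rewrite leNgt; apply/negP => hn.
have := h (z (p n) + c); rewrite addrK; apply/negP; rewrite -ltnNge.
rewrite -(cnt_perm z p) /cnt (bigD1 n)//= ltxx add0n [in X in (_ < X)%N](bigD1 n)//=.
rewrite hn add1n ltnS; apply: leq_sum => a _; have [za|] := boolP (z (p n) < z (p a)) => //.
suff xa : x n <= x a by rewrite (lt_le_trans hn).
rewrite leNgt; apply/negP => xa.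
by move: (so a) => /forallP /(_ n); rewrite xa /= leNgt za.
Qed.

End Counting.

(** * The coupled pair of systems along a fixed noise *)

Section CoupledSystem.
Context {R : realType} {N : nat} (i0 : 'I_N) (mu : R) (y0 : 'I_N -> R).
Implicit Types (z : 'I_N -> R) (j : nat -> R) (k : nat -> 'I_N).

(** Ties are broken by enumeration, which makes the choice a function of finitely many comparisons
    and hence measurable. A minimiser always exists, so [i0] only makes the function total. *)
Definition argm (s : R -> R) z : 'I_N :=
  odflt i0 [pick m | [forall n, s (z m) <= s (z n)]].

Lemma argmP s z n : s (z (argm s z)) <= s (z n).
Proof.
rewrite /argm; case: pickP => [m /forallP //|h].
pose m := [arg min_(m < i0) s (z m)]%O.
suff : [forall n, s (z m) <= s (z n)] by rewrite h.
by apply/forallP => n'; rewrite /m; case: arg_minP => // a _ /(_ n' isT).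
Qed.

Definition bee : R -> R := fun u => - `|u|.

Definition premove z (db : 'I_N -> R) (c : R) : 'I_N -> R := fun n => z n + db n + c.

Definition jumpZ (zm : 'I_N -> R) kk := jump zm (argm bee zm) kk.
Definition jumpX (xm : 'I_N -> R) kk := jump xm (argm id xm) kk.

Definition matching (x z : 'I_N -> R) : {perm 'I_N} := odflt 1%g [pick p | simord x z p].

Lemma matchingP x z : simord x z (matching x z).
Proof.
rewrite /matching; case: pickP => // h.
by have [p] := simord_ex x z; rewrite h.
Qed.

(** The bee positions after rematching, the N-BBM positions, and the latest matching. Only the bee
    labels are ever permuted. *)
Definition state := (('I_N -> R) * ('I_N -> R) * {perm 'I_N})%type.

Definition step (s : state) (db : 'I_N -> R) (dj : R) (kk : 'I_N) : state :=
  let Z1 := jumpZ (premove s.1.1 db (mu * dj)) kk in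
  let X1 := jumpX (premove s.1.2 db 0) kk in
  let p := matching X1 Z1 in
  (Z1 \o p, X1, p).

Fixpoint st (be : nat -> 'I_N -> R) j k (i : nat) : state :=
  if i is i'.+1 then
    step (st be j k i') (fun n => be i'.+1 n - be i' n) (j i'.+1 - j i') (k i'.+1)
  else (y0, y0, 1%g).

Lemma st_ext be be' j j' k i : (forall l, (l <= i)%N -> be l =1 be' l) ->
  (forall l, (l <= i)%N -> j l = j' l) -> st be j k i = st be' j' k i.
Proof.
elim: i => // i IH h hj /=; rewrite IH; last 2 first.
- by move=> l li; apply: h; exact: leqW.
- by move=> l li; apply: hj; exact: leqW.
have -> : j i.+1 - j i = j' i.+1 - j' i by rewrite (hj i.+1)// (hj i).
have -> : (fun n => be i.+1 n - be i n) = (fun n => be' i.+1 n - be' i n) => //.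
by apply/funext => n; rewrite (h i.+1)// (h i).
Qed.

Section Path.
Context (j : nat -> R) (k : nat -> 'I_N) (b : 'I_N -> R -> R).
Let be l n := b n (j l).
Let Zs i := (st be j k i).1.1.
Let Xs i := (st be j k i).1.2.
Let dZ i := premove (Zs i) (fun n => be i.+1 n - be i n) (mu * (j i.+1 - j i)).
Let dX i := premove (Xs i) (fun n => be i.+1 n - be i n) 0.

Hypothesis j0 : j 0%N = 0.
Hypothesis jS : forall i, j i < j i.+1.
Hypothesis joo : forall x, exists i, x < j i.

(** Common Brownian increments preserve the bound during the motion, and the drift accounts for
    [mu * j i]. At the jump [jump_dom] gives the bound for counts and [match_le] returns it to
    labels. *)
Lemma coupled_dom i n : Zs i n <= Xs i n + mu * j i.
Proof.
elim: i n => [|i IH] n; first by rewrite /Zs /Xs /= j0 mulr0 addr0.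
rewrite {1}/Zs /Xs /=; apply: match_le; first exact: matchingP.
move=> y; apply: jump_dom; last by move=> n'; exact: (argmP id).
by move=> n'; have := IH n'; rewrite /premove /Zs /Xs; lra.
Qed.

(** N-BBM jumps only move particles up, so the bee positions just before a jump are controlled by
    the N-BBM just after it, a time at which its speed can be applied. *)
Lemma coupled_premove_dom i n : dZ i n <= Xs i.+1 n + mu * j i.+1.
Proof.
apply: (@le_trans _ _ (dX i n + mu * j i.+1)).
  by have := coupled_dom i n; rewrite /dZ /dX /premove; lra.
rewrite lerD2r; apply: jump_ge => n'; exact: (argmP id).
Qed.

(** On negative positions the score is the position itself, so the bee removes its leftmost particle
    and can take the role of the dominating system in [jump_dom]. *)
Lemma coupled_dom_ge (C : R) i1 : (forall n, Xs i1 n + mu * j i1 <= Zs i1 n + C) ->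
  (forall i n, (i1 <= i)%N -> dZ i n < 0) ->
  forall i n, (i1 <= i)%N -> Xs i n + mu * j i <= Zs i n + C.
Proof.
move=> h0 hneg i n /subnKC <-; elim: (i - i1)%N n => [|l IH] n; first by rewrite addn0.
rewrite addnS; set i' := (i1 + l)%N in IH *.
have neg n' : dZ i' n' < 0 by apply: hneg; exact: leq_addr.
suff : Xs i'.+1 n <= Zs i'.+1 n + (C - mu * j i'.+1) by lra.
rewrite /Zs /Xs /=; apply: match_ge; first exact: matchingP.
move=> y; apply: jump_dom.
  by move=> n'; have := IH n'; rewrite /premove /Zs /Xs; lra.
move=> n'; have := argmP bee (dZ i') n'.
by rewrite /bee !ltr0_norm// !opprK.
Qed.

Definition idx (t : R) : nat := xget 0%N [set i | j i <= t < j i.+1].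

Lemma j_mono i l : (i <= l)%N -> j i <= j l.
Proof. by move=> /subnKC <-; elim: (l - i)%N => [|n IH]; rewrite ?addn0// addnS (le_trans IH)// ltW. Qed.

Lemma idxP t : 0 <= t -> j (idx t) <= t < j (idx t).+1.
Proof.
move=> t0; rewrite /idx; case: xgetP => [i _ //|h].
have [l hl] := joo t.
suff : exists i, j i <= t < j i.+1 by move=> [i hi]; case: (h i).
have ex : exists l, t < j l by exists l.
case: (ex_minnP ex) => -[|m] tm hm; first by move: tm; rewrite j0 ltNge t0.
by exists m; rewrite tm andbT leNgt; apply/negP => /hm; rewrite ltnn.
Qed.

Lemma idx_uniq t i : j i <= t -> t < j i.+1 -> idx t = i.
Proof.
move=> h1 h2; rewrite /idx; case: xgetP => [l _ /andP[h3 h4]|h]; last first.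
  by case: (h i); rewrite /= h1 h2.
apply/eqP; rewrite eqn_leq; apply/andP; split; rewrite leqNgt; apply/negP => /j_mono.
  by rewrite leNgt (le_lt_trans h3 h2).
by rewrite leNgt (le_lt_trans h1 h4).
Qed.

Definition Xt (t : R) : 'I_N -> R :=
  fun n => Xs (idx t) n + (b n t - b n (j (idx t))).

Lemma idx_j i : idx (j i) = i. Proof. by apply: idx_uniq. Qed.

Lemma Xt_j i : Xt (j i) = Xs i.
Proof. by apply/funext => n; rewrite /Xt idx_j subrr addr0. Qed.

Lemma Xt_BD_path : BD_path (fun x => x) 0 y0 j k b
  (fun t n => nth 0 (sorted_pos (Xt t)) n).
Proof.
exists Xt; split.
- by rewrite -[0 in LHS]j0 Xt_j.
- by move=> i t n h1 h2; rewrite /Xt (idx_uniq h1 h2) idx_j subrr addr0 mul0r addr0.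
- move=> i zm; have -> : zm = dX i.
    by apply/funext => n; rewrite /zm Xt_j /dX /premove mul0r.
  by exists (argm id (dX i)); split=> [n|n]; [exact: (argmP id)|rewrite Xt_j].
- by [].
Qed.

Section Bee.
Context (b0 : 'I_N -> R -> R) (Y : R -> 'I_N -> R) (sg : nat -> {perm 'I_N}).
Hypothesis hY : BD_path bee mu y0 j k b0 Y.
Hypothesis sg0 : sg 0%N = 1%g.
Hypothesis sgS : forall i n, sg i.+1 n = sg i ((st be j k i.+1).2 n).
Hypothesis hb : forall i n t, j i <= t -> t <= j i.+1 ->
  b n t - b n (j i) = b0 (sg i n) t - b0 (sg i n) (j i).
Hypothesis notie : forall i a a', a != a' -> `|dZ i a| != `|dZ i a'|.

(** Invariant: label [n] of the coupled bee system sits where label [sg i n] of the given system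
    sits. Without ties the removed particle is the unique minimiser, so an arbitrary tie-breaking
    rule has to agree with [argm]. *)
Lemma bee_relabel : forall t, 0 <= t -> exists p : {perm 'I_N}, exists Zt : 'I_N -> R,
  Y t =1 (fun n => nth 0 (sorted_pos Zt) n) /\
  forall n, Zt (p n) = Zs (idx t) n + (b n t - b n (j (idx t))) + mu * (t - j (idx t)).
Proof.
case: hY => Z [Z0 Zmove Zjump ZY].
have key i n : Zs i n = Z (j i) (sg i n).
  elim: i n => [|i IH] n; first by rewrite /Zs /= j0 Z0 sg0 perm1.
  pose zm n := Z (j i) n + (b0 n (j i.+1) - b0 n (j i)) + mu * (j i.+1 - j i).
  have [m [hm hZ]] : exists m, (forall n, bee (zm m) <= bee (zm n)) /\
      forall n, Z (j i.+1) n = jump zm m (k i.+1) n by exact: (Zjump i).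
  have e n' : dZ i n' = zm (sg i n').
    by rewrite /zm /dZ /premove /be IH (@hb i n' (j i.+1) (ltW (jS i)) (lexx _)).
  have es : sorted_pos (dZ i) = sorted_pos zm.
    by rewrite -(sorted_pos_perm zm (sg i)); congr sorted_pos; apply/funext => n'; exact: e.
  have am : sg i (argm bee (dZ i)) = m.
    apply/eqP; apply/negPn/negP => ne.
    have := @notie i (argm bee (dZ i)) ((sg i)^-1 m)%g.
    rewrite -(inj_eq (@perm_inj _ (sg i))) permKV => /(_ ne) /negP; apply.
    have h1 := argmP bee (dZ i) ((sg i)^-1 m)%g.
    have h2 := hm (sg i (argm bee (dZ i))).
    by move: h1 h2; rewrite !e permKV /bee eq_le => h1 h2; apply/andP; split; lra.
  have -> : Zs i.+1 n = jump (dZ i) (argm bee (dZ i)) (k i.+1) ((st be j k i.+1).2 n) by [].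
  by rewrite sgS hZ /jump es e -am (inj_eq (@perm_inj _ (sg i))).
move=> t t0; have /andP[h1 h2] := idxP t0.
exists (sg (idx t)), (Z t); split; first by move=> n; exact: ZY.
by move=> n; rewrite (Zmove (idx t))// -key -hb// ltW.
Qed.

End Bee.
End Path.
End CoupledSystem.

(** * Sublinearity of Brownian motion *)

Section BorelCantelli.
Context {R : realType} {d : measure_display} {T : measurableType d}.
Variable P : probability T R.

Lemma geometric_sum_le (C r : R) n : 0 <= C -> 0 <= r < 1 ->
  \sum_(i < n) C * r ^+ i <= C / (1 - r).
Proof.
move=> C0 /andP[r0 r1].
suff h : (\sum_(i < n) C * r ^+ i) * (1 - r) = C * (1 - r ^+ n).
  rewrite ler_pdivlMr ?subr_gt0// h ler_piMr// lerBlDr lerDl exprn_ge0//.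
elim: n => [|n IH]; first by rewrite big_ord0 expr0 mul0r subrr mulr0.
by rewrite big_ord_recr /= mulrDl IH exprS; ring.
Qed.

Lemma geometric_nneseries_le (u : nat -> \bar R) (C r : R) : 0 <= C -> 0 <= r < 1 ->
  (forall m, 0 <= u m)%E -> (forall m, u m <= (C * r ^+ m)%:E)%E ->
  (\sum_(m <oo) u m <= (C / (1 - r))%:E)%E.
Proof.
move=> C0 r01 u0 ur; apply: lime_le; first by apply: is_cvg_nneseries => m _ _; exact: u0.
apply: nearW => n; apply: (@le_trans _ _ (\sum_(0 <= i < n) (C * r ^+ i)%:E)%E).
  by apply: lee_sum => i _; exact: ur.
by rewrite sumEFin lee_fin big_mkord; exact: geometric_sum_le.
Qed.

Lemma borel_cantelli_geometric (V : nat -> set T) (C r : R) : 0 <= C -> 0 <= r < 1 ->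
  (forall p, measurable (V p)) -> (forall p, P (V p) <= (C * r ^+ p)%:E)%E ->
  {ae P, forall w, exists p0, forall p, (p0 <= p)%N -> ~ V p w}.
Proof.
move=> C0 r01 mV PV.
have h : P (lim_sup_set V) = 0.
  apply: lim_sup_set_cvg0 => //.
  apply: (le_lt_trans (@geometric_nneseries_le _ C r C0 r01 _ _)) => //.
  by rewrite ltry.
exists (lim_sup_set V); split => //.
  by apply: bigcap_measurable => // k _; exact: bigcup_measurable.
move=> w /= hw n _; apply: contrapT => hn; apply: hw; exists n => p np Vp.
by apply: hn; exists p.
Qed.

Lemma fin_union_le (n : nat) (A : nat -> set T) (c : R) :
  (forall i, measurable (A i)) -> (forall i, (i < n)%N -> P (A i) <= c%:E)%E ->
  (P (\big[setU/set0]_(i < n) A i) <= (n%:R * c)%:E)%E.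
Proof.
move=> mA PA; apply: (le_trans (Boole_inequality _ _)) => //.
apply: (@le_trans _ _ (\sum_(i < n) c%:E)%E); first by apply: lee_sum => i _; exact: PA.
by rewrite sumEFin lee_fin sumr_const card_ord mulr_natl.
Qed.

Lemma indep_run (F : nat -> set_system T) (A : nat -> set T) (a : R) i L :
  indep_nat P F -> (forall l, <<s F l >> (A l)) -> (forall l, measurable (A l)) ->
  (forall l, P (A l) = a%:E) ->
  P (\bigcap_(l in [set l | (i <= l < i + L)%N]) ~` A l) = ((1 - a) ^+ L)%:E.
Proof.
move=> hF hA mA Pa.
(* Independence is stated for initial segments, so the indices before [i] are filled with the whole
   space. *)
pose E l := if (l < i)%N then setT else ~` A l.
have -> : \bigcap_(l in [set l | (i <= l < i + L)%N]) ~` A l = \bigcap_(l in `I_(i + L)) E l.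
  apply/seteqP; split=> w h l /=.
    by move=> lL; rewrite /E; case: ltnP => // il; apply: (h l); rewrite /= il.
  by move=> /andP[il lL]; have := h l lL; rewrite /E ltnNge il.
rewrite hF; last first.
  move=> l _; rewrite /E; case: ifP => _.
    exact: (@measurableT _ (g_sigma_algebraType (F l))).
  exact: (@measurableC _ (g_sigma_algebraType (F l)) _ (hA l)).
rewrite big_split_ord /= big1 ?mul1e; last first.
  by move=> l _; rewrite /E ltn_ord probability_setT.
rewrite (eq_bigr (fun=> (1 - a)%:E)); last first.
  by move=> l _; rewrite /E ltnNge leq_addr /= probability_setC// Pa.
elim: L {E} => [|L IH]; first by rewrite big_ord0 expr0.
by rewrite big_ord_recr /= IH exprSr EFinM.
Qed.

Lemma exists_small_power (a e : R) : 0 < a <= 1 -> 0 < e -> exists L, (1 - a) ^+ L <= e.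
Proof.
move=> /andP[a0 a1] e0.
have : (1 - a) ^+ m @[m --> \oo] --> 0 by apply: cvg_expr; rewrite ger0_norm; lra.
move=> /cvgrPdist_le /(_ e e0) [M _ /(_ M (leqnn M)) /=].
by rewrite sub0r normrN ger0_norm ?exprn_ge0 ?subr_ge0// => h; exists M.
Qed.

(** With [L] such that [(1 - a) ^+ L <= 1/4], a window of length [L * p] misses all the events with
    probability at most [4^-p]. The [2 ^ p.+1] starting points cost a factor that leaves [2 * 2^-p],
    which is summable. *)
Lemma indep_windows (F : nat -> set_system T) (A : nat -> set T) (a : R) :
  0 < a <= 1 ->
  indep_nat P F -> (forall l, <<s F l >> (A l)) -> (forall l, measurable (A l)) ->
  (forall l, P (A l) = a%:E) ->
  exists L, {ae P, forall w, exists p0, forall p, (p0 <= p)%N ->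
    forall i, (i < 2 ^ p.+1)%N -> exists2 l, (i <= l < i + L * p)%N & A l w}.
Proof.
move=> a01 hF hA mA Pa.
have e4 : 0 < 4^-1 :> R by rewrite invr_gt0.
have [L hL] := exists_small_power a01 e4; exists L.
pose W p i := \bigcap_(l in [set l | (i <= l < i + L * p)%N]) ~` A l.
have mW p i : measurable (W p i).
  have [[l hl]|/nonemptyPn e] := pselect ([set l | (i <= l < i + L * p)%N] !=set0).
    by apply: bigcap_measurable; [exists l|move=> l' _; exact: measurableC].
  by rewrite /W e bigcap_set0.
have h : forall p, (P (\big[setU/set0]_(i < 2 ^ p.+1) W p i) <= (2 * 2^-1 ^+ p)%:E)%E.
  move=> p; apply: (le_trans (@fin_union_le _ _ (4^-1 ^+ p) _ _)) => //.
    move=> i _; rewrite (indep_run _ _ hF hA mA Pa) lee_fin exprM lerXn2r// nnegrE//.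
    by rewrite exprn_ge0//; lra.
  rewrite lee_fin natrX exprS -mulrA ler_wpM2l// -exprMn.
  by rewrite (_ : 2%:R * 4^-1 = 2^-1)//; lra.
have h01 : 0 <= (2^-1 : R) < 1 by lra.
have mU p : measurable (\big[setU/set0]_(i < 2 ^ p.+1) W p i).
  by apply: bigsetU_measurable => i _; exact: mW.
have := @borel_cantelli_geometric (fun p => \big[setU/set0]_(i < 2 ^ p.+1) W p i) 2 2^-1
  (ler0n _ 2) h01 mU h.
apply: filterS => w [p0 hp0]; exists p0 => p pp0 i hi.
have := hp0 p pp0; rewrite -bigcup_mkord => hn.
have : ~ W p i w by move=> hW; apply: hn; exists i.
move=> /existsNP[l /not_implyP[hl /contrapT Al]]; by exists l.
Qed.

End BorelCantelli.

Section NormalTail.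
Context {R : realType}.
Local Notation mu := (@lebesgue_measure R).

Lemma normal_peak_double (s : R) : 0 < s -> normal_peak (s * 2) = normal_peak s / 2.
Proof.
move=> s0; rewrite /normal_peak.
rewrite (_ : (s * 2) ^+ 2 * pi *+ 2 = 2 ^+ 2 * (s ^+ 2 * pi *+ 2)); last first.
  by ring.
by rewrite sqrtrM ?sqr_ge0// sqrtr_sqr ger0_norm// invfM mulrC.
Qed.

Lemma expRN_le (y : R) : 0 < y -> expR (- y) <= 4 / y ^+ 2.
Proof.
move=> y0; rewrite expRN -[4 / _]invrK lef_pV2 ?posrE ?expR_gt0 ?invr_gt0 ?divr_gt0 ?exprn_gt0//.
rewrite invf_div.
have h : 1 + y / 2 <= expR (y / 2) by exact: expR_ge1Dx.
have -> : expR y = expR (y / 2) ^+ 2 by rewrite -expRM_natl -mulr_natl mulrCA divff ?mulr1.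
apply: (@le_trans _ _ ((1 + y / 2) ^+ 2)); first by nra.
by rewrite lerXn2r// nnegrE ?expR_ge0//; lra.
Qed.

(** Beyond [a] the density is at most [c] times the one with standard deviation [2 s], whose mass is
    at most one. Then [expR (- y) <= 4 / y^2] with [y = a^2 / (4 s^2)] gives [2 * 4 * 16 = 128]. The
    fourth power of [s / a] matters: a quadratic bound would not survive the union over the [2 ^ m]
    cells of level [m]. *)
Lemma normal_tail (s a : R) : 0 < s -> 0 < a ->
  (normal_prob 0 s [set x | (a <= `|x|)%R] <= (128 * (s ^+ 2 / a ^+ 2) ^+ 2)%:E)%E.
Proof.
move=> s0 a0; set V := [set x | _].
have mV : measurable V.
  rewrite (_ : V = (fun x : R => `|x|) @^-1` `[a, +oo[%classic).
    by rewrite -[X in measurable X]setTI; exact: normr_measurable.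
  by apply/seteqP; split=> x /=; rewrite in_itv /= andbT.
pose c := 2 * expR (- (a ^+ 2 / (s ^+ 2 * 4))).
have c0 : 0 <= c by rewrite mulr_ge0// expR_ge0.
have sn0 : s != 0 by rewrite gt_eqF.
have s2n0 : s * 2 != 0 by rewrite mulf_neq0.
have s2 : 0 < s ^+ 2 by rewrite exprn_gt0.
have key x : V x -> normal_pdf 0 s x <= c * normal_pdf 0 (s * 2) x.
  move=> Vx; rewrite !normal_pdfE// normal_peak_double// /normal_fun !subr0 /c.
  have -> : 2 * expR (- (a ^+ 2 / (s ^+ 2 * 4))) * (normal_peak s / 2 *
      expR (- x ^+ 2 / ((s * 2) ^+ 2 *+ 2))) =
      normal_peak s * expR (- (a ^+ 2 / (s ^+ 2 * 4)) + - x ^+ 2 / ((s * 2) ^+ 2 *+ 2)).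
    by rewrite expRD; field.
  rewrite ler_wpM2l ?normal_peak_ge0// ler_expR.
  have ax : a ^+ 2 <= x ^+ 2 by rewrite -(@real_normK _ x) ?num_real// lerXn2r ?nnegrE// ltW.
  have -> : - x ^+ 2 / (s ^+ 2 *+ 2) = - (x ^+ 2) * (4 / (s ^+ 2 * 8)) by field.
  have -> : - (a ^+ 2 / (s ^+ 2 * 4)) + - x ^+ 2 / ((s * 2) ^+ 2 *+ 2) =
      - (a ^+ 2 * 2 + x ^+ 2) * (1 / (s ^+ 2 * 8)) by field.
  rewrite [4 / _](_ : _ = 4 * (1 / (s ^+ 2 * 8))); last by field.
  set q := 1 / _.
  have q0 : 0 <= q by rewrite divr_ge0// mulr_ge0// ltW.
  have h1 : 0 <= q * (x ^+ 2 - a ^+ 2) by rewrite mulr_ge0// subr_ge0.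
  have h2 : 0 <= q * x ^+ 2 by rewrite mulr_ge0// sqr_ge0.
  by lra.
apply: (@le_trans _ _ (\int[mu]_(x in V) (c * normal_pdf 0 (s * 2) x)%:E)%E).
  apply: ge0_le_integral => //=.
  - by move=> x _; rewrite lee_fin normal_pdf_ge0.
  - by apply/measurable_EFinP; apply: measurable_funTS; exact: measurable_normal_pdf.
  - apply/measurable_EFinP; apply: measurable_funTS; apply: measurable_funM => //.
    exact: measurable_normal_pdf.
under eq_integral do rewrite EFinM.
rewrite ge0_integralZl//=; last 2 first.
- by apply/measurable_EFinP; apply: measurable_funTS; exact: measurable_normal_pdf.
- by move=> x _; rewrite lee_fin normal_pdf_ge0.
apply: (@le_trans _ _ (c%:E * 1)%E).
  rewrite lee_wpmul2l ?lee_fin//.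
  exact: (@probability_le1 _ _ _ (normal_prob 0 (s * 2)) V mV).
rewrite mule1 lee_fin /c.
have y0 : 0 < a ^+ 2 / (s ^+ 2 * 4) by rewrite divr_gt0 ?exprn_gt0// mulr_gt0.
have := expRN_le y0.
have -> : 128 * (s ^+ 2 / a ^+ 2) ^+ 2 = 2 * (4 / (a ^+ 2 / (s ^+ 2 * 4)) ^+ 2).
  by field; rewrite ?gt_eqF.
by move=> h; rewrite ler_wpM2l.
Qed.

Lemma normal_itv_le (s x y : R) : 0 < s -> x <= y ->
  (normal_prob 0 s `[x, y] <= (normal_peak s * (y - x))%:E)%E.
Proof.
move=> s0 xy; have sn0 : s != 0 by rewrite gt_eqF.
apply: (@le_trans _ _ (\int[mu]_(u in `[x, y]) (cst (normal_peak s)%:E u))%E).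
  apply: ge0_le_integral => //=.
  - by move=> u _; rewrite lee_fin normal_pdf_ge0.
  - by apply/measurable_EFinP; apply: measurable_funTS; exact: measurable_normal_pdf.
  - by move=> u _; rewrite lee_fin normal_pdf_ub.
rewrite integral_cst//= lebesgue_measure_itv/= lte_fin.
case: ltP => [_|yx]; first by rewrite -EFinD -EFinM.
have -> : y = x by apply/eqP; rewrite eq_le yx xy.
by rewrite subrr mulr0 mule0.
Qed.

End NormalTail.

Section BrownianSup.
Context {R : realType} {d : measure_display} {T : measurableType d}.
Variable P : probability T R.

(* Each dyadic point of level [m + 1] is one step away from a point of level [m]. *)
Lemma chaining (f : R -> R) (S c th : R) : f 0 = 0 -> 0 < S -> 0 <= c -> 0 <= th < 1 ->
  {within [set t : R | 0 <= t], continuous f} ->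
  (forall m k, (k < 2 ^ m)%N ->
     `|f (k.+1%:R * S / 2 ^+ m) - f (k%:R * S / 2 ^+ m)| <= c * th ^+ m) ->
  forall t, 0 <= t <= S -> `|f t| <= c / (1 - th).
Proof.
move=> f0 S0 c0 th01 cf h t /andP[t0 tS].
have key m k : (k <= 2 ^ m)%N ->
    `|f (k%:R * S / 2 ^+ m)| <= \sum_(i < m.+1) c * th ^+ i.
  elim: m k => [|m IH] k.
    rewrite expn0 big_ord_recl big_ord0 /= addr0.
    case: k => [|[|//]] _; first by rewrite !mul0r f0 normr0 expr0 mulr1.
    by have := h 0%N 0%N isT; rewrite expr0 mul0r mul0r f0 subr0.
  have ev l : ((l.*2)%:R * S / 2 ^+ m.+1 : R) = l%:R * S / 2 ^+ m.
    by rewrite -muln2 natrM exprS; field; rewrite expf_neq0.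
  have nn : 0 <= c * th ^+ m.+1 by rewrite mulr_ge0// exprn_ge0//; case/andP: th01.
  move=> km; rewrite big_ord_recr /=.
  have kE := odd_double_half k; case ok : (odd k) kE => /= kE.
    have hl : (k./2 <= 2 ^ m)%N by move: km; rewrite expnS; lia.
    have lk : (k./2.*2 < 2 ^ m.+1)%N by lia.
    have := h m.+1 k./2.*2 lk; rewrite -add1n kE ev => h1.
    have h2 := IH _ hl.
    have -> : f (k%:R * S / 2 ^+ m.+1) = f (k./2%:R * S / 2 ^+ m) +
      (f (k%:R * S / 2 ^+ m.+1) - f (k./2%:R * S / 2 ^+ m)) by ring.
    by rewrite (le_trans (ler_normD _ _))// lerD.
  have hl : (k./2 <= 2 ^ m)%N by move: km; rewrite expnS; lia.
  by rewrite -kE add0n ev (le_trans (IH _ hl))// lerDl.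
have dy m : `|f (S * dfloor m (t / S))| <= c / (1 - th).
  have tS0 : 0 <= t / S by rewrite divr_ge0// ltW.
  have tS1 : t / S <= 1 by rewrite ler_pdivrMr// mul1r.
  have -> : S * dfloor m (t / S) = (Num.truncn (t / S * 2 ^+ m))%:R * S / 2 ^+ m.
    by rewrite /dfloor /grid; ring.
  apply: (le_trans (key _ _ _)); last exact: geometric_sum_le.
  rewrite -(@ler_nat R) natrX; apply: (@le_trans _ _ (t / S * 2 ^+ m)).
    by rewrite truncn_le mulr_ge0// exprn_ge0.
  by rewrite ler_piMl// exprn_ge0.
have cv : f (S * dfloor m (t / S)) @[m --> \oo] --> f t.
  apply: (within_continuous_seq cf) => //.
    by move=> m; rewrite mulr_ge0 ?grid_ge0// ltW.
  rewrite [X in _ --> X](_ : t = S * (t / S)); last by rewrite mulrC divfK// gt_eqF.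
  by apply: cvgM; [exact: cvg_cst|apply: dfloor_cvg; rewrite divr_ge0// ltW].
apply/ler_addgt0Pr => e e0.
have /cvgrPdist_le /(_ e e0) [M _ /(_ M (leqnn M)) /= hM] := cv.
rewrite -(subrK (f (S * dfloor M (t / S))) (f t)) addrC.
by rewrite (le_trans (ler_normD _ _))// lerD.
Qed.

Section Bad.
Context (W : R -> T -> R) (hW : std_BM P W) (e : R) (e0 : 0 < e).
(** Any ratio with [th < 1 < 2 * th ^ 4] would do: the first inequality sums the chaining errors,
    with [1 / (1 - th) = 10], the second makes [r = 1 / (2 * th ^ 4)], the ratio of the union
    bounds, less than one. *)
Let th : R := 9 / 10.
Let r : R := 5000 / 6561.

Let time p m k : R := k%:R * 2 ^+ p / 2 ^+ m.
Let bad1 p m k : set T :=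
  [set w | e * 2 ^+ p * th ^+ m <= `|W (time p m k.+1) w - W (time p m k) w|].
Let bad p : set T := \bigcup_m \big[setU/set0]_(k < 2 ^ m) bad1 p m k.

Let time_ge0 p m k : 0 <= time p m k.
Proof. by rewrite /time divr_ge0 ?exprn_ge0// mulr_ge0// exprn_ge0. Qed.

Let timeS p m k : time p m k.+1 - time p m k = 2 ^+ p / 2 ^+ m.
Proof. by rewrite /time -natr1; ring. Qed.

Let th_gt0 m : 0 < th ^+ m. Proof. by rewrite exprn_gt0// /th; lra. Qed.

Let mbad1 p m k : measurable (bad1 p m k).
Proof.
case: hW => mW _ _ _ _.
have h : measurable_fun setT (fun w => `|W (time p m k.+1) w - W (time p m k) w|).
  by apply: measurableT_comp => //; apply: measurable_funB; exact: mW.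
rewrite (_ : bad1 p m k = (fun w => `|W (time p m k.+1) w - W (time p m k) w|) @^-1`
    `[e * 2 ^+ p * th ^+ m, +oo[%classic).
  by rewrite -[X in measurable X]setTI; exact: h.
by apply/seteqP; split=> w /=; rewrite in_itv /= andbT.
Qed.

Let Pbad1 p m k : (P (bad1 p m k) <=
  (128 * ((2 ^+ p / 2 ^+ m) / (e * 2 ^+ p * th ^+ m) ^+ 2) ^+ 2)%:E)%E.
Proof.
case: hW => _ _ _ h4 _.
have dt : 0 < 2 ^+ p / 2 ^+ m :> R by rewrite divr_gt0 ?two_exp_gt0.
have lt : time p m k < time p m k.+1 by rewrite -subr_gt0 timeS.
have a0 : 0 < e * 2 ^+ p * th ^+ m by rewrite !mulr_gt0 ?two_exp_gt0.
have mV : measurable [set x : R | e * 2 ^+ p * th ^+ m <= `|x|].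
  rewrite (_ : [set _ | _] = (fun x : R => `|x|) @^-1` `[e * 2 ^+ p * th ^+ m, +oo[%classic).
    by rewrite -[X in measurable X]setTI; exact: normr_measurable.
  by apply/seteqP; split=> x /=; rewrite in_itv /= andbT.
have := h4 _ _ (time_ge0 p m k) lt _ mV; rewrite timeS => hP.
have s0 : 0 < Num.sqrt (2 ^+ p / 2 ^+ m) :> R by rewrite sqrtr_gt0.
have := normal_tail s0 a0; rewrite sqr_sqrtr ?(ltW dt)//.
by rewrite -hP.
Qed.

Let mbad p : measurable (bad p).
Proof.
by apply: bigcupT_measurable => m; apply: bigsetU_measurable => k _; exact: mbad1.
Qed.

Let Pbad p : (P (bad p) <= (128 / e ^+ 4 / (1 - r) * 4^-1 ^+ p)%:E)%E.
Proof.
apply: (@le_trans _ _ (\sum_(m <oo) P (\big[setU/set0]_(k < 2 ^ m) bad1 p m k))%E).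
  apply: measure_sigma_subadditive => //.
  by move=> m; apply: bigsetU_measurable => k _; exact: mbad1.
have -> : 128 / e ^+ 4 / (1 - r) * 4^-1 ^+ p = (128 / e ^+ 4 * 4^-1 ^+ p) / (1 - r) by ring.
apply: geometric_nneseries_le => //.
- by rewrite mulr_ge0 ?exprn_ge0// divr_ge0// exprn_ge0// ltW.
- by rewrite /r; lra.
move=> m; apply: (le_trans (@fin_union_le _ _ _ P _ _ _ (mbad1 p m) (fun k _ => @Pbad1 p m k))).
rewrite lee_fin natrX.
have -> : r ^+ m = (2 ^+ m * (th ^+ m) ^+ 4)^-1.
  rewrite -exprM mulnC exprM -exprMn -exprVn; congr (_ ^+ _).
  by rewrite /r /th; field.
have -> : (4^-1 : R) ^+ p = (2 ^+ p * 2 ^+ p)^-1.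
  by rewrite -exprMn -exprVn; congr (_ ^+ _); field.
have A0 : 2 ^+ p != 0 :> R by rewrite gt_eqF// two_exp_gt0.
have B0 : 2 ^+ m != 0 :> R by rewrite gt_eqF// two_exp_gt0.
have C0 : th ^+ m != 0 by rewrite gt_eqF.
have E0 : e != 0 by rewrite gt_eqF.
by rewrite le_eqVlt; apply/orP; left; apply/eqP; field; rewrite A0 B0 C0 E0.
Qed.

Lemma BM_sup_bound : {ae P, forall w, exists p0, forall p, (p0 <= p)%N ->
  forall t, 0 <= t <= 2 ^+ p -> `|W t w| <= e * 10 * 2 ^+ p}.
Proof.
have C0 : 0 <= 128 / e ^+ 4 / (1 - r).
  by rewrite divr_ge0 ?divr_ge0 ?exprn_ge0 ?ltW// /r; lra.
have q0 : 0 <= (4^-1 : R) < 1 by lra.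
have := borel_cantelli_geometric C0 q0 mbad Pbad.
apply: filterS => w [p0 hp0]; exists p0 => p pp0 t tS.
case: hW => _ W0 cW _ _.
have -> : e * 10 * 2 ^+ p = (e * 2 ^+ p) / (1 - th) by rewrite /th; field.
apply: (@chaining (fun t => W t w) (2 ^+ p) _ _ (W0 w)) => //.
- by rewrite mulr_ge0 ?ltW// two_exp_gt0.
- by rewrite /th; lra.
move=> m k km; rewrite leNgt; apply/negP => hlt; apply: (hp0 p pp0).
exists m => //; rewrite -bigcup_mkord; exists k => //=.
exact: ltW.
Qed.

End Bad.

Lemma BM_sublinear (W : R -> T -> R) : std_BM P W ->
  {ae P, forall w, forall e, 0 < e -> exists t0, forall t, t0 <= t -> `|W t w| <= e * t}.
Proof.
move=> hW.
have h : {ae P, forall w, forall q : nat, exists p0, forall p, (p0 <= p)%N ->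
    forall t, 0 <= t <= 2 ^+ p -> `|W t w| <= q.+1%:R^-1 * 10 * 2 ^+ p}.
  by apply: ae_foralln => q; apply: BM_sup_bound => //; rewrite invr_gt0.
apply: filterS h => w h e e0.
(* The bound on [[0, 2 ^+ l.+1]] has a factor 10 from chaining, and [2 ^+ l.+1 <= 2 * t] costs
   another 2. *)
have e20 : 0 < e / 20 by lra.
have [q _ /(_ q (leqnn q)) /= hq] := near_infty_natSinv_lt (PosNum e20).
have [p0 hp0] := h q; exists (2 ^+ p0) => t t0.
have tp : 0 < t by rewrite (lt_le_trans _ t0)// two_exp_gt0.
have /andP[k1 k2] := truncn_itv (ltW tp); set k := Num.truncn t in k1 k2.
have kp0 : (2 ^ p0 <= k)%N by rewrite truncn_ge_nat ?natrX//; exact: ltW.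
have k0 : (0 < k)%N by rewrite (leq_trans _ kp0)// expn_gt0.
have /andP[l1 l2] := trunc_log_bounds (isT : 1 < 2)%N k0.
set l := trunc_log 2 k in l1 l2.
have lp0 : (p0 <= l)%N by apply: trunc_log_max.
have t1 : 2 ^+ l <= t by rewrite (le_trans _ k1)// -natrX ler_nat.
have t2 : t <= 2 ^+ l.+1 by rewrite ltW// (lt_le_trans k2)// -natrX ler_nat.
have := hp0 l.+1 (leqW lp0) t; rewrite (ltW tp) t2 => /(_ isT) hh.
apply: (le_trans hh); rewrite exprS.
have q0 : 0 <= q.+1%:R^-1 :> R by rewrite invr_ge0.
have l0 : 0 <= 2 ^+ l :> R by rewrite exprn_ge0.
apply: (@le_trans _ _ (e / 20 * 10 * (2 * 2 ^+ l))).
  rewrite ler_wpM2r ?mulr_ge0// ler_wpM2r// ltW//.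
by have := ler_wpM2l (ltW e0) t1; lra.
Qed.

End BrownianSup.

(** * All labels of the N-BBM have the same speed *)

Section WindowTimes.
Context {R : realType} {N : nat} (top : 'I_N).
Implicit Types (j : nat -> R) (k : nat -> 'I_N).

Definition tops k i e : nat := (\sum_(i <= l < e) (k l.+1 == top))%N.

(** The almost sure regularity of jump times and choices in deterministic form: among about [2 ^ p]
    jumps no gap exceeds [p], and each window of [L * p] jumps contains a choice of the top rank and
    a gap longer than 1. *)
Definition windowed (L : nat) j k := [/\ j 0%N = 0, forall i, j i < j i.+1 &
  exists p0, forall p, (p0 <= p)%N -> forall i, (i < 2 ^ p.+1)%N ->
    [/\ j i.+1 - j i <= p%:R,
        exists2 l, (i <= l < i + L * p)%N & k l.+1 = top &
        exists2 l, (i <= l < i + L * p)%N & 1 < j l.+1 - j l]].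

Lemma poly_le_exp (C : nat) : exists p0, forall p, (p0 <= p)%N -> (C * p.+1 ^ 3 <= 2 ^ p)%N.
Proof.
exists (4 * (64 * C))%N => p hp.
set m := (p %/ 4)%N.
have pm : (p = 4 * m + p %% 4)%N by rewrite mulnC /m -divn_eq.
have r4 : (p %% 4 < 4)%N by rewrite ltn_mod.
have mC : (64 * C <= m)%N by lia.
have m2 : (m.+1 <= 2 ^ m)%N by exact: ltn_expl.
have p4 : (p.+1 <= 4 * 2 ^ m)%N by lia.
apply: (@leq_trans (C * (4 * 2 ^ m) ^ 3)); first by rewrite leq_mul2l leq_exp2r// p4 orbT.
rewrite expnMn mulnA -expnM.
apply: (@leq_trans (2 ^ m * 2 ^ (m * 3))).
  rewrite leq_mul2r; apply/orP; right; apply: (leq_trans _ (ltnW m2)).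
  by rewrite (_ : 4 ^ 3 = 64)%N//; lia.
by rewrite -expnD leq_exp2l//; lia.
Qed.

(** This bound and the next one share a right-hand side, so that a single comparison with [2 ^ p]
    controls both the number of jumps spent in [n] windows and their duration. *)
Lemma window_bound1 (M n L p : nat) :
  (n * (L * p.+1).+1 <= 2 * M.+1 * n.+1 * L.+1 * L.+1 * p.+1 ^ 3)%N.
Proof.
have h1 : ((L * p.+1).+1 <= L.+1 * p.+1)%N by rewrite mulSn addSn ltnS leq_addl.
apply: (@leq_trans (n.+1 * (L.+1 * p.+1))); first exact: leq_mul.
rewrite (_ : 2 * M.+1 * n.+1 * L.+1 * L.+1 * p.+1 ^ 3 =
  n.+1 * (L.+1 * p.+1) * (2 * M.+1 * L.+1 * p.+1 ^ 2))%N; last by ring.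
by rewrite leq_pmulr// !muln_gt0 expn_gt0.
Qed.

Lemma window_bound2 (M n L p : nat) :
  (M.+1 * (n * (L * p.+1).+1 * p.+1) * (L.+1 * p) <=
   2 * M.+1 * n.+1 * L.+1 * L.+1 * p.+1 ^ 3)%N.
Proof.
have h1 : ((L * p.+1).+1 <= L.+1 * p.+1)%N by rewrite mulSn addSn ltnS leq_addl.
apply: (@leq_trans (M.+1 * (n.+1 * (L.+1 * p.+1) * p.+1) * (L.+1 * p.+1))).
  by apply: leq_mul; [apply: leq_mul => //; apply: leq_mul => //; exact: leq_mul|exact: leq_mul].
rewrite (_ : 2 * M.+1 * n.+1 * L.+1 * L.+1 * p.+1 ^ 3 =
  M.+1 * (n.+1 * (L.+1 * p.+1) * p.+1) * (L.+1 * p.+1) * 2)%N; last by ring.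
by rewrite leq_pmulr.
Qed.

Section Windowed.
Context (L : nat) (j : nat -> R) (k : nat -> 'I_N).
Hypothesis hw : windowed L j k.

Let j0 : j 0%N = 0. Proof. by case: hw. Qed.
Let jS i : j i < j i.+1. Proof. by case: hw. Qed.
Let jm i l : (i <= l)%N -> j i <= j l. Proof. exact: j_mono. Qed.

(** Each block of [L.+1 * p] jumps contains a gap longer than 1. *)
Let grow : exists p0, forall p, (p0 <= p)%N -> forall a, (a * (L.+1 * p) <= 2 ^ p)%N ->
  a%:R <= j (a * (L.+1 * p))%N.
Proof.
case: hw => _ _ [p0 h]; exists p0 => p pp0; elim=> [|a IH] ha; first by rewrite mul0n j0.
have ha' : (a * (L.+1 * p) <= 2 ^ p)%N by rewrite (leq_trans _ ha)// leq_mul2r leqnSn orbT.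
have hi : (a * (L.+1 * p) < 2 ^ p.+1)%N.
  by rewrite (leq_ltn_trans ha')// ltn_exp2l.
have [_ _ [l /andP[l1 l2] hl]] := h p pp0 _ hi.
have h1 := IH ha'; have h2 := jm l1.
have h3 : j l.+1 <= j (a.+1 * (L.+1 * p))%N by apply: jm; nia.
by rewrite -natr1; lra.
Qed.

Lemma windowed_unbounded x : exists i, x < j i.
Proof.
have [p0 h] := grow.
set a := (Num.truncn x).+1.
have [p1 hp1] := poly_le_exp (a * L.+1).
pose p := maxn p0 p1.
have ha : (a * (L.+1 * p) <= 2 ^ p)%N.
  have := hp1 p (leq_maxr _ _); apply: leq_trans; rewrite mulnA leq_mul2l; apply/orP; right.
  by apply: (leq_trans (leqnSn p)); rewrite -{1}(expn1 p.+1) leq_pexp2l.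
exists (a * (L.+1 * p))%N; apply: (lt_le_trans _ (h p (leq_maxl _ _) _ ha)).
exact: truncnS_gt.
Qed.

Lemma tops_cat i e e' : (i <= e)%N -> (e <= e')%N ->
  (tops k i e' = tops k i e + tops k e e')%N.
Proof. by move=> ie ee'; rewrite /tops (@big_cat_nat _ _ _ e). Qed.

(** For [2 ^ p <= i < 2 ^ p.+1], [N] successive windows take a time polynomial in [p], whereas [j i]
    is at least of order [2 ^ p / p]. *)
Lemma windowed_tops (ep : R) : 0 < ep -> exists i1, forall i, (i1 <= i)%N ->
  exists e, [/\ (i <= e)%N, (N <= tops k i e)%N & j e <= (1 + ep) * j i].
Proof.
move=> ep0; have [p0 hg] := grow; case: hw => _ _ [p1 h].
have [M hM] : exists M : nat, ep^-1 <= M%:R.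
  by exists (Num.truncn ep^-1).+1; rewrite ltW// truncnS_gt.
have [p2 hp2] := poly_le_exp (2 * M.+1 * N.+1 * L.+1 * L.+1)%N.
pose p3 := maxn (maxn p0 p1) (maxn p2 1).
exists (2 ^ p3)%N => i hi.
have i0 : (0 < i)%N by rewrite (leq_trans _ hi)// expn_gt0.
have /andP[i1 i2] := trunc_log_bounds (isT : 1 < 2)%N i0.
set p := trunc_log 2 i in i1 i2.
have pp3 : (p3 <= p)%N by apply: trunc_log_max.
have [pp0 pp1 pp2 pp] : [/\ (p0 <= p)%N, (p1 <= p)%N, (p2 <= p)%N & (1 <= p)%N].
  by move: pp3; rewrite /p3; split; lia.
have key := hp2 p pp2.
(* The search starts below [2 ^ p.+1] and stays below [2 ^ p.+2], hence the windows of level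
   [p.+1]. *)
pose s := (L * p.+1).+1.
have Ns : (N * s <= 2 ^ p.+1)%N.
  apply: (leq_trans (window_bound1 M N L p)); apply: (leq_trans key).
  by rewrite leq_exp2l.
have ex r : (r <= N)%N -> exists e, [/\ (i <= e)%N, (e <= i + r * s)%N & (r <= tops k i e)%N].
  elim: r => [|r IH] rN; first by exists i; rewrite mul0n addn0 leqnn.
  have [e [ie ei re]] := IH (ltnW rN).
  have e2 : (e < 2 ^ p.+2)%N.
    have : (r * s <= N * s)%N by rewrite leq_mul2r ltnW ?orbT.
    move=> rs; apply: (leq_ltn_trans ei); rewrite expnS mul2n -addnn -addSn.
    by apply: leq_add => //; exact: leq_trans Ns.
  have [_ [l /andP[l1 l2] kl] _] := h p.+1 (leqW pp1) e e2.
  exists l.+1; split.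
  - by rewrite (leq_trans ie)// leqW.
  - by apply: (leq_trans l2); rewrite mulSn addnCA [X in (X <= _)%N]addnC leq_add// leqnSn.
  rewrite (tops_cat ie (leqW l1)) -addn1 leq_add// /tops big_nat_recr//= kl eqxx.
  by rewrite leq_addl.
have [e [ie ei Ne]] := ex N (leqnn N).
exists e; split => //.
have jup u : (i + u <= 2 ^ p.+2)%N -> j (i + u)%N - j i <= u%:R * p.+1%:R.
  elim: u => [|u IH] hu; first by rewrite addn0 subrr mul0r.
  have h1 : (i + u < 2 ^ p.+2)%N by rewrite -addnS.
  have h2 := IH (ltnW h1); have [h3 _ _] := h p.+1 (leqW pp1) _ h1.
  by rewrite addnS -[u.+1%:R]natr1 mulrDl mul1r; lra.
have e2 : (e <= 2 ^ p.+2)%N.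
  by apply: (leq_trans ei); rewrite expnS mul2n -addnn leq_add// ltnW.
have h1 : j e - j i <= (N * s)%:R * p.+1%:R.
  have := jup (e - i)%N; rewrite subnKC// => /(_ e2) /le_trans; apply.
  by rewrite ler_wpM2r// ler_nat leq_subLR.
set a := (2 ^ p %/ (L.+1 * p))%N.
have ha : (a * (L.+1 * p) <= 2 ^ p)%N by exact: leq_divM.
have h2 : a%:R <= j i.
  apply: (le_trans (hg p pp0 a ha)); apply: jm; exact: leq_trans i1.
have h3 : (M.+1 * (N * s * p.+1) <= a)%N.
  rewrite leq_divRL; last by rewrite muln_gt0.
  exact: (leq_trans (window_bound2 M N L p) key).
have h4 : (M.+1%:R * ((N * s)%:R * p.+1%:R) : R) <= j i.
  by rewrite (le_trans _ h2)// -!natrM ler_nat.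
set D := (N * s)%:R * p.+1%:R in h1 h4.
have D0 : 0 <= D by rewrite mulr_ge0.
have epM : 1 <= ep * M.+1%:R.
  rewrite -natr1 mulrDr mulr1 (@le_trans _ _ (ep * M%:R))//; last by rewrite lerDl ltW.
  by have := ler_wpM2l (ltW ep0) hM; rewrite mulfV ?gt_eqF.
have : D <= ep * j i.
  apply: (@le_trans _ _ (ep * (M.+1%:R * D))); last by rewrite ler_pM2l.
  by rewrite mulrA ler_peMl.
by lra.
Qed.

End Windowed.
End WindowTimes.

Lemma eventually_all {R : realType} {N : nat} (Q : 'I_N -> R -> Prop) :
  (forall n, exists t0, forall t, t0 <= t -> Q n t) ->
  exists t0, forall t n, t0 <= t -> Q n t.
Proof.
move=> h; have [f hf] := @choice _ _ (fun n t0 => forall t, t0 <= t -> Q n t) h.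
exists (\big[Num.max/0]_n f n) => t n ht; apply: hf; apply: le_trans ht.
exact: le_bigmax.
Qed.

Section LabelSpeed.
Context {R : realType} {N : nat} (i0 top : 'I_N) (mu v : R) (y0 : 'I_N -> R).
Context (j : nat -> R) (k : nat -> 'I_N) (b : 'I_N -> R -> R).
Hypothesis topE : top = N.-1 :> nat.
Hypothesis i00 : i0 = 0%N :> nat.
Hypothesis j0 : j 0%N = 0.
Hypothesis jS : forall i, j i < j i.+1.
Hypothesis joo : forall x, exists i, x < j i.
Let be l n := b n (j l).
Let Xs i := (st i0 mu y0 be j k i).1.2.
Let X := Xt i0 mu y0 j k b.
(** The jump part of a label: constant between jumps and nondecreasing, because a removed leftmost
    particle can only move up. *)
Let A i n := Xs i n - b n (j i).
Let dX i := premove (Xs i) (fun n => be i.+1 n - be i n) 0.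

Let dXE i n : dX i n = A i n + b n (j i.+1).
Proof. by rewrite /dX /premove /A /be; ring. Qed.

Let XsS i n : Xs i.+1 n = jump (dX i) (argm i0 id (dX i)) (k i.+1) n.
Proof. by []. Qed.

Let A_step i n : A i n <= A i.+1 n.
Proof.
rewrite {2}/A lerBrDr -dXE XsS; apply: jump_ge => n'; exact: (argmP i0 id).
Qed.

Let A_mono i l n : (i <= l)%N -> A i n <= A l n.
Proof. by move=> /subnKC <-; elim: (l - i)%N => [|u IH]; rewrite ?addn0// addnS (le_trans IH). Qed.

Let A0 i n : y0 n - b n 0 <= A i n.
Proof. by have := @A_mono 0%N i n (leq0n _); rewrite {1}/A /Xs /= j0. Qed.

Let XE t n : X t n = A (idx j t) n + b n t.
Proof. by rewrite /X /Xt /A /Xs /be; ring. Qed.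

(* Each choice of the rightmost particle brings the leftmost one above the level
   [A i n0], so [N] choices bring all of them there. *)
Lemma collapse i e n0 (eta : R) : (i <= e)%N -> (N <= tops top k i e)%N ->
  (forall l n, (i <= l <= e)%N -> `|b n (j l)| <= eta) ->
  forall n, A i n0 - 5 * eta <= Xs e n.
Proof.
move=> ie hN hb.
have hb1 l n : (i <= l <= e)%N -> - eta <= b n (j l) <= eta.
  by move=> h; rewrite -ler_norml hb.
(* Jump parts and positions differ by at most [eta]. When the top is chosen, the jumping label
   reaches a position at least [A i n0 - eta], so its jump part reaches [c]. If its jump part was at
   [c] already, it was the minimum, and all labels are within [2 * eta] of [c]: the second
   alternative of [Q]. *)
pose c := A i n0 - 2 * eta.
have Q l : (i <= l <= e)%N ->
    (tops top k i l <= \sum_n (c <= A l n)%R)%N \/ forall n, c - 2 * eta <= A l n.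
  move=> /andP[il le]; move: le; rewrite -(subnKC il).
  elim: (l - i)%N => [|u IH] hle.
    by left; rewrite addn0 /tops big_geq.
  have hle' : (i + u <= e)%N by apply: leq_trans hle; rewrite leq_add2l.
  have [h|h] := IH hle'.
    rewrite addnS; set l' := (i + u)%N in IH h hle *.
    have il' : (i <= l')%N by exact: leq_addr.
    have l'e : (i <= l'.+1 <= e)%N by rewrite leqW//= /l' -addnS.
    have step1 : tops top k i l'.+1 = (tops top k i l' + (k l'.+1 == top))%N.
      by rewrite /tops big_nat_recr.
    have mono : (\sum_n (c <= A l' n)%R <= \sum_n (c <= A l'.+1 n)%R)%N.
      apply: leq_sum => n _; have [h'|//] := boolP (c <= A l' n).
      by rewrite (le_trans h').
    rewrite step1; have [kt|_] := boolP (k l'.+1 == top); last first.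
      by left; rewrite addn0 (leq_trans h).
    set m := argm i0 id (dX l').
    have [hm|hm] := boolP (c <= A l' m).
      right=> n; apply: (le_trans _ (A_step l' n)).
      have h1 : dX l' m <= dX l' n by exact: (argmP i0 id).
      move: h1; rewrite !dXE.
      by have := hb1 _ m l'e; have := hb1 _ n l'e; lra.
    left; rewrite addn1; apply: (leq_ltn_trans h).
    have hm' : c <= A l'.+1 m.
      have h1 : dX l' n0 <= Xs l'.+1 m.
        rewrite XsS /jump eqxx; apply: nth_sorted_last.
        by rewrite (eqP kt).
      have h2 := A_mono n0 il'.
      move: h1; rewrite dXE {2}/A.
      by have := hb1 _ m l'e; have := hb1 _ n0 l'e; rewrite /c; lra.
    rewrite (bigD1 m)//= [in X in (_ < X)%N](bigD1 m)//= hm' (negbTE hm) add0n add1n ltnS.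
    apply: leq_sum => n _; have [h'|//] := boolP (c <= A l' n).
    by rewrite (le_trans h').
  right=> n; rewrite addnS; apply: (le_trans (h n)); exact: A_step.
have ee : (i <= e <= e)%N by rewrite ie leqnn.
have eta0 : 0 <= eta by apply: (le_trans _ (hb e n0 ee)).
have fin n : c - 2 * eta <= A e n.
  have [h|//] := Q e ee.
  have [hn|hn] := boolP (c <= A e n); first by lra.
  exfalso; have := leq_trans hN h; apply/negP; rewrite -ltnNge (bigD1 n)//= (negbTE hn) add0n.
  apply: (@leq_ltn_trans (\sum_(n' | n' != n) 1)); first by apply: leq_sum => n' _; case: (_ <= _).
  by rewrite sum1_card cardC1 card_ord; have := ltn_ord n; lia.
move=> n; have := fin n; rewrite /A -/(A i n0) /c.
by have := hb1 _ n ee; rewrite /A; lra.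
Qed.

Hypothesis hb : forall n e, 0 < e -> exists t0, forall t, t0 <= t -> `|b n t| <= e * t.
Hypothesis hX : forall e, 0 < e -> exists t0, forall t, t0 <= t ->
  `|nth 0 (sorted_pos (X t)) i0 - v * t| <= e * t.
Hypothesis htops : forall ep, 0 < ep -> exists i1, forall i, (i1 <= i)%N ->
  exists e, [/\ (i <= e)%N, (N <= tops top k i e)%N & j e <= (1 + ep) * j i].

Let hball e : 0 < e -> exists t0, forall t n, t0 <= t -> `|b n t| <= e * t.
Proof. by move=> e0; apply: eventually_all => n; exact: hb. Qed.

(** The lower bound is the speed of the minimum. For the upper one, the minimum at the later time
    [j u] has caught up with label [n] by [collapse], and [j u <= (1 + ep) * j i] makes its position
    close to [v * t]. *)
Lemma label_speed n e : 0 < e -> exists t0, forall t, t0 <= t -> `|X t n - v * t| <= e * t.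
Proof.
move=> e0.
(* [ep <= 1] gives [j u <= 2 * t], and the second bound makes the delay cost at most [e / 2 * t].
   The remaining errors add up to [13 * e / 40 * t]: six of size [e / 40 * j u] and one of size
   [e / 40 * t]. *)
pose ep := Num.min 1 (e / (2 * (`|v| + 1))).
have v1 : 0 < `|v| + 1 by rewrite ltr_wpDl.
have ep0 : 0 < ep by rewrite lt_min ltr01 divr_gt0// mulr_gt0.
have ep1 : ep <= 1 by rewrite ge_min lexx.
have epv : `|v| * ep <= e / 2.
  have : ep <= e / (2 * (`|v| + 1)) by rewrite ge_min lexx orbT.
  move=> /(ler_wpM2l (normr_ge0 v)) /le_trans; apply.
  rewrite [leLHS](_ : _ = e / 2 * (`|v| / (`|v| + 1))); last by field; rewrite gt_eqF.
  by rewrite ger_pMr ?divr_gt0// ler_pdivrMr// mul1r lerDl.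
have e40 : 0 < e / 40 by lra.
have [t1 ht1] := hball e40; have [t2 ht2] := hX e40; have [i1 hi1] := htops ep0.
have [i2 hi2] := joo (Num.max 0 (Num.max t1 t2)).
exists (j (maxn i1 i2)) => t tj.
have t0 : 0 <= t by apply: (le_trans _ tj); rewrite -j0; exact: j_mono.
have /andP[jt tj'] := idxP j0 joo t0; set i := idx j t in jt tj'.
have im : (maxn i1 i2 <= i)%N.
  rewrite -ltnS ltnNge; apply/negP => /(j_mono jS).
  by rewrite leNgt (le_lt_trans tj).
have ji : Num.max 0 (Num.max t1 t2) < j i.
  by apply: (lt_le_trans hi2); apply: j_mono => //; exact: leq_trans (leq_maxr _ _) im.
have ji0 : 0 < j i by move: ji; rewrite gt_max => /andP[].
have ji1 : t1 <= j i by move: ji; rewrite !gt_max => /and3P[_ /ltW].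
have ji2 : t2 <= j i by move: ji; rewrite !gt_max => /and3P[_ _ /ltW].
have ii1 : (i1 <= i)%N by exact: leq_trans (leq_maxl _ _) im.
have [u [iu Nu ju]] := hi1 i ii1.
have ju0 : j i <= j u by exact: j_mono.
have lowX : v * t - e / 40 * t <= X t n.
  have : nth 0 (sorted_pos (X t)) i0 <= X t n by exact: nth_sorted_first.
  by have := ht2 t (le_trans ji2 jt); rewrite ler_norml => /andP[]; lra.
have hbu l n' : (i <= l <= u)%N -> `|b n' (j l)| <= e / 40 * j u.
  move=> /andP[il lu]; apply: (le_trans (ht1 _ _ (le_trans ji1 (j_mono jS il)))).
  by rewrite ler_pM2l//; exact: j_mono.
have [n1 hn1] := nth_sorted_ex (X (j u)) i0.
have h1 := @collapse i u n _ iu Nu hbu n1.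
have h2 := ht2 (j u) (le_trans ji2 ju0); rewrite hn1 /X Xt_j// in h2.
have h3 := ht1 t n (le_trans ji1 jt).
have ju2 : j u <= 2 * t by have := ler_wpM2r (ltW ji0) ep1; move: ju jt; lra.
have iu' : (i < u)%N.
  rewrite ltn_neqAle iu andbT; apply/negP => /eqP iu'; move: Nu.
  by rewrite -iu' /tops big_geq// leqNgt (leq_ltn_trans _ (ltn_ord n)).
(* Needed for negative [v], whose sign is not yet known. *)
have tu : t <= j u by apply: (le_trans (ltW tj')); exact: j_mono.
have hv : v * j u <= v * t + e / 2 * t.
  have jut : j u <= t + ep * t.
    by have := ler_wpM2l (ltW ep0) jt; move: ju jt; lra.
  have et : 0 <= e / 2 * t by rewrite mulr_ge0//; lra.
  have [v0|v0] := leP 0 v.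
    have h4 := ler_wpM2l v0 jut; have h5 := ler_wpM2r t0 epv.
    by rewrite (ger0_norm v0) in h5; lra.
  by have := ler_wnM2l (ltW v0) tu; lra.
have h4 : e / 40 * j u <= e / 40 * (2 * t) by rewrite ler_wpM2l// ltW.
have h5 : 0 <= e * t by rewrite mulr_ge0// ltW.
have upX : X t n <= v * t + e * t.
  rewrite XE -/i; move: h1 h2 h3; rewrite /Xs !ler_norml => h1 /andP[_ h2] /andP[_ h3].
  by lra.
by rewrite ler_norml; apply/andP; split; lra.
Qed.

(** As its jump part is nondecreasing, a label stays above a constant plus its own Brownian motion,
    which is sublinear. *)
Lemma speed_ge0 : 0 <= v.
Proof.
rewrite leNgt; apply/negP => v0; pose n := i0.
have e0 : 0 < - v / 4 by lra.
have [t1 h1] := label_speed n e0; have [t2 h2] := hb n e0.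
pose c0 := y0 n - b n 0.
pose t := Num.max (Num.max t1 t2) (Num.max 0 (2 * c0 / v + 1)).
have tt1 : t1 <= t by rewrite !le_max lexx.
have tt2 : t2 <= t by rewrite !le_max lexx orbT.
have t0 : 0 <= t by rewrite !le_max lexx !orbT.
have t3 : 2 * c0 / v + 1 <= t by rewrite !le_max lexx !orbT.
have := h1 t tt1; have := h2 t tt2; rewrite XE !ler_norml => /andP[h3 _] /andP[_ h4].
have h5 := A0 (idx j t) n; rewrite -/c0 in h5.
have h6 : c0 <= v / 2 * t by lra.
have h7 : v / 2 * t <= v / 2 * (2 * c0 / v + 1) by rewrite ler_wnM2l//; lra.
have h8 : v / 2 * (2 * c0 / v + 1) = c0 + v / 2 by field; rewrite lt_eqF.
by lra.
Qed.

End LabelSpeed.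

(** * Almost sure regularity of the jump times and choices *)

Section WindowNoise.
Context {R : realType} {d : measure_display} {T : measurableType d}.
Variable P : probability T R.
Context {N : nat} (hN : (2 <= N)%N) (top : 'I_N).
Context (B : 'I_N -> R -> T -> R) (J : nat -> T -> R) (K : nat -> T -> 'I_N).
Hypothesis hnoise : BD_noise P B J K.

Let hJ : poisson_jumps P N%:R J. Proof. by case: hnoise. Qed.
Let hK : unif_choices P K. Proof. by case: hnoise. Qed.

Let out (x : R) i : set T := (fun w => J i.+1 w - J i w) @^-1` (~` `[0, x]%classic).

Let mJ i : measurable_fun setT (J i). Proof. by case: hJ. Qed.

Let mout x i : measurable (out x i).
Proof.
have : measurable_fun setT (fun w => J i.+1 w - J i w) by apply: measurable_funB.
move=> /(_ measurableT (~` `[0, x]%classic)); rewrite setTI; apply.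
exact: measurableC.
Qed.

Let Pin x i : 0 < x -> P ((fun w => J i.+1 w - J i w) @^-1` `[0, x]%classic) =
  (1 - expR (- N%:R * x))%:E.
Proof.
move=> x0; case: hJ => _ _ h _; rewrite h//.
by rewrite exponential_prob_itv0c.
Qed.

Let Pout x i : 0 < x -> P (out x i) = (expR (- N%:R * x))%:E.
Proof.
move=> x0; rewrite /out preimage_setC probability_setC ?Pin//.
  by rewrite -EFinB opprB addrCA subrr addr0.
have : measurable_fun setT (fun w => J i.+1 w - J i w) by apply: measurable_funB.
by move=> /(_ measurableT `[0, x]%classic); rewrite setTI; apply.
Qed.

Let N2 : 2 <= N%:R :> R. Proof. by rewrite ler_nat. Qed.

(** A gap that is not positive lies either outside [[0, x]] with [x = q.+1] or inside
    [[0, 1 / q.+1]]; both exponential masses vanish as [q] grows. *)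
Let ae_increasing : {ae P, forall w, forall i, J i w < J i.+1 w}.
Proof.
apply: ae_foralln => i; exists [set w | J i.+1 w - J i w <= 0]; split; last first.
- by move=> w /= /negP; rewrite -leNgt subr_le0.
- apply/eqP; rewrite eq_le measure_ge0 andbT; apply/lee_addgt0Pr => e e0; rewrite add0e.
  have N1 : 0 < N%:R + 1 :> R by rewrite addr_gt0// ltr0n ltnW.
  have eN : 0 < e / (N%:R + 1) by rewrite divr_gt0.
  have [q _ /(_ q (leqnn q)) /= hq] := near_infty_natSinv_lt (PosNum eN).
  have q0 : 0 < q.+1%:R :> R by [].
  apply: (@le_trans _ _ (P (out q.+1%:R i `|`
      (fun w => J i.+1 w - J i w) @^-1` `[0, q.+1%:R^-1]%classic))).
    have min : measurable ((fun w => J i.+1 w - J i w) @^-1` `[0, q.+1%:R^-1]%classic).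
      have : measurable_fun setT (fun w => J i.+1 w - J i w) by apply: measurable_funB.
      by move=> /(_ measurableT `[0, q.+1%:R^-1]%classic); rewrite setTI; apply.
    apply: le_measure; rewrite ?inE.
    + by apply: measurable_leR; apply: measurable_funB.
    + exact: measurableU.
    + move=> w /= hw; have [w0|w0] := leP 0 (J i.+1 w - J i w).
        by right; rewrite /= in_itv /= w0 (le_trans hw)// invr_ge0 ltW.
      by left; rewrite /out /= in_itv /= leNgt w0.
  have min : measurable ((fun w => J i.+1 w - J i w) @^-1` `[0, q.+1%:R^-1]%classic).
    have : measurable_fun setT (fun w => J i.+1 w - J i w) by apply: measurable_funB.
    by move=> /(_ measurableT `[0, q.+1%:R^-1]%classic); rewrite setTI; apply.
  apply: (@le_trans _ _ ((expR (- N%:R * q.+1%:R))%R%:E +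
      (1 - expR (- N%:R * q.+1%:R^-1))%R%:E)%E).
    rewrite -(Pout i q0) -(@Pin _ i) ?invr_gt0//.
    by apply: measureU2; [exact: mout|exact: min].
  rewrite -EFinD lee_fin.
  have h1 : expR (- N%:R * q.+1%:R) <= q.+1%:R^-1 :> R.
    rewrite mulNr expRN lef_pV2 ?posrE ?expR_gt0//.
    have := expR_ge1Dx (N%:R * q.+1%:R : R).
    have : q.+1%:R <= N%:R * q.+1%:R :> R by rewrite ler_peMl// (le_trans _ N2)// ler1n.
    by lra.
  have h2 : 1 - expR (- N%:R * q.+1%:R^-1) <= N%:R * q.+1%:R^-1 :> R.
    by have := expR_ge1Dx (- N%:R * q.+1%:R^-1 : R); rewrite mulNr lerBlDr -lerBlDl.
  have h3 : (N%:R + 1) * q.+1%:R^-1 <= e.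
    by have := ler_wpM2l (ltW N1) (ltW hq); rewrite mulrCA mulfV ?mulr1// gt_eqF.
  by apply: (le_trans (lerD h1 h2)); rewrite addrC -{2}[_^-1]mul1r -mulrDl.
- by apply: measurable_leR; apply: measurable_funB.
Qed.

(** This uses [N >= 2]: a gap exceeds [p] with probability at most [4^-p], small enough for a union
    over [2 ^ p.+1] gaps. *)
Let exp4 : expR (- N%:R) <= 4^-1 :> R.
Proof.
rewrite expRN lef_pV2 ?posrE ?expR_gt0//.
apply: (@le_trans _ _ (expR 2)); last by rewrite ler_expR.
have h : 2 <= expR 1 :> R by have := expR_ge1Dx (1 : R); lra.
have -> : expR 2 = expR 1 * expR 1 :> R by rewrite -expRD; congr expR; lra.
by nra.
Qed.

Let ae_bounded : {ae P, forall w, exists p0, forall p, (p0 <= p)%N ->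
  forall i, (i < 2 ^ p.+1)%N -> J i.+1 w - J i w <= p%:R}.
Proof.
have h : forall p, (P (\big[setU/set0]_(i < 2 ^ p.+1) out p%:R i) <= (2 * 2^-1 ^+ p)%:E)%E.
  case=> [|p].
    apply: (le_trans (probability_le1 _ _)); first by apply: bigsetU_measurable.
    by rewrite expr0 mulr1 lee_fin; lra.
  apply: (le_trans (@fin_union_le _ _ _ P _ _ (4^-1 ^+ p.+1) _ _)) => //.
    move=> i _; rewrite Pout// lee_fin expRM_natr.
    by rewrite lerXn2r// nnegrE ?expR_ge0// invr_ge0.
  rewrite lee_fin natrX exprS -mulrA ler_wpM2l// -exprMn.
  by rewrite (_ : 2%:R * 4^-1 = 2^-1)//; lra.
have h01 : 0 <= (2^-1 : R) < 1 by lra.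
have mU p : measurable (\big[setU/set0]_(i < 2 ^ p.+1) out p%:R i) by apply: bigsetU_measurable.
have := @borel_cantelli_geometric _ _ _ P _ 2 2^-1 (ler0n _ 2) h01 mU h.
apply: filterS => w [p0 hp0]; exists p0 => p pp0 i hi; rewrite leNgt; apply/negP => hlt.
apply: (hp0 p pp0); rewrite -bigcup_mkord; exists i => //.
by rewrite /out /= in_itv /= [X in _ && X]leNgt hlt andbF.
Qed.

Lemma ae_windowed : exists L,
  {ae P, forall w, windowed top L (fun i => J i w) (fun i => K i w)}.
Proof.
have N0 : 0 < N%:R :> R by rewrite ltr0n ltnW.
have a1 : 0 < (N%:R^-1 : R) <= 1.
  by rewrite invr_gt0 N0 /= invf_le1// (le_trans _ N2)// ler1n.
have sK i : <<s Ksys (K i.+1) >> (K i.+1 @^-1` [set top]).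
  by apply: sub_sigma_algebra; exists [set top].
have [L1 h1] := @indep_windows _ _ _ P (fun i => Ksys (K i.+1))
  (fun i => K i.+1 @^-1` [set top]) N%:R^-1 a1
  (let: And3 _ _ h := hK in h)
  sK
  (fun i => let: And3 h _ _ := hK in h i [set top])
  (fun i => let: And3 _ h _ := hK in h i top).
have a2 : 0 < expR (- N%:R * 1 : R) <= 1.
  by rewrite expR_gt0 mulr1 -[leRHS]expR0 ler_expR oppr_le0 ler0n.
have sout i : <<s rv_sys (fun w => J i.+1 w - J i w) >> (out 1 i).
  by apply: sub_sigma_algebra; exists (~` `[0, 1]%classic) => //; exact: measurableC.
have [L2 h2] := @indep_windows _ _ _ P (fun i => rv_sys (fun w => J i.+1 w - J i w))
  (out 1) _ a2 (let: And4 _ _ _ h := hJ in h) sout (mout 1) (fun i => Pout i ltr01).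
exists (maxn L1 L2).
apply: filterS (filterI ae_increasing (filterI ae_bounded (filterI h1 h2))).
move=> w [hinc [[p1 hp1] [[p2 hp2] [p3 hp3]]]]; split => //.
  by case: hJ.
exists (maxn p1 (maxn p2 p3)) => p; rewrite !geq_max => /and3P[pp1 pp2 pp3] i hi; split.
- exact: hp1.
- have [l /andP[l1 l2] hl] := hp2 p pp2 i hi; exists l => //; rewrite l1 (leq_trans l2)//.
  by rewrite leq_add2l leq_mul2r leq_maxl orbT.
- have [l /andP[l1 l2] hl] := hp3 p pp3 i hi; exists l.
    by rewrite l1 (leq_trans l2)// leq_add2l leq_mul2r leq_maxr orbT.
  move: hl; rewrite /out /= in_itv /= subr_ge0 (ltW (hinc l)) /= => /negP.
  by rewrite -ltNge.
Qed.

End WindowNoise.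

(** * Relabelling after every jump *)

Section FiniteSelection.
Context {R : realType} {d : measure_display} {T : measurableType d}.

(** A choice that depends on a finite table of comparisons takes finitely many table values, so it
    is measurable as soon as each comparison is. *)
Lemma measurable_ffun (I : finType) (Q : I -> T -> bool) (V : Type)
    (g : {ffun I -> bool} -> V) (y : V) :
  (forall a, measurable [set w | Q a w]) ->
  measurable [set w | g [ffun a => Q a w] = y].
Proof.
move=> mQ.
have mf (f : {ffun I -> bool}) : measurable [set w | [ffun a => Q a w] = f].
  rewrite (_ : [set w | _] = \bigcap_(a in [set: I])
      (if f a then [set w | Q a w] else ~` [set w | Q a w])).
    by apply: fin_bigcap_measurable => // a _; case: (f a) => //; exact: measurableC.
  apply/seteqP; split=> w /=.
    move=> <- a _ /=; rewrite ffunE; case e : (Q a w) => //=.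
    by rewrite e.
  move=> h; apply/ffunP => a; rewrite ffunE; have := h a Logic.I; case: (f a) => //=.
  by move=> /negP /negbTE.
rewrite (_ : [set w | _] = \bigcup_(f in [set f | g f = y]) [set w | [ffun a => Q a w] = f]).
  by apply: fin_bigcup_measurable => // f _; exact: mf.
by apply/seteqP; split=> w /= => [h|[f <- <-]//]; exists [ffun a => Q a w].
Qed.

Lemma measurable_ltR (f g : T -> R) : measurable_fun setT f -> measurable_fun setT g ->
  measurable [set w | f w < g w].
Proof.
move=> mf mg; rewrite (_ : [set w | _] = ~` [set w | g w - f w <= 0]).
  by apply: measurableC; apply: measurable_leR; exact: measurable_funB.
apply/seteqP; split=> w /=; rewrite subr_le0.
  by rewrite ltNge => /negP.
by move/negP; rewrite -ltNge.
Qed.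

Lemma measurable_leR2 (f g : T -> R) : measurable_fun setT f -> measurable_fun setT g ->
  measurable [set w | f w <= g w].
Proof.
move=> mf mg; rewrite (_ : [set w | _] = [set w | f w - g w <= 0]).
  by apply: measurable_leR; exact: measurable_funB.
by apply/seteqP; split=> w /=; rewrite subr_le0.
Qed.

Context {N : nat} (i0 : 'I_N).
Implicit Types (z x : T -> 'I_N -> R).

Definition mvec z := forall n, measurable_fun setT (fun w => z w n).

Lemma measurable_argm (s : R -> R) z a : (forall n, measurable_fun setT (fun w => s (z w n))) ->
  measurable [set w | argm i0 s (z w) = a].
Proof.
move=> mz.
pose g (f : {ffun 'I_N * 'I_N -> bool}) := odflt i0 [pick m | [forall n, f (m, n)]].
rewrite (_ : [set w | _] =
    [set w | g [ffun c : 'I_N * 'I_N => s (z w c.1) <= s (z w c.2)] = a]).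
  by apply: (@measurable_ffun _ (fun c w => s (z w c.1) <= s (z w c.2))) => c; exact: measurable_leR2.
have e w : argm i0 s (z w) = g [ffun c : 'I_N * 'I_N => s (z w c.1) <= s (z w c.2)].
  rewrite /argm /g; congr odflt; apply: eq_pick => m.
  by apply: eq_forallb => n; rewrite ffunE.
by apply/seteqP; split=> w /=; rewrite e.
Qed.

Lemma measurable_matching x z p : mvec x -> mvec z ->
  measurable [set w | matching (x w) (z w) = p].
Proof.
move=> mx mz.
pose Q (c : bool * ('I_N * 'I_N)) w :=
  if c.1 then x w c.2.1 < x w c.2.2 else z w c.2.1 <= z w c.2.2.
pose g (f : {ffun bool * ('I_N * 'I_N) -> bool}) : {perm 'I_N} :=
  odflt 1%g [pick p : {perm 'I_N} |
    [forall a, forall b, f (true, (a, b)) ==> f (false, (p a, p b))]].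
rewrite (_ : [set w | _] = [set w | g [ffun c => Q c w] = p]).
  apply: measurable_ffun => -[[] c]; rewrite /Q /=.
    exact: measurable_ltR.
  exact: measurable_leR2.
have e w : matching (x w) (z w) = g [ffun c => Q c w].
  rewrite /matching /g; congr odflt; apply: eq_pick => q.
  by apply: eq_forallb => a; apply: eq_forallb => b; rewrite !ffunE.
by apply/seteqP; split=> w /=; rewrite e.
Qed.

Lemma measurable_nth_sorted z k : mvec z ->
  measurable_fun setT (fun w => nth 0 (sorted_pos (z w)) (k : 'I_N)).
Proof.
move=> mz; apply: measurable_fun_leR => y.
pose g (f : {ffun 'I_N -> bool}) := (N - k <= \sum_n f n)%N.
rewrite (_ : [set w | _] = [set w | g [ffun n => y < z w n] = false]).
  apply: (@measurable_ffun _ (fun n w => y < z w n)) => n.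
  by apply: measurable_ltR => //; exact: measurable_cst.
have e w : (y < nth 0 (sorted_pos (z w)) k) = g [ffun n => y < z w n].
  rewrite nth_sorted_gt /g /cnt; congr (_ <= _)%N.
  by apply: eq_bigr => n _; rewrite ffunE.
by apply/seteqP; split=> w /=; rewrite -e leNgt; [move/negbTE|move=> ->].
Qed.

Lemma measurable_jump z (m k : T -> 'I_N) : mvec z ->
  (forall a, measurable [set w | m w = a]) -> (forall a, measurable [set w | k w = a]) ->
  mvec (fun w => jump (z w) (m w) (k w)).
Proof.
move=> mz mm mk n.
apply: (@measurable_select _ _ _ _ (fun w => (m w, k w))
  (fun c w => jump (z w) c.1 c.2 n)) => -[a c].
  rewrite (_ : _ @^-1` _ = [set w | m w = a] `&` [set w | k w = c]).
    exact: measurableI.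
  by apply/seteqP; split=> w /=; [move=> [-> ->]|move=> [-> ->]].
move=> _ _; rewrite /jump /=; case: (n == a); last exact: mz.
exact: measurable_nth_sorted.
Qed.

Lemma measurable_relabel z (p : T -> {perm 'I_N}) : mvec z ->
  (forall q, measurable [set w | p w = q]) -> mvec (fun w => z w \o p w).
Proof.
move=> mz mp n.
by apply: (@measurable_select _ _ _ _ p (fun q w => z w (q n))) => // q _ _; exact: mz.
Qed.

Variables (mu : R) (y0 : 'I_N -> R).

Lemma measurable_st (be : nat -> 'I_N -> T -> R) (j : nat -> T -> R) (k : nat -> T -> 'I_N) :
  (forall l n, measurable_fun setT (be l n)) -> (forall l, measurable_fun setT (j l)) ->
  (forall l a, measurable [set w | k l.+1 w = a]) ->
  forall i, [/\ mvec (fun w => (st i0 mu y0 (fun l n => be l n w) (j^~ w) (k^~ w) i).1.1),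
    mvec (fun w => (st i0 mu y0 (fun l n => be l n w) (j^~ w) (k^~ w) i).1.2) &
    forall p, measurable [set w | (st i0 mu y0 (fun l n => be l n w) (j^~ w) (k^~ w) i).2 = p]].
Proof.
move=> mbe mj mk; elim=> [|i [mZ mX _]].
  split=> [n|n|p]; try exact: measurable_cst.
  rewrite /=; have [->|ne] := eqVneq p 1%g.
    by rewrite (_ : [set _ | _] = setT)//; apply/seteqP; split.
  rewrite (_ : [set _ | _] = set0)//; apply/seteqP; split=> w //= h.
  by rewrite h eqxx in ne.
have pm (z : T -> 'I_N -> R) (c : T -> R) : mvec z -> measurable_fun setT c ->
    mvec (fun w => premove (z w) (fun n => be i.+1 n w - be i n w) (c w)).
  move=> mz mc n; apply: measurable_funD => //; apply: measurable_funD => //.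
  exact: measurable_funB.
have mdZ := pm _ (fun w => mu * (j i.+1 w - j i w)) mZ
  (measurable_funM (measurable_cst _) (measurable_funB (mj _) (mj _))).
have mdX := pm _ (fun w => 0) mX (measurable_cst _).
have mZ1 : mvec (fun w => jumpZ i0 (premove
    (st i0 mu y0 (fun l n => be l n w) (j^~ w) (k^~ w) i).1.1
    (fun n => be i.+1 n w - be i n w) (mu * (j i.+1 w - j i w))) (k i.+1 w)).
  apply: measurable_jump => // a; apply: measurable_argm => n.
  rewrite /bee; apply: measurableT_comp => //; apply: measurableT_comp => //; exact: mdZ.
have mX1 : mvec (fun w => jumpX i0 (premove
    (st i0 mu y0 (fun l n => be l n w) (j^~ w) (k^~ w) i).1.2
    (fun n => be i.+1 n w - be i n w) 0) (k i.+1 w)).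
  by apply: measurable_jump => // a; apply: measurable_argm.
split => //=; last by move=> p; exact: measurable_matching.
by apply: measurable_relabel => // q; exact: measurable_matching.
Qed.

End FiniteSelection.

Section Iterate.
Context {R : realType} {d : measure_display} {T : measurableType d}.
Variable P : probability T R.
Context {N : nat} (i0 : 'I_N) (mu : R) (y0 : 'I_N -> R).
Implicit Types (B : 'I_N -> R -> T -> R) (J : nat -> T -> R) (K : nat -> T -> 'I_N).

(** The random time is approximated from below, so that only coordinates before it are used. *)
Lemma Fgen_time B J K (Q : 'I_N * R -> Prop) n (tau : T -> R) :
  (forall w, {within [set t : R | 0 <= t], continuous (fun t => B n t w)}) ->
  measurable_fun setT (tau : g_sigma_algebraType (Fgen B J K Q) -> R) ->
  (forall w, 0 <= tau w) -> (forall m w, Q (n, dfloor m (tau w))) ->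
  measurable_fun setT ((fun w => B n (tau w) w) : g_sigma_algebraType (Fgen B J K Q) -> R).
Proof.
move=> cB mtau tau0 hQ.
apply: (@measurable_fun_cvg _ (g_sigma_algebraType (Fgen B J K Q)) _ _
  (fun m w => B n (dfloor m (tau w)) w)); last first.
  move=> w _; apply: (within_continuous_seq (cB w)) => //.
    by move=> m; exact: grid_ge0.
  exact: dfloor_cvg.
move=> m.
apply: (@measurable_select _ _ (g_sigma_algebraType (Fgen B J K Q)) _
  (fun w => Num.truncn (tau w * 2 ^+ m)) (fun k w => B n (grid m k) w)).
  move=> k.
  have h : measurable_fun setT (fun w : g_sigma_algebraType (Fgen B J K Q) => tau w * 2 ^+ m).
    by apply: measurable_funM.
  have := h measurableT _ (measurable_truncn_fiber k); by rewrite setTI.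
move=> k _ [w <-]; apply: (@Fgen_B _ _ _ _ B J K Q (n, _)); exact: (hQ m w).
Qed.

Lemma Fgen_Jm B J K Q i :
  measurable_fun setT (J i : g_sigma_algebraType (Fgen B J K Q) -> R).
Proof.
move=> _ A mA; rewrite setTI; apply: Fgen_J; apply: sub_sigma_algebra.
by exists i; exists A.
Qed.

Lemma Fgen_Km B J K Q i a : <<s Fgen B J K Q >> [set w | K i.+1 w = a].
Proof. by apply: Fgen_K; apply: sub_sigma_algebra; exists i; exists [set a]. Qed.

Definition good_times (j : nat -> R) :=
  [/\ j 0%N = 0, forall i, j i < j i.+1 & forall x, exists i, x < j i].

Definition goodset J : set T := [set w | good_times (J^~ w)].

Lemma goodset_J J : <<s J_sys J >> (goodset J).
Proof.
have mJ i : measurable_fun setT (J i : g_sigma_algebraType (J_sys J) -> R).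
  by move=> _ A mA; rewrite setTI; apply: sub_sigma_algebra; exists i; exists A.
rewrite (_ : goodset J = J 0%N @^-1` [set 0] `&` (\bigcap_i [set w | J i w < J i.+1 w]) `&`
    \bigcap_(m : nat) \bigcup_i [set w | m%:R < J i w]).
  apply: (@measurableI _ (g_sigma_algebraType (J_sys J))); first apply: (@measurableI _ (g_sigma_algebraType (J_sys J))).
  - by have := mJ 0%N measurableT [set 0] (measurable_set1 _); rewrite setTI.
  - by apply: (@bigcapT_measurable _ (g_sigma_algebraType (J_sys J))) => i; exact: measurable_ltR.
  - apply: (@bigcapT_measurable _ (g_sigma_algebraType (J_sys J))) => m.
    apply: (@bigcupT_measurable _ (g_sigma_algebraType (J_sys J))) => i.
    by apply: measurable_ltR => //; exact: measurable_cst.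
apply/seteqP; split=> w.
  move=> [h1 h2 h3]; split; first by split=> // i _; exact: h2.
  by move=> m _; have [i hi] := h3 m%:R; exists i.
move=> [[h1 h2] h3]; split => //; first by move=> i; exact: h2.
move=> x; have [i _ hi] := h3 (Num.truncn x).+1 Logic.I; exists i.
by apply: lt_trans hi; exact: truncnS_gt.
Qed.

Definition stB B J K i w : state :=
  st i0 mu y0 (fun l n => B n (J l w) w) (J^~ w) (K^~ w) i.

Definition rhoB B J K i w : {perm 'I_N} :=
  if w \in goodset J then (stB B J K i w).2 else 1%g.

Definition clip (q x : R) : R := Num.max 0 (Num.min x q).

Lemma clip_ge0 q x : 0 <= clip q x. Proof. by rewrite le_max lexx. Qed.

Lemma clip_le q x : 0 <= q -> clip q x <= q.
Proof. by move=> q0; rewrite ge_max q0 ge_min lexx orbT. Qed.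

Lemma clip_id q x : 0 <= x -> x <= q -> clip q x = x.
Proof. by move=> x0 xq; rewrite /clip (min_idPl xq) (max_idPr x0). Qed.

(* Agrees with [stB] on [J i <= q], but only looks at the Brownian motions up to
   time [q]; this makes the matching permutations adapted. *)
Definition stq q B J K i w : state :=
  st i0 mu y0 (fun l n => B n (clip q (J l w)) w) (J^~ w) (K^~ w) i.

Lemma stqE q B J K i w : goodset J w -> J i w <= q -> stq q B J K i w = stB B J K i w.
Proof.
move=> [j0 jS _] hq; apply: st_ext => // l li n.
have jl : J l w <= J i w by exact: (@j_mono _ (J^~ w)).
by rewrite clip_id ?(le_trans jl)// -j0 (@j_mono _ (J^~ w)).
Qed.

Lemma measurable_stq q B J K i (Q : 'I_N * R -> Prop) : BD_noise P B J K -> 0 <= q ->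
  (forall c, past q c -> Q c) ->
  [/\ @mvec R _ (g_sigma_algebraType (Fgen B J K Q)) N (fun w => (stq q B J K i w).1.1),
    @mvec R _ (g_sigma_algebraType (Fgen B J K Q)) N (fun w => (stq q B J K i w).1.2) &
    forall p, <<s Fgen B J K Q >> [set w | (stq q B J K i w).2 = p]].
Proof.
move=> hN q0 hQ.
have cB n w : {within [set t : R | 0 <= t], continuous (fun t => B n t w)}.
  by case: hN => hB _ _ _; case: (hB n).
apply: (@measurable_st _ _ (g_sigma_algebraType (Fgen B J K Q)) _ i0 mu y0
  (fun l n w => B n (clip q (J l w)) w) J K).
- move=> l n; apply: Fgen_time => //.
  + apply: measurable_maxr; first exact: measurable_cst.
    by apply: measurable_minr; [exact: Fgen_Jm|exact: measurable_cst].
  + by move=> w; exact: clip_ge0.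
  + move=> m w; apply: hQ; split; first by exists m; eexists.
    have /andP[h _] := dfloor_dceil m (clip_ge0 q (J l w)).
    exact: (le_trans h (clip_le _ q0)).
- by move=> l; exact: Fgen_Jm.
- by move=> l a; exact: Fgen_Km.
Qed.

Lemma rho_past B J K i q p : BD_noise P B J K -> dyadic q ->
  <<s Fgen B J K (past q) >> ([set w | rhoB B J K i w = p] `&` [set w | J i w <= q]).
Proof.
move=> hN dq; have q0 := dyadic_ge0 dq.
have [_ _ mp] := measurable_stq i hN q0 (fun c (h : past q c) => h).
pose F := g_sigma_algebraType (Fgen B J K (past q)).
rewrite (_ : _ `&` _ = [set w | J i w <= q] `&`
    ((goodset J `&` [set w | (stq q B J K i w).2 = p]) `|`
     (~` goodset J `&` [set w | 1%g = p]))).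
  apply: (@measurableI _ F); first by apply: measurable_leR; exact: Fgen_Jm.
  have mg : <<s Fgen B J K (past q) >> (goodset J) by apply: Fgen_J; exact: goodset_J.
  apply: (@measurableU _ F); apply: (@measurableI _ F).
  - exact: mg.
  - exact: mp.
  - exact: (@measurableC _ F _ mg).
  have [->|ne] := eqVneq 1%g p.
    by rewrite (_ : [set _ | _] = setT); [exact: (@measurableT _ F)|apply/seteqP; split].
  rewrite (_ : [set _ | _] = set0); first exact: (@measurable0 _ F).
  by apply/seteqP; split=> w //= h; rewrite h eqxx in ne.
apply/seteqP; split=> w /=.
  move=> [hp hq]; split => //; have [g|g] := pselect (goodset J w).
    by left; split=> //; rewrite stqE// -hp /rhoB (mem_set g).
  by right; split=> //; rewrite -hp /rhoB (memNset g).
move=> [hq [[g hp]|[g hp]]]; split => //; rewrite /rhoB.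
  by rewrite (mem_set g) -(stqE B K g hq).
by rewrite (memNset g).
Qed.

Section Limit.
Context (B : 'I_N -> R -> T -> R) (J : nat -> T -> R) (K : nat -> T -> 'I_N).
Hypothesis hN : BD_noise P B J K.

(* [Bs i] has undergone the relabellings of the first [i] jumps. *)
Fixpoint Bs i : 'I_N -> R -> T -> R :=
  if i is i'.+1 then switched (Bs i') (J i'.+1) (rhoB (Bs i') J K i'.+1) else B.

Let good_ge0 w i : goodset J w -> 0 <= J i w.
Proof. by move=> [j0 jS _]; rewrite -j0 (@j_mono _ (J^~ w)). Qed.

Let tau_rho B' i w : 0 <= J i w \/ rhoB B' J K i w = 1%g.
Proof. by rewrite /rhoB; case: ifPn => g; [left; apply: good_ge0; exact: set_mem|right]. Qed.

Let mJ i a : <<s J_sys J >> [set w | J i w <= a].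
Proof.
apply: (@measurable_leR _ _ (g_sigma_algebraType (J_sys J)) (J i)) => _ A mA.
by rewrite setTI; apply: sub_sigma_algebra; exists i; exists A.
Qed.

Lemma Bs_noise i : BD_noise P (Bs i) J K.
Proof.
elim: i => //= i IH; apply: switched_noise => //.
by move=> q p; exact: rho_past.
Qed.

Let Bs_law i : law_eq P nonneg_time B (Bs i) J K.
Proof.
elim: i => [|i IH] DJ DK hJ hK L hL //.
rewrite IH//; apply: (switched_law_eq (Bs_noise i)) => //.
by move=> q p; exact: rho_past (Bs_noise i).
Qed.

Let BsS i n t w : t <= J i.+1 w -> Bs i.+1 n t w = Bs i n t w.
Proof. by move=> h; rewrite /= /switched /sw h. Qed.

Let Bs_bad i n t w : ~ goodset J w -> Bs i n t w = B n t w.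
Proof.
move=> g; elim: i => //= i IH; rewrite /switched /rhoB (memNset g).
by rewrite sw1.
Qed.

Let Bs_stable i i' n t w : goodset J w -> (i <= i')%N -> t <= J i.+1 w ->
  Bs i' n t w = Bs i n t w.
Proof.
move=> [j0 jS _] /subnKC <- ht; elim: (i' - i)%N => [|u IH]; rewrite ?addn0// addnS.
rewrite BsS// (le_trans ht)// (@j_mono _ (J^~ w))// ltnS leq_addr//.
Qed.

(** A switch at a jump time alters only later values, so [Bs i n t w] is eventually constant in [i];
    this is its final value. *)
Definition Binf n t w : R :=
  if w \in goodset J then Bs (idx (J^~ w) t) n t w else B n t w.

Lemma BinfE i n t w : goodset J w -> 0 <= t -> t <= J i.+1 w -> Binf n t w = Bs i n t w.
Proof.
move=> g t0 ht; rewrite /Binf (mem_set g).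
have [j0 jS joo] := g; have /andP[h1 h2] := idxP j0 joo t0.
have [le|lt] := leqP i (idx (J^~ w) t); first exact: Bs_stable.
by apply/esym; apply: Bs_stable => //; [exact: ltnW|exact: ltW].
Qed.

Let Bs_cvg n t w : 0 <= t -> Bs i n t w @[i --> \oo] --> Binf n t w.
Proof.
move=> t0; have [g|g] := pselect (goodset J w); last first.
  rewrite /Binf (memNset g).
  rewrite (_ : (fun i => _) = cst (B n t w)); first exact: cvg_cst.
  by apply/funext => i; exact: Bs_bad.
have [j0 jS joo] := g; have [i hi] := joo t.
apply: cvg_near_cst; exists i => // i' /= ii'; apply/esym; apply: BinfE => //.
by rewrite (le_trans (ltW hi))// (@j_mono _ (J^~ w))// leqW.
Qed.

Let Binf_measurable n t : 0 <= t -> measurable_fun setT (Binf n t).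
Proof.
move=> t0; apply: (@measurable_fun_cvg _ _ _ _ (fun i => Bs i n t)).
  by move=> i; exact: (noiseM (Bs_noise i)).
by move=> w _; exact: Bs_cvg.
Qed.

Lemma Binf_noise : BD_noise P Binf J K.
Proof.
apply: (noise_transfer hN).
- move=> DJ DK hJ hK L hL.
  have mJ' : measurable DJ by apply: measurable_J_sys hJ; case: hN => _ [].
  have mK' : measurable DK by apply: measurable_K_sys hK; case: hN => _ _ [].
  apply: (@cyl_lim_eq _ _ _ P _ _ _ (fun i => bcoord B) (fun i => bcoord (Bs i))).
  + exact: measurableI.
  + by move=> m c /hL; exact: (noiseM hN).
  + by move=> m c /hL; exact: (noiseM (Bs_noise m)).
  + by move=> w c _; exact: cvg_cst.
  + by move=> w c /hL; exact: Bs_cvg.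
  + by move=> m e; apply: Bs_law => // c /mapP[c' /hL h ->].
- exact: Binf_measurable.
- move=> n w; rewrite /Binf; case: ifP => g; last exact: (noise0 hN).
  exact: (noise0 (Bs_noise _)).
- move=> n w; have cB i : {within [set t : R | 0 <= t], continuous (fun t => Bs i n t w)}.
    by case: (Bs_noise i) => hB _ _ _; case: (hB n).
  have [g|g] := pselect (goodset J w); last first.
    rewrite (_ : (fun t => _) = (fun t => B n t w)); first exact: (cB 0%N).
    by apply/funext => t; rewrite /Binf (memNset g).
  apply/within_continuousP => x x0 e e0; have [_ _ joo] := g.
  have [i hi] := joo (x + 1); have [dl dl0 hdl] := (within_continuousP _).1 (cB i) x x0 e e0.
  have jS : J i w < J i.+1 w by case: g.
  exists (Num.min dl 1); first by rewrite lt_min dl0 ltr01.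
  move=> y y0'; rewrite lt_min => /andP[h1 h2].
  have yx : y <= x + 1 by move: h2; rewrite ltr_norml => /andP[_]; lra.
  rewrite (BinfE _ g y0' (_ : y <= J i.+1 w)) ?(BinfE _ g x0 (_ : x <= J i.+1 w)).
  + exact: hdl.
  + by move: hi jS; lra.
  + by move: hi jS yx; lra.
Qed.

(** Resolves the apparent circularity: the matching at a jump only looks at the motions up to that
    jump, where later switches have no effect. The permutations used to build [Binf] are thus those
    of the coupling driven by [Binf]. *)
Lemma Binf_state i w : goodset J w -> stB Binf J K i.+1 w = stB (Bs i) J K i.+1 w.
Proof.
move=> g; apply: st_ext => // l li n.
by apply: BinfE => //; [exact: good_ge0|case: g => _ jS _; exact: (@j_mono _ (J^~ w))].
Qed.

(** [sg w i n] is the original label whose increments drive label [n] after jump [i]. The product of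
    permutations applies its left factor first. *)
Fixpoint sg w i : {perm 'I_N} :=
  if i is i'.+1 then ((stB Binf J K i'.+1 w).2 * sg w i')%g else 1%g.

Lemma Binf_increment i n t w : goodset J w -> J i w <= t -> t <= J i.+1 w ->
  Binf n t w - Binf n (J i w) w = B (sg w i n) t w - B (sg w i n) (J i w) w.
Proof.
move=> g.
have key i' n' t' : J i' w <= t' ->
    Bs i' n' t' w - Bs i' n' (J i' w) w = B (sg w i' n') t' w - B (sg w i' n') (J i' w) w.
  elim: i' n' t' => [|i' IH] n' t' ht'; first by rewrite /= perm1.
  have jS : J i' w < J i'.+1 w by case: g.
  have e s : J i'.+1 w <= s -> Bs i'.+1 n' s w = Bs i' n' (J i'.+1 w) w +
      (Bs i' (rhoB (Bs i') J K i'.+1 w n') s w - Bs i' (rhoB (Bs i') J K i'.+1 w n') (J i'.+1 w) w).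
    rewrite le_eqVlt => /orP[/eqP <-|hs]; first by rewrite subrr addr0 BsS.
    by rewrite /= /switched /sw leNgt hs.
  have hr : rhoB (Bs i') J K i'.+1 w = (stB Binf J K i'.+1 w).2.
    by rewrite /rhoB (mem_set g) Binf_state.
  rewrite e// (e (J i'.+1 w))// hr /= permM.
  set m := (stB Binf J K i'.+1 w).2 n'.
  have h1 := IH m t' (le_trans (ltW jS) ht').
  have h2 := IH m (J i'.+1 w) (ltW jS).
  by move: h1 h2; lra.
move=> h1 h2; have J0 := good_ge0 i g.
have jS : J i w < J i.+1 w by case: g.
by rewrite !(@BinfE i) ?key// ?(le_trans J0)// ltW.
Qed.

End Limit.
End Iterate.

(** * Absence of ties *)

Section MarkovIncrement.
Context {R : realType} {d : measure_display} {T : measurableType d}.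
Variable P : probability T R.

Section OneBM.
Context (W : R -> T -> R) (M r : nat) (u : R).
Hypothesis hW : std_BM P W.
Hypothesis qu : grid M r < u.

(** The grid up to [grid M r], then [u], so that the increment of interest is number [r]. The tail
    [u + 1, u + 2, ...] continues the strictly increasing infinite sequence required by [std_BM]. *)
Let tt (l : nat) : R := if (l <= r)%N then grid M l else u + (l - r.+1)%:R.

Let tt_lt l : tt l < tt l.+1.
Proof.
rewrite /tt; case: ltngtP => [lr|rl|->].
- by rewrite -subr_gt0 gridS invr_gt0 two_exp_gt0.
- by rewrite ltrD2l ltr_nat subSn.
- by rewrite subnn addr0.
Qed.

Let tt_ge0 l : 0 <= tt l.
Proof. by elim: l => [|l IH]; [rewrite /tt leq0n grid0|rewrite (le_trans IH)// ltW]. Qed.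

Let mW t : 0 <= t -> measurable_fun setT (W t). Proof. by case: hW => + _ _ _ _; exact. Qed.

Let f (w : T) : 'I_1 -> nat -> R := fun _ l => if (l < r)%N then W (tt l.+1) w - W (tt l) w else 0.

Let mf E : boxes E -> measurable (f @^-1` E).
Proof.
move=> [Lm [A [mA ->]]].
rewrite (_ : _ @^-1` _ = \bigcap_(n in [set: 'I_1]) \bigcap_(l in `I_Lm)
    ((fun w => f w n l) @^-1` A n l)); last first.
  apply/seteqP; split=> w; first by move=> h n _ l lL; exact: h.
  by move=> h n l lL; exact: (h n Logic.I l).
apply: fin_bigcap_measurable => // n _; apply: fin_bigcap_measurable => // l _.
have : measurable_fun setT (fun w => f w n l).
  rewrite /f; case: (l < r)%N; last exact: measurable_cst.
  by apply: measurable_funB; apply: mW; exact: tt_ge0.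
by move=> /(_ measurableT _ (mA n l)); rewrite setTI.
Qed.

Let S (A : set R) : set T := (fun w => W u w - W (grid M r) w) @^-1` A.

Let mS A : measurable A -> measurable (S A).
Proof.
move=> mA; have u0 : 0 <= u by rewrite (le_trans _ (ltW qu))// grid_ge0.
have : measurable_fun setT (fun w => W u w - W (grid M r) w).
  by apply: measurable_funB; apply: mW => //; exact: grid_ge0.
by move=> /(_ measurableT A mA); rewrite setTI.
Qed.

Let box_indep A E : measurable A -> boxes E ->
  P (S A `&` f @^-1` E) = (P (S A) * P (f @^-1` E))%E.
Proof.
move=> mA [Lm [A' [mA' ->]]].
pose C l : set R := (if (l < Lm)%N then A' ord0 l else setT).
have mC l : measurable (C l) by rewrite /C; case: ifP.
(* Coordinates [l >= r] of [f] are constant; they only decide whether the box is empty. *)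
have [hc|hc] := pselect (forall l, (r <= l < Lm)%N -> A' ord0 l 0); last first.
  have -> : f @^-1` box Lm A' = set0.
    apply/seteqP; split=> w // hw; apply: hc => l /andP[rl lL].
    by have := hw ord0 l lL; rewrite /f ltnNge rl.
  by rewrite setI0 measure0 mule0.
pose F l := (fun w => W (tt l.+1) w - W (tt l) w) @^-1` (if (l < r)%N then C l else A).
have fE : f @^-1` box Lm A' = \bigcap_(l in `I_r)
    ((fun w => W (tt l.+1) w - W (tt l) w) @^-1` C l).
  apply/seteqP; split=> w h.
    move=> l lr /=; rewrite /C; case: ifP => // lL.
    by have := h ord0 l lL; rewrite /f lr.
  move=> n l lL; rewrite (ord1 n) /f; case: ltnP => lr; last by apply: hc; rewrite lr.
  by have := h l lr; rewrite /C /= lL.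
have SE : S A `&` f @^-1` box Lm A' = \bigcap_(l in `I_r.+1) F l.
  have er : tt r = grid M r by rewrite /tt leqnn.
  have eu : tt r.+1 = u by rewrite /tt ltnn subnn addr0.
  rewrite fE; apply/seteqP; split=> w.
    move=> [h1 h2] l /= lr; rewrite /F; have [lr'|rl] := ltnP l r; first exact: h2.
    have -> : l = r by apply/eqP; rewrite eqn_leq rl -ltnS lr.
    by rewrite er eu.
  move=> h; split.
    by have := h r (leqnn _); rewrite /F ltnn er eu.
  by move=> l lr; have := h l (ltnW lr : (l < r.+1)%N); rewrite /F lr.
have [_ _ _ _ h5] := hW.
have hi := h5 tt (tt_ge0 0) tt_lt.
rewrite SE fE hi; last first.
  by move=> l _; apply: sub_sigma_algebra; eexists; last reflexivity; rewrite /=; case: ifP.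
rewrite (hi r (fun l => (fun w => (W (tt l.+1) w - W (tt l) w)%R) @^-1` C l)); last first.
  by move=> l _; apply: sub_sigma_algebra; exists (C l); [exact: mC|].
rewrite big_ord_recr /= muleC; congr (_ * _)%E.
  rewrite /F ltnn; have -> : tt r = grid M r by rewrite /tt leqnn.
  by have -> : tt r.+1 = u by rewrite /tt ltnn subnn addr0.
by apply: eq_bigr => l _; rewrite /F ltn_ord.
Qed.

Lemma BM_markov (L : seq (R * R)) A : measurable A ->
  (forall c, c \in L -> exists2 k, (k <= r)%N & c.1 = grid M k) ->
  P ([set w | all (fun c => (W c.1 w <= c.2)%R) L] `&` S A) =
  (P [set w | all (fun c => (W c.1 w <= c.2)%R) L] * P (S A))%E.
Proof.
move=> mA hL.
have [kk hkk] : {kk : R * R -> nat & forall c, c \in L -> (kk c <= r)%N /\ c.1 = grid M (kk c)}.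
  apply: (@choice _ _ (fun c k => c \in L -> (k <= r)%N /\ c.1 = grid M k)) => c.
  have [cL|] := boolP (c \in L); last by exists 0%N.
  by have [k kr ck] := hL c cL; exists k.
pose L' : seq (('I_1 * R) * R) := [seq ((ord0, c.1), c.2) | c <- L].
pose kk' (c : ('I_1 * R) * R) := kk (c.1.2, c.2).
have W0 w : W 0 w = 0 by case: hW.
have -> : [set w | all (fun c => (W c.1 w <= c.2)%R) L] =
    f @^-1` [set x : 'I_1 -> nat -> R | all (fun c => \sum_(l < kk' c) x c.1.1 l <= c.2) L'].
  have e w : all (fun c => (W c.1 w <= c.2)%R) L =
      all (fun c => \sum_(l < kk' c) f w c.1.1 l <= c.2) L'.
    rewrite all_map; apply: eq_in_all => -[t a] cL /=.
    have [kr /= ct] := hkk _ cL; rewrite /kk' /= {1}ct; congr (_ <= _).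
    transitivity (\sum_(l < kk (t, a)) (W (grid M l.+1) w - W (grid M l) w)).
      rewrite -(big_mkord xpredT (fun l => W (grid M l.+1) w - W (grid M l) w)).
      by rewrite telescope_sumr// grid0 W0 subr0.
    apply: eq_bigr => l _; have lr : (l < r)%N by exact: leq_trans (ltn_ord l) kr.
    by rewrite /f lr /tt lr ltnW.
  by apply/seteqP; split=> w /=; rewrite e.
have := @pi_lambda_eq _ _ _ P _ (@boxes R 1) f f (S A) setT (fine (P (S A)))
  (fine_ge0 (measure_ge0 _ _)) (@boxes_setI R 1) (mS mA) measurableT
  (fun E hE => conj (mf hE) (mf hE)).
have PfE : (fine (P (S A)))%:E = P (S A) by rewrite fineK// fin_num_measure//; exact: mS.
rewrite PfE probability_setT mule1 => /(_ erefl).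
have hb E : boxes E -> P (S A `&` f @^-1` E) = (P (S A) * P (setT `&` f @^-1` E))%E.
  by move=> hE; rewrite setTI; exact: box_indep.
move=> /(_ hb _ (measurable_cyl_incs L' kk')) [_ _].
by rewrite setTI setIC => ->; rewrite muleC.
Qed.

End OneBM.

Context {N : nat}.
Context (B : 'I_N -> R -> T -> R) (J : nat -> T -> R) (K : nat -> T -> 'I_N).
Hypothesis hN : BD_noise P B J K.
Context (a : 'I_N).

(** Everything except the motion of [a] after time [q]: the other Brownian motions are known for all
    times. *)
Definition past_of (q : R) (c : 'I_N * R) : Prop := dyadic c.2 /\ (c.1 = a -> c.2 <= q).

Lemma past_of_ge0 q c : past_of q c -> 0 <= c.2. Proof. by move=> [/dyadic_ge0]. Qed.

(** Sorting the constraints by label isolates the motion of [a] through the independence in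
    [BD_noise]; within that motion the increment is independent of the past by [BM_markov]. *)
Lemma increment_indep q u H A : dyadic q -> dyadic u -> q < u -> measurable A ->
  <<s Fgen B J K (past_of q) >> H ->
  P (H `&` (fun w => (B a u w - B a q w)%R) @^-1` A) =
  (P H * P ((fun w => (B a u w - B a q w)%R) @^-1` A))%E.
Proof.
move=> dq du qu mA hH; set S := _ @^-1` A.
have [hB hJ hK hI] := hN.
have mS : measurable S.
  have : measurable_fun setT (fun w => B a u w - B a q w).
    by apply: measurable_funB; apply: (noiseM hN); exact: dyadic_ge0.
  by move=> /(_ measurableT A mA); rewrite setTI.
have key DJ DK L : <<s J_sys J >> DJ -> <<s K_sys K >> DK ->
    (forall c, c \in L -> past_of q c.1) ->
    P (S `&` (DJ `&` DK `&` cyl (bcoord B) L)) = (P S * P (DJ `&` DK `&` cyl (bcoord B) L))%E.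
  move=> hDJ hDK hL.
  pose Ln n := [seq c <- L | c.1.1 == n].
  pose G n := cyl (bcoord B) (Ln n).
  pose E (s : bool) (c : 'I_N + bool) := match c with
    | inl n => if s && (n == a) then G n `&` S else G n
    | inr true => DJ | inr false => DK end.
  have cylE : cyl (bcoord B) L = \bigcap_(n in [set: 'I_N]) G n.
    apply/seteqP; split=> w.
      by move=> /allP h n _; apply/allP => c; rewrite mem_filter => /andP[_ /h].
    move=> h; apply/allP => c cL; have /allP := h c.1.1 Logic.I; apply.
    by rewrite mem_filter eqxx.
  have GB n : <<s BM_sys (B n) >> (G n).
    apply: (@measurable_cyl _ _ (g_sigma_algebraType (BM_sys (B n)))) => c.
    rewrite mem_filter => /andP[/eqP <- /hL /past_of_ge0 c0].
    exact: BM_sys_measurable.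
  have SB : <<s BM_sys (B a) >> S.
    have : measurable_fun setT (fun w : g_sigma_algebraType (BM_sys (B a)) => B a u w - B a q w).
      by apply: measurable_funB; apply: BM_sys_measurable; exact: dyadic_ge0.
    by move=> /(_ measurableT A mA); rewrite setTI.
  have hE s c : <<s match c with
      | inl n => BM_sys (B n) | inr true => J_sys J | inr false => K_sys K end >> (E s c).
    case: c => [n|[]] //=; case: ifP => [/andP[_ /eqP ->]|_]; last exact: GB.
    by apply: gen_setI; [exact: GB|exact: SB].
  have E0 : DJ `&` DK `&` cyl (bcoord B) L = \bigcap_(c in [set: 'I_N + bool]) E false c.
    rewrite cylE; apply/seteqP; split=> w.
      by move=> [[h1 h2] h3] [n|[]] _ //=; exact: h3.
    move=> h; split; first by split; [exact: (h (inr true))|exact: (h (inr false))].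
    by move=> n _; exact: (h (inl n)).
  have E1 : S `&` (DJ `&` DK `&` cyl (bcoord B) L) = \bigcap_(c in [set: 'I_N + bool]) E true c.
    rewrite cylE; apply/seteqP; split=> w.
      move=> [hS [[h1 h2] h3]] [n|[]] _ //=; case: ifP => _; last exact: h3.
      by split => //; exact: h3.
    move=> h; split; first by have := h (inl a) Logic.I; rewrite /= eqxx => -[].
    split; first by split; [exact: (h (inr true))|exact: (h (inr false))].
    by move=> n _; have := h (inl n) Logic.I; rewrite /=; case: ifP => // _ [].
  rewrite E1 E0 !hI//.
  rewrite (bigD1 (inl a))//= eqxx [in RHS](bigD1 (inl a))//= muleA; congr (_ * _)%E; last first.
    by apply: eq_bigr => -[n|[]] //= /negbTE; rewrite (inj_eq (@inl_inj _ _)) => ->.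
  have [M hM] : exists M, (exists r, q = grid M r) /\
      forall c, c \in Ln a -> exists k, c.1.2 = grid M k.
    have [] := @dyadic_common R (option (('I_N * R) * R)) (None :: [seq Some c | c <- Ln a])
      (fun o => if o is Some c then c.1.2 else q).
      move=> c; rewrite inE => /orP[/eqP->//|/mapP[c' + ->]].
      by rewrite mem_filter => /andP[_ /hL[]].
    move=> M hM; exists M; split; first exact: (hM None (mem_head _ _)).
    by move=> c cL; apply: (hM (Some c)); rewrite inE; apply/orP; right; apply/mapP; exists c.
  have [[r qr] hk] := hM.
  have qu' : grid M r < u by rewrite -qr.
  have := @BM_markov (B a) M r u (hB a) qu' [seq (c.1.2, c.2) | c <- Ln a] A mA.
  have -> : [set w | all (fun c => B a c.1 w <= c.2) [seq (c.1.2, c.2) | c <- Ln a]] = G a.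
    have e w : all (fun c => B a c.1 w <= c.2) [seq (c.1.2, c.2) | c <- Ln a] =
        all (fun c => bcoord B c.1 w <= c.2) (Ln a).
      rewrite all_map; apply: eq_in_all => c; rewrite mem_filter => /andP[/eqP ca _].
      by rewrite /bcoord ca.
    by apply/seteqP; split=> w /=; rewrite /G /cyl /= e.
  rewrite -qr => ->; first by rewrite muleC.
  move=> c /mapP[c' c'L ->] /=; have [k ck] := hk c' c'L; exists k => //.
  rewrite -(@grid_le R M) -ck -qr; move: c'L; rewrite mem_filter => /andP[/eqP ca /hL[_]].
  exact.
have PfE : (fine (P S))%:E = P S by rewrite fineK// fin_num_measure.
have mFg E : Fgen B J K (past_of q) E -> measurable E.
  by move=> hE; apply: (Fgen_measurable hN (@past_of_ge0 q)); exact: sub_sigma_algebra.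
have := @pi_lambda_eq _ _ _ P _ (Fgen B J K (past_of q)) id id S setT (fine (P S))
  (fine_ge0 (measure_ge0 _ _)) (@Fgen_setI _ _ _ _ B J K (past_of q)) mS measurableT
  (fun E hE => conj (mFg E hE) (mFg E hE)).
rewrite PfE probability_setT mule1 => /(_ erefl) h.
have [|_ _] := h _ H hH.
  by move=> _ [DJ [DK [L [h1 h2 h3 ->]]]]; rewrite setTI; exact: key.
by rewrite setTI /= setIC => ->; rewrite muleC.
Qed.

End MarkovIncrement.

Lemma normal_peak_le {R : realType} (s t : R) : 0 < s -> s <= t -> normal_peak t <= normal_peak s.
Proof.
move=> s0 st; have t0 := lt_le_trans s0 st.
have h (x : R) : 0 < x -> 0 < x ^+ 2 * pi *+ 2.
  by move=> x0; rewrite mulrn_wgt0// mulr_gt0 ?pi_gt0// exprn_gt0.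
rewrite /normal_peak lef_pV2 ?posrE ?sqrtr_gt0 ?h//.
rewrite ler_wsqrtr// lerMn2r /= ler_wpM2r ?pi_ge0//.
by rewrite lerXn2r// nnegrE ltW.
Qed.

Section NoTies.
Context {R : realType} {d : measure_display} {T : measurableType d}.
Variable P : probability T R.
Context {N : nat} (i0 : 'I_N) (mu : R) (y0 : 'I_N -> R).
Context (B : 'I_N -> R -> T -> R) (J : nat -> T -> R) (K : nat -> T -> 'I_N).
Hypothesis hN : BD_noise P B J K.

Definition dZ i w n : R := (stB i0 mu y0 B J K i w).1.1 n +
  (B n (J i.+1 w) w - B n (J i w) w) + mu * (J i.+1 w - J i w).

Section OneTie.
Context (i : nat) (a a' : 'I_N) (eps q dl : R).
Hypothesis aa' : a != a'.
Hypothesis dq : dyadic q.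
Hypothesis dl0 : 0 < dl.

Let Fm := g_sigma_algebraType (Fgen B J K (past_of a q)).
Let tau w := Num.max 0 (J i.+1 w).
Let stZ w := (stq i0 mu y0 q B J K i w).1.1.

(** The two sides of the tie equation, with the motion of [a] stopped at [q]. A tie means that its
    remaining increment equals [- V], and [V] is known from [past_of a q] since [a'] differs from
    [a]. *)
Let V w : R := stZ w a + (B a q w - B a (clip q (J i w)) w) + mu * (J i.+1 w - J i w) -
  eps * (stZ w a' + (B a' (tau w) w - B a' (clip q (J i w)) w) + mu * (J i.+1 w - J i w)).

Let q0 : 0 <= q := dyadic_ge0 dq.

Let tau_ge0 w : 0 <= tau w. Proof. by rewrite /tau le_max lexx. Qed.

Let mtau : measurable_fun setT (tau : Fm -> R).
Proof. by apply: measurable_maxr; [exact: measurable_cst|exact: Fgen_Jm]. Qed.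

Let cB n w : {within [set t : R | 0 <= t], continuous (fun t => B n t w)}.
Proof. by case: hN => hB _ _ _; case: (hB n). Qed.

Let mV : measurable_fun setT (V : Fm -> R).
Proof.
have [mZ _ _] := @measurable_stq _ _ _ P _ i0 mu y0 q B J K i (past_of a q) hN q0
  (fun c h => conj h.1 (fun _ => h.2)).
have mdJ : measurable_fun setT ((fun w => mu * (J i.+1 w - J i w)) : Fm -> R).
  by apply: measurable_funM => //; apply: measurable_funB; exact: Fgen_Jm.
have mcl n : measurable_fun setT ((fun w => B n (clip q (J i w)) w) : Fm -> R).
  apply: Fgen_time => //.
  - apply: measurable_maxr; first exact: measurable_cst.
    by apply: measurable_minr; [exact: Fgen_Jm|exact: measurable_cst].
  - by move=> w; exact: clip_ge0.
  - move=> m w; split; first by exists m; eexists.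
    move=> _; have /andP[h _] := dfloor_dceil m (clip_ge0 q (J i w)).
    exact: (le_trans h (clip_le _ q0)).
apply: measurable_funB.
  apply: measurable_funD => //; apply: measurable_funD; first exact: mZ.
  apply: measurable_funB => //.
  exact: (@Fgen_B _ _ _ _ B J K (past_of a q) (a, q) (conj dq (fun _ => lexx _))).
apply: measurable_funM => //.
apply: measurable_funD => //; apply: measurable_funD; first exact: mZ.
apply: measurable_funB => //; apply: Fgen_time => // m w; split; first by exists m; eexists.
by move=> /= e; case/eqP: aa'; rewrite e.
Qed.

Let FmT D : <<s Fgen B J K (past_of a q) >> D -> measurable D.
Proof. exact: (Fgen_measurable hN (@past_of_ge0 _ _ a q)). Qed.

Let mFmT (f : T -> R) : measurable_fun setT (f : Fm -> R) -> measurable_fun setT f.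
Proof.
move=> mf _ A mA; rewrite setTI; apply: FmT.
by have := mf measurableT A mA; rewrite setTI.
Qed.

Let C m (eta : R) : set T := [set w | q + dl <= J i.+1 w] `&`
  [set w | `|V w + (B a (dceil m (tau w)) w - B a q w)| <= eta].

Let mJl : <<s Fgen B J K (past_of a q) >> [set w | q + dl <= J i.+1 w].
Proof.
by apply: (@measurable_leR2 _ _ Fm); [exact: measurable_cst|exact: Fgen_Jm].
Qed.

Let mtr m k : <<s Fgen B J K (past_of a q) >> [set w | Num.truncn (tau w * 2 ^+ m) = k].
Proof.
have h : measurable_fun setT (fun w : Fm => tau w * 2 ^+ m) by apply: measurable_funM.
by have := h measurableT _ (measurable_truncn_fiber k); rewrite setTI.
Qed.

Let mC m (eta : R) : measurable (C m eta).
Proof.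
apply: measurableI; first exact: FmT.
apply: measurable_leR2; last exact: measurable_cst.
apply: measurableT_comp => //; apply: measurable_funD; first exact: mFmT.
apply: measurable_funB; last exact: (noiseM hN).
apply: (@measurable_select _ _ T _ (fun w => Num.truncn (tau w * 2 ^+ m))
  (fun k w => B a (grid m k.+1) w)).
  by move=> k; apply: FmT; exact: mtr.
by move=> k _ _; apply: (noiseM hN); exact: grid_ge0.
Qed.

(** The cells fix the discretised jump time [u] and the value of [V] up to [eta]. On each cell the
    increment must fall in an interval of length [3 * eta], and [u - q > dl] bounds its density. *)
Let PC m (eta : R) : 0 < eta -> (P (C m eta) <= (normal_peak (Num.sqrt dl) * (3 * eta))%:E)%E.
Proof.
move=> eta0.
have c0 : 0 <= normal_peak (Num.sqrt dl) * (3 * eta).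
  by rewrite mulr_ge0 ?normal_peak_ge0// mulr_ge0// ltW.
pose kf w := (Num.truncn (tau w * 2 ^+ m), Num.floor (V w / eta)).
have mkf c : <<s Fgen B J K (past_of a q) >> (kf @^-1` [set c]).
  case: c => l z.
  rewrite (_ : _ @^-1` _ = [set w | Num.truncn (tau w * 2 ^+ m) = l] `&`
      ([set w | z%:~R * eta <= V w] `&` [set w | V w < (z + 1)%:~R * eta])).
    apply: (@measurableI _ Fm); first exact: mtr.
    apply: (@measurableI _ Fm).
      by apply: (@measurable_leR2 _ _ Fm) => //; exact: measurable_cst.
    by apply: (@measurable_ltR _ _ Fm) => //; exact: measurable_cst.
  apply/seteqP; split=> w; rewrite /kf /=.
    move=> [-> <-]; split=> //; rewrite -ler_pdivlMr// -ltr_pdivrMr//.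
    by rewrite floor_le_tmp floorD1_gt.
  move=> [->]; rewrite -ler_pdivlMr// -ltr_pdivrMr// => -[h1 h2].
  by congr pair; apply: floor_def; rewrite h1 h2.
apply: (partition_le c0 (fun c => FmT (mkf c)) (mC m eta)) => -[l z].
pose u : R := grid m l.+1.
have du : dyadic u by exists m, l.+1.
pose H := kf @^-1` [set (l, z)] `&` [set w | q + dl <= J i.+1 w].
have hH : <<s Fgen B J K (past_of a q) >> H.
  exact: (@measurableI _ Fm _ _ (mkf _) mJl).
pose A : set R := `[- eta - (z + 1)%:~R * eta, eta - z%:~R * eta]%classic.
have mA : measurable A by exact: measurable_itv.
have sub : C m eta `&` kf @^-1` [set (l, z)] `<=`
    H `&` (fun w => (B a u w - B a q w)%R) @^-1` A.
  move=> w [[h1 h2] hk]; split; first by split.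
  move: hk; rewrite /kf /= => -[hl hz].
  rewrite /A /= in_itv /=; move: h2; rewrite /= /dceil hl -/u ler_norml => /andP[h2 h3].
  have := floor_le_tmp (V w / eta); have := floorD1_gt (V w / eta).
  by rewrite hz ler_pdivlMr// ltr_pdivrMr//; move: h2 h3; lra.
have uH w : H w -> q + dl < u.
  move=> [[hl _]] /= h; have /andP[_] := dfloor_dceil m (tau_ge0 w).
  rewrite /dceil hl -/u; apply: le_lt_trans; apply: (le_trans h).
  by rewrite /tau le_max lexx orbT.
have mI : measurable (H `&` (fun w => (B a u w - B a q w)%R) @^-1` A).
  apply: measurableI; first exact: FmT.
  have : measurable_fun setT (fun w => B a u w - B a q w).
    by apply: measurable_funB; apply: (noiseM hN) => //; exact: dyadic_ge0.
  by move=> /(_ measurableT A mA); rewrite setTI.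
have mkT := FmT (mkf (l, z)).
apply: (@le_trans _ _ (P (H `&` (fun w => (B a u w - B a q w)%R) @^-1` A))).
  by apply: le_measure => //; rewrite ?inE//; exact: measurableI.
have [hu|hu] := ltP (q + dl) u; last first.
  rewrite (_ : H = set0) ?set0I ?measure0 ?mule_ge0//.
  by apply/seteqP; split=> w // /uH; rewrite ltNge hu.
have qu : q < u by move: hu dl0; lra.
rewrite (increment_indep hN dq du qu mA hH) muleC.
have [hB _ _ _] := hN; have [_ _ _ hn _] := hB a.
rewrite hn//; apply: lee_pmul => //.
  apply: le_trans (normal_itv_le _ _) _.
  - by rewrite sqrtr_gt0 subr_gt0.
  - by rewrite intrD; move: eta0; lra.
  rewrite lee_fin; apply: ler_pM; rewrite ?normal_peak_ge0//.
  - by rewrite intrD; move: eta0; lra.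
  - by apply: normal_peak_le; rewrite ?sqrtr_gt0// ler_wsqrtr//; move: hu; lra.
  - by rewrite intrD; move: eta0; lra.
by apply: le_measure; rewrite ?inE//; [exact: FmT|exact: subIsetl].
Qed.

Let G (eta : R) M := \bigcap_(m in [set m | (M <= m)%N]) C m eta.

Let PG (eta : R) : 0 < eta ->
  (P (\bigcup_M G eta M) <= (normal_peak (Num.sqrt dl) * (3 * eta))%:E)%E.
Proof.
move=> eta0.
have mG M : measurable (G eta M) by apply: bigcap_measurable => //; exists M; exact: leqnn.
have ndG : nondecreasing_seq (G eta).
  move=> M M' MM'; apply/subsetPset => w h m /= hm; apply: h => /=.
  exact: leq_trans hm.
have h : (P \o G eta) x @[x --> \oo] --> P (\bigcup_M G eta M).
  by apply: nondecreasing_cvg_mu => //; exact: bigcupT_measurable.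
rewrite -(cvg_lim _ h)//; apply: lime_le; first by apply: cvgP; exact: h.
apply: nearW => M /=; apply: le_trans (PC M eta0).
by apply: le_measure; rewrite ?inE// => w; apply => /=.
Qed.

(* Given the jump times and all other Brownian motions, a tie at time [J i.+1]
   prescribes the increment of [B a] after [q], which has a bounded density. *)
Lemma tie_negligible : P.-negligible [set w | [/\ goodset J w, J i w <= q,
  q + dl <= J i.+1 w & dZ i w a = eps * dZ i w a']].
Proof.
have mG (eta : R) : measurable (\bigcup_M G eta M).
  by apply: bigcupT_measurable => M; apply: bigcap_measurable => //; exists M; exact: leqnn.
exists (\bigcap_r \bigcup_M G r.+1%:R^-1 M); split.
- exact: bigcapT_measurable.
- apply/eqP; rewrite eq_le measure_ge0 andbT; apply/lee_addgt0Pr => e e0; rewrite add0e.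
  pose c := normal_peak (Num.sqrt dl) * 3.
  have c0 : 0 <= c by rewrite mulr_ge0 ?normal_peak_ge0.
  have ec : 0 < e / (c + 1) by rewrite divr_gt0//; move: c0; lra.
  have [r _ /(_ r (leqnn r)) /= hr] := near_infty_natSinv_lt (PosNum ec).
  have r0 : 0 < r.+1%:R^-1 :> R by rewrite invr_gt0.
  apply: (@le_trans _ _ (P (\bigcup_M G r.+1%:R^-1 M))).
    by apply: le_measure; rewrite ?inE//; [exact: bigcapT_measurable|move=> w; apply].
  apply: (le_trans (PG r0)); rewrite lee_fin mulrA -/c.
  have h : (c + 1) * r.+1%:R^-1 <= e.
    by move: (ltW hr); rewrite ler_pdivlMr 1?mulrC//; move: c0; lra.
  by apply: le_trans h; rewrite ler_wpM2r ?(ltW r0)// lerDl.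
- move=> w /= [g h1 h2 h3] r _.
  have r0 : 0 < r.+1%:R^-1 :> R by rewrite invr_gt0.
  have [j0 jS _] := g.
  have J0 l : 0 <= J l w by rewrite -j0 (@j_mono _ (J^~ w)).
  have tE : tau w = J i.+1 w by rewrite /tau (max_idPr (J0 _)).
  have V0 : V w + (B a (tau w) w - B a q w) = 0.
    rewrite /V /stZ (stqE _ _ _ _ _ g h1) tE clip_id//.
    by move: h3; rewrite /dZ; lra.
  have cv : B a (dceil m (tau w)) w @[m --> \oo] --> B a (tau w) w.
    apply: (within_continuous_seq (@cB a w)) => //; first by move=> m; exact: grid_ge0.
    exact: dceil_cvg.
  have [M _ hM] := (cvgrPdist_le _ _).1 cv _ r0.
  exists M => // m /= Mm; split => //=.
  rewrite (_ : _ + _ = - (B a (tau w) w - B a (dceil m (tau w)) w)).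
    by rewrite normrN; exact: hM.
  by move: V0; lra.
Qed.

End OneTie.

(** Equal absolute values mean equality up to a sign, and each gap contains a dyadic [q] followed by
    a margin [r.+1%:R^-1]. Ties are therefore covered by countably many negligible events. *)
Lemma no_ties : {ae P, forall w, goodset J w -> forall i (a a' : 'I_N), a != a' ->
  `|dZ i w a| != `|dZ i w a'|}.
Proof.
pose I : Type := (nat * ('I_N * 'I_N) * bool * (nat * nat) * nat)%type.
pose bad (x : I) : set T := let: (i, (a, a'), s, (m, k), r) := x in
  [set w | [/\ goodset J w, J i w <= grid m k, grid m k + r.+1%:R^-1 <= J i.+1 w &
    a != a' /\ dZ i w a = (-1) ^+ s * dZ i w a']].
have hbad x : P.-negligible (bad x).
  case: x => [[[[i [a a']] s] [m k]] r].
  have [e|ne] := eqVneq a a'.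
    rewrite (_ : bad _ = set0); first exact: negligible_set0.
    by apply/seteqP; split=> w //= [_ _ _ [+ _]]; rewrite e eqxx.
  apply: negligibleS (@tie_negligible i a a' ((-1) ^+ s) (grid m k) r.+1%:R^-1 ne _ _).
  - by move=> w /= [? ? ? [_ ?]].
  - by exists m, k.
  - by rewrite invr_gt0.
have : {ae P, forall w n, if unpickle n is Some x then ~ bad x w else True}.
  apply: ae_foralln => n; case: (unpickle n) => [x|]; last exact: aeW.
  by apply: negligibleS (hbad x) => w /= /contrapT.
apply: filterS => w hw g i a a' ne; apply/negP => /eqP h.
have [j0 jS _] := g.
have J0 l : 0 <= J l w by rewrite -j0 (@j_mono _ (J^~ w)).
have [s hs] : exists s : bool, dZ i w a = (-1) ^+ s * dZ i w a'.
  move/eqP: h; rewrite eqr_norm2 => /orP[] /eqP ->; first by exists false; rewrite expr0 mul1r.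
  by exists true; rewrite expr1 mulN1r.
(* The dyadic time just after [J i] uses at most half of the gap, and the margin fits in the other
   half. *)
pose g0 := J i.+1 w - J i w.
have g00 : 0 < g0 / 2 by rewrite divr_gt0// subr_gt0.
have [m _ hm] := (cvgrPdist_le _ _).1 (dceil_cvg (J0 i)) _ g00.
have {}hm := hm m (leqnn m).
have /andP[_ hm'] := dfloor_dceil m (J0 i).
have [r _ /(_ r (leqnn r)) /= hr] := near_infty_natSinv_lt (PosNum g00).
pose x : I := (i, (a, a'), s, (m, (Num.truncn (J i w * 2 ^+ m)).+1), r).
have := hw (pickle x); rewrite pickleK; apply; split => //.
- exact: ltW.
- rewrite -/(dceil m (J i w)); have hr' : r.+1%:R^-1 < g0 / 2 := hr.
  move: hm hr'; rewrite /= ler_norml => /andP[+ _].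
  by move: (r.+1%:R^-1) (dceil _ _) => x1 x2; rewrite /g0; lra.
Qed.

End NoTies.

Lemma cvg_ratioP {R : realType} (f : R -> R) (c : R) :
  f t / t @[t --> +oo] --> c <->
  forall e, 0 < e -> exists t0, forall t, t0 <= t -> `|f t - c * t| <= e * t.
Proof.
have h t e : 0 < t -> (`|c - f t / t| <= e) = (`|f t - c * t| <= e * t).
  move=> t0; rewrite -[leLHS](_ : `|f t - c * t| / t = _) ?ler_pdivrMr//.
  rewrite -[in X in _ / X](gtr0_norm t0) -normf_div distrC; congr `|_|.
  by field; rewrite gt_eqF.
split=> [/cvgrPdist_le hf e e0|hf].
  have [M [_ hM]] := hf e e0; exists (Num.max 1 (M + 1)) => t.
  rewrite ge_max => /andP[t1 tM]; rewrite -h; first by apply: hM; move: tM; lra.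
  by move: t1; lra.
apply/cvgrPdist_le => e e0; have [t0 ht0] := hf e e0.
exists (Num.max 0 t0); split; first exact: num_real.
by move=> t; rewrite gt_max => /andP[t00 tt0]; rewrite h//; apply: ht0; exact: ltW.
Qed.

(** * The bee system with negative drift *)

Section BeeSpeed.
Context {R : realType} {N : nat} (i0 : 'I_N) (mu v : R) (y0 : 'I_N -> R).
Context (j : nat -> R) (k : nat -> 'I_N) (b b0 : 'I_N -> R -> R).
Context (Y : R -> 'I_N -> R) (sg : nat -> {perm 'I_N}).
Hypothesis j0 : j 0%N = 0.
Hypothesis jS : forall i, j i < j i.+1.
Hypothesis joo : forall x, exists i, x < j i.
Hypothesis vmu : v + mu < 0.
Hypothesis hX : forall n e, 0 < e -> exists t0, forall t, t0 <= t ->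
  `|Xt i0 mu y0 j k b t n - v * t| <= e * t.
Hypothesis hY : BD_path (@bee R) mu y0 j k b0 Y.
Let be l n := b n (j l).
Let Zs i := (st i0 mu y0 be j k i).1.1.
Let Xs i := (st i0 mu y0 be j k i).1.2.
Let dZ i := premove (Zs i) (fun n => be i.+1 n - be i n) (mu * (j i.+1 - j i)).
Hypothesis sg0 : sg 0%N = 1%g.
Hypothesis sgS : forall i n, sg i.+1 n = sg i ((st i0 mu y0 be j k i.+1).2 n).
Hypothesis hb : forall i n t, j i <= t -> t <= j i.+1 ->
  b n t - b n (j i) = b0 (sg i n) t - b0 (sg i n) (j i).
Hypothesis notie : forall i a a', a != a' -> `|dZ i a| != `|dZ i a'|.

Lemma bee_path_speed n e : 0 < e ->
  exists t0, forall t, t0 <= t -> `|Y t n - (v + mu) * t| <= e * t.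
Proof.
move=> e0.
(* With this error the drifted N-BBM stays below [(v + mu) / 2 * t < 0]. *)
have c0 : 0 < - (v + mu) / 2 by rewrite divr_gt0// oppr_gt0.
have e20 : 0 < e / 2 by rewrite divr_gt0.
have [t1 ht1] := eventually_all (fun n => hX n c0).
have [t2 ht2] := eventually_all (fun n => hX n e20).
have [i1 hi1] := joo (Num.max 0 t1).
have ji1 i : (i1 <= i)%N -> 0 < j i /\ t1 <= j i.
  move=> ii; have := lt_le_trans hi1 (j_mono jS ii).
  by rewrite gt_max => /andP[-> /ltW ->].
have neg i m : (i1 <= i)%N -> dZ i m < 0.
  move=> ii; have [p1 p2] := ji1 i.+1 (leqW ii).
  apply: (le_lt_trans (coupled_premove_dom i0 mu y0 k b j0 i m)).
  have := ht1 _ m p2; rewrite Xt_j// ler_norml => /andP[_ h].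
  have : (v + mu) / 2 * j i.+1 < 0 by rewrite pmulr_llt0//; move: c0; lra.
  by move: h; lra.
(* The largest discrepancy at index [i1], from which all bee particles are negative just before each
   jump; it cannot grow afterwards. *)
pose C := \big[Num.max/0]_m (Xs i1 m + mu * j i1 - Zs i1 m).
have hC m : Xs i1 m + mu * j i1 <= Zs i1 m + C by rewrite -lerBlDl; exact: le_bigmax.
have C0 : 0 <= C by exact: bigmax_ge_id.
have low := @coupled_dom_ge _ _ i0 mu y0 j k b C i1 hC neg.
have up := coupled_dom i0 mu y0 k b j0.
exists (Num.max (j i1) (Num.max t2 (2 * C / e))) => t.
rewrite !ge_max => /and3P[tj tt2 tC].
have t0 : 0 <= t by apply: le_trans tj; rewrite -j0; exact: j_mono.
have ii : (i1 <= idx j t)%N.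
  have /andP[_ h] := idxP j0 joo t0; rewrite -ltnS ltnNge; apply/negP => /(j_mono jS).
  by rewrite leNgt (le_lt_trans tj h).
have [p [Zt [hYt hZt]]] := bee_relabel j0 jS joo hY sg0 sgS hb notie t0.
have [m hm] := nth_sorted_ex Zt n.
rewrite hYt hm -[m](permKV p) hZt; set m' := (p^-1 m)%g.
have h1 := low _ m' ii; have h2 := up (idx j t) m'.
have := ht2 t m' tt2; rewrite /Xt !ler_norml => /andP[h3 h4].
have h5 : C <= e / 2 * t by move: tC; rewrite ler_pdivrMr//; lra.
by apply/andP; split; move: h1 h2 h3 h4; rewrite /Zs /Xs /be; lra.
Qed.

End BeeSpeed.

Section NegativeDrift.
Context {R : realType} {d : measure_display} {T : measurableType d}.
Variable P : probability T R.
Context {N : nat} (hN : (2 <= N)%N) (v mu : R) (y0 : 'I_N -> R).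
Hypothesis hv : NBBM_speed (ltnW hN) v.
Implicit Types (B : 'I_N -> R -> T -> R) (J : nat -> T -> R) (K : nat -> T -> 'I_N).
Let i0 := first_ord (ltnW hN).

(** The sign of [v] is stated inside the almost sure event because it is read off a path. *)
Lemma coupled_speed B J K : BD_noise P B J K ->
  {ae P, forall w, [/\ goodset J w, 0 <= v & forall n e, 0 < e -> exists t0, forall t, t0 <= t ->
    `|Xt i0 mu y0 (J^~ w) (K^~ w) (fun n t => B n t w) t n - v * t| <= e * t]}.
Proof.
move=> hn.
have lt : (N.-1 < N)%N by rewrite ltn_predL ltnW.
pose top : 'I_N := Ordinal lt.
have [L hL] := ae_windowed hN top hn.
pose X w t n := nth 0 (sorted_pos (Xt i0 mu y0 (J^~ w) (K^~ w) (fun n t => B n t w) t)) (n : 'I_N).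
have hX : {ae P, forall w, BD_path (fun x => x) 0 y0 (fun i => J i w) (fun i => K i w)
    (fun n t => B n t w) (X w)}.
  apply: filterS hL => w hw; have joo := windowed_unbounded hw.
  have [j0 jS _] := hw; exact: Xt_BD_path.
have hspeed := hv hn hX.
have hB : {ae P, forall w (n : 'I_N) e, 0 < e -> exists t0, forall t, t0 <= t ->
    `|B n t w| <= e * t}.
  have h l : {ae P, forall w (n : 'I_N), n = l :> nat -> forall e, 0 < e -> exists t0,
      forall t, t0 <= t -> `|B n t w| <= e * t}.
    have [lN|Nl] := ltnP l N; last first.
      by apply: aeW => w n nl; move: (ltn_ord n); rewrite nl ltnNge Nl.
    have [hB' _ _ _] := hn; apply: filterS (BM_sublinear (hB' (Ordinal lN))) => w hw n nl.
    by have -> : n = Ordinal lN by exact: val_inj.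
  by apply: filterS (ae_foralln h) => w hw n; exact: (hw n n erefl).
apply: filterS (filterI hL (filterI hspeed hB)) => w [hw [hs hBw]].
have joo := windowed_unbounded hw; have [j0 jS _] := hw.
have ht := windowed_tops hw.
have hs' := (cvg_ratioP _ _).1 hs.
split; first by split.
  exact: (@speed_ge0 _ _ i0 top mu v y0 (J^~ w) (K^~ w) (fun n t => B n t w)).
exact: (@label_speed _ _ i0 top mu v y0 (J^~ w) (K^~ w) (fun n t => B n t w)).
Qed.

(** The coupling runs on [Binf] and the given system on [B]; [sg] translates between them. All ranks
    are treated because reflection exchanges the first and the last one. *)
Lemma bee_speed_neg B J K (Y : T -> R -> 'I_N -> R) : BD_noise P B J K -> v + mu < 0 ->
  {ae P, forall w, BD_path (@bee R) mu y0 (fun i => J i w) (fun i => K i w)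
    (fun n t => B n t w) (Y w)} ->
  {ae P, forall w n, Y w t n / t @[t --> +oo] --> v + mu}.
Proof.
move=> hn vmu hY.
have hn' := Binf_noise i0 mu y0 hn.
apply: filterS (filterI (coupled_speed hn') (filterI (no_ties i0 mu y0 hn') hY)).
move=> w [[g _ hX] [nt hYw]] n; apply/cvg_ratioP => e e0.
have [j0 jS joo] := g.
apply: (@bee_path_speed _ _ i0 mu v y0 (J^~ w) (K^~ w)
  (fun n t => Binf i0 mu y0 B J K n t w) (fun n t => B n t w) (Y w)
  (sg i0 mu y0 B J K w)) => //.
- by move=> i n' /=; rewrite permM.
- by move=> i n' t; exact: Binf_increment.
- exact: nt.
Qed.

End NegativeDrift.

(** * Reflection *)

Section NormalSymmetry.
Context {R : realType}.

Lemma normal_prob_opp (s : R) (A : set R) : 0 < s -> measurable A ->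
  normal_prob 0 s (-%R @^-1` A) = normal_prob 0 s A.
Proof.
move=> s0 mA; have sn0 : s != 0 by rewrite gt_eqF.
pose C : set (set R) := [set E | exists x y : R, E = `[x, y]%classic].
have CI : setI_closed C.
  move=> _ _ [x [y ->]] [x' [y' ->]]; exists (Num.max x x'), (Num.min y y').
  apply/seteqP; split=> z /=; rewrite !in_itv /= ge_max le_min.
    by move=> [/andP[-> ->] /andP[-> ->]].
  by move=> /andP[/andP[-> ->] /andP[-> ->]].
have opp (x y : R) : -%R @^-1` `[x, y]%classic = `[(- y)%R, (- x)%R]%classic.
  have e z : (x <= - z <= y) = (- y <= z <= - x) by rewrite lerNr (lerNl z) andbC.
  by apply/seteqP; split=> z /=; rewrite !in_itv /= e.
have key E : C E -> normal_prob 0 s (-%R @^-1` E) = normal_prob 0 s E.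
  move=> [x [y ->]]; rewrite opp; have [xy|yx] := leP x y; last first.
    by rewrite !set_itv_ge// bnd_simp -?ltNge ?ltrN2.
  rewrite /normal_prob integration_by_substitution_oppr//; last first.
    by apply: continuous_subspaceT; exact: continuous_normal_pdf.
  apply: eq_integral => z _; congr (_%:E); rewrite !normal_pdfE//=.
  by rewrite /normal_fun !subr0 sqrrN.
have hA : <<s C >> A.
  have : measurable_fun setT (id : g_sigma_algebraType C -> R).
    apply: measurable_fun_leR => a.
    rewrite (_ : [set w | _] = \bigcup_n `[a - n%:R, a]%classic).
      apply: (@bigcupT_measurable _ (g_sigma_algebraType C)) => n.
      by apply: sub_sigma_algebra; exists (a - n%:R), a.
    apply/seteqP; split=> z /=; last by move=> [n _]; rewrite /= in_itv /= => /andP[].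
    move=> za; exists (Num.truncn (a - z)).+1 => //=; rewrite in_itv /= za andbT.
    by have := truncnS_gt (a - z); lra.
  by move=> /(_ measurableT A mA); rewrite setTI.
have := @pi_lambda_eq _ _ _ (normal_prob 0 s) R C -%R id setT setT 1 ler01 CI
  measurableT measurableT.
rewrite mul1e => h; have [| | |_ _] := h _ _ _ A hA.
- by move=> _ [x [y ->]]; rewrite opp; split; exact: measurable_itv.
- by [].
- by move=> E hE; rewrite !setTI mul1e; exact: key.
- by rewrite !setTI mul1e.
Qed.

End NormalSymmetry.

Section Reflection.
Context {R : realType} {d : measure_display} {T : measurableType d}.
Variable P : probability T R.

Lemma rv_sys_opp (X : T -> R) : rv_sys (fun w => - X w) = rv_sys X.
Proof.
have opp (U : T -> R) : rv_sys (fun w => - U w) `<=` rv_sys U.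
  move=> _ [A mA <-]; exists (-%R @^-1` A) => //=.
  have : measurable_fun setT (-%R : R -> R) by exact: measurable_funN.
  by move=> /(_ measurableT A mA); rewrite setTI.
apply/seteqP; split; first exact: opp.
by have := @opp (fun w => - X w); under eq_fun do rewrite opprK.
Qed.

Lemma BM_sys_opp (W : R -> T -> R) : BM_sys (fun t w => - W t w) = BM_sys W.
Proof. by rewrite /BM_sys; under eq_fun do under eq_exists do rewrite rv_sys_opp. Qed.

Lemma std_BM_opp (W : R -> T -> R) : std_BM P W -> std_BM P (fun t w => - W t w).
Proof.
move=> [h1 h2 h3 h4 h5]; split.
- by move=> t t0; apply: measurable_funN; exact: h1.
- by move=> w; rewrite h2 oppr0.
- move=> w; apply/within_continuousP => x x0 e e0.
  have [dl dl0 hdl] := (within_continuousP _).1 (h3 w) x x0 e e0.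
  by exists dl => // y y0 hy; rewrite -opprD normrN; exact: hdl.
- move=> s t s0 st A mA; rewrite -normal_prob_opp ?sqrtr_gt0 ?subr_gt0//.
  rewrite -h4//; last first.
    have : measurable_fun setT (-%R : R -> R) by exact: measurable_funN.
    by move=> /(_ measurableT A mA); rewrite setTI.
  by congr (P _); apply/seteqP; split=> w /=; rewrite opprB opprK addrC.
- move=> tt tt0 ttS; have := h5 tt tt0 ttS; congr indep_nat.
  apply/funext => i; rewrite -rv_sys_opp; congr rv_sys.
  by apply/funext => w; rewrite opprD.
Qed.

Context {N : nat}.

Lemma Ksys_rev (k : T -> 'I_N) : Ksys (fun w => rev_ord (k w)) = Ksys k.
Proof.
have rev (k' : T -> 'I_N) : Ksys (fun w => rev_ord (k' w)) `<=` Ksys k'.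
  by move=> _ [A _ <-]; exists (@rev_ord N @^-1` A).
apply/seteqP; split; first exact: rev.
by have := @rev (fun w => rev_ord (k w)); under eq_fun do rewrite rev_ordK.
Qed.

Lemma BD_noise_opp (B : 'I_N -> R -> T -> R) (J : nat -> T -> R) (K : nat -> T -> 'I_N) :
  BD_noise P B J K ->
  BD_noise P (fun n t w => - B n t w) J (fun i w => rev_ord (K i w)).
Proof.
move=> [hB hJ [k1 k2 k3] hI]; split => //.
- by move=> n; exact: std_BM_opp.
- split.
  + by move=> i A; exact: (k1 i (@rev_ord N @^-1` A)).
  + move=> i k; rewrite -(k2 i (rev_ord k)); congr (P _).
    by apply/seteqP; split=> w /=; [move=> <-; rewrite rev_ordK|move=> ->; rewrite rev_ordK].
  + by have := k3; congr indep_nat; apply/funext => i; rewrite Ksys_rev.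
- have := hI; congr indep_fin; apply/funext => -[n|[]] //.
    by rewrite BM_sys_opp.
  by apply/seteqP; split=> E [i hi]; exists i; move: hi; rewrite Ksys_rev.
Qed.

Lemma sorted_pos_opp (z : 'I_N -> R) (n : 'I_N) :
  nth 0 (sorted_pos (fun n => - z n)) n = - nth 0 (sorted_pos z) (rev_ord n).
Proof.
have sz : size (sorted_pos z) = N by rewrite size_sort size_map size_enum_ord.
have -> : sorted_pos (fun n => - z n) = rev (map -%R (sorted_pos z)).
  apply: (sorted_eq le_trans le_anti).
  - by apply: sort_sorted; exact: le_total.
  - rewrite rev_sorted sorted_map.
    rewrite (eq_sorted (e' := <=%R)); first by apply: sort_sorted; exact: le_total.
    by move=> x y /=; rewrite lerN2.
  - rewrite perm_sort perm_sym perm_rev /sorted_pos.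
    rewrite (map_comp -%R z); apply: perm_map.
    by rewrite perm_sort.
by rewrite nth_rev size_map sz// (nth_map 0) ?sz ?rev_ord_proof.
Qed.

(** The score is even, so the same particle is removed. Ranks are reversed, so the choices must be
    reversed as well, which keeps them uniform. *)
Lemma BD_path_opp (mu : R) (y0 : 'I_N -> R) (j : nat -> R) (k : nat -> 'I_N)
    (b : 'I_N -> R -> R) (Y : R -> 'I_N -> R) :
  BD_path (@bee R) mu y0 j k b Y ->
  BD_path (@bee R) (- mu) (fun n => - y0 n) j (fun i => rev_ord (k i))
    (fun n t => - b n t) (fun t n => - Y t (rev_ord n)).
Proof.
move=> [Z [Z0 Zmove Zjump ZY]]; exists (fun t n => - Z t n); split.
- by rewrite Z0.
- by move=> i t n h1 h2; rewrite (Zmove i t n h1 h2); ring.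
- move=> i zm; have [m [hm hZ]] := Zjump i.
  pose zm' n := Z (j i) n + (b n (j i.+1) - b n (j i)) + mu * (j i.+1 - j i).
  have e : zm = (fun n => - zm' n) by apply/funext => n; rewrite /zm /zm'; ring.
  exists m; split=> n; first by rewrite e /bee !normrN; exact: hm.
  rewrite hZ e sorted_pos_opp rev_ordK; by case: ifP.
- by move=> t n t0; rewrite ZY// sorted_pos_opp.
Qed.

End Reflection.

Theorem mainTheorem3 (R : realType) (N : nat) (hN : (2 <= N)%N) (v mu : R)
  (hv : NBBM_speed (ltnW hN) v) (hmu : v < `|mu|)
  (d : measure_display) (T : measurableType d) (P : probability T R)
  (B : 'I_N -> R -> T -> R) (J : nat -> T -> R) (K : nat -> T -> 'I_N)
  (hnoise : BD_noise P B J K)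
  (y0 : 'I_N -> R) (Y : T -> R -> 'I_N -> R)
  (hY : {ae P, forall w, BD_path (fun x => - `|x|) mu y0 (fun i => J i w)
                  (fun i => K i w) (fun n t => B n t w) (Y w)}) :
  {ae P, forall w, Y w t (first_ord (ltnW hN)) / t @[t --> +oo]
                     --> (1 - v / `|mu|) * mu}.
Proof.
have [mu0|mu0|mu0] := ltgtP mu 0.
- have e : (1 - v / `|mu|) * mu = v + mu.
    by rewrite ltr0_norm//; field; rewrite lt_eqF.
  rewrite e; rewrite ltr0_norm// in hmu.
  have vmu : v + mu < 0 by move: hmu; lra.
  by apply: filterS (bee_speed_neg hv hnoise vmu hY) => w; apply.
- have e : (1 - v / `|mu|) * mu = - (v + - mu).
    by rewrite gtr0_norm//; field; rewrite gt_eqF.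
  rewrite e; rewrite gtr0_norm// in hmu.
  have vmu : v + - mu < 0 by rewrite subr_lt0.
  have hY' : {ae P, forall w, BD_path (@bee R) (- mu) (fun n => - y0 n) (fun i => J i w)
      (fun i => rev_ord (K i w)) (fun n t => - B n t w) (fun t n => - Y w t (rev_ord n))}.
    by apply: filterS hY => w; exact: BD_path_opp.
  apply: filterS (bee_speed_neg hv (BD_noise_opp hnoise) vmu hY') => w.
  move=> /(_ (rev_ord (first_ord (ltnW hN)))); rewrite rev_ordK => h.
  have -> : (fun t => Y w t (first_ord (ltnW hN)) / t) =
      (fun t => - (- Y w t (first_ord (ltnW hN)) / t)).
    by apply/funext => t; rewrite mulNr opprK.
  exact: cvgN.
- by apply: filterS (coupled_speed mu y0 hv hnoise) => w [_ + _]; move: hmu; rewrite mu0 normr0; lra.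
Qed.
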